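(* Let $\mathcal{H}$ be the Fock space with orthonormal basis of Fock states $\{|0\rangle,|1\rangle,|2\rangle,\dots\}$, let $\bar{B}_1=\{|\psi\rangle\in\mathcal{H}:\||\psi\rangle\|=1\}$, and fix a target photon number $\bar n\in\{0,1,2,\dots\}$ and real parameters $\theta,\phi$ satisfying Assumption A1: the eigenvalues of $M_g$ and of $M_e$ (defined in the context) are non-degenerate (equivalently, $\pi/\phi$ is not rational). Then for every $\epsilon>0$ and every $C>0$ there exist constants $\delta>0$ and $\bar\alpha>0$ such that, for the closed-loop Markov process described in the context (with Lyapunov function $V=V_\delta$ and control bound $\bar\alpha$), and for every probability measure $\mu$ on $\bar{B}_1$ with $\mathbb{E}_\mu[V]\le C$, the sequence of laws $\Gamma_k(\mu)$ converges to its limit set $\Omega$ (the set of weak-$\ast$ limits of subsequences of $(\Gamma_k(\mu))_k$), and for every $\mu_\infty\in\Omega$: every $|\psi\rangle\in\operatorname{supp}(\mu_\infty)$ is one of the Fock states $|n\rangle$, and $$\mu_\infty(\{|\bar n\rangle\})\ge 1-\epsilon .$$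
   Context: Let $a$ be the annihilation operator, $a|n\rangle=\sqrt{n}\,|n-1\rangle$, $a^\dagger$ its adjoint, and $N=a^\dagger a$ the number operator, $N|n\rangle=n|n\rangle$. For $\alpha\in\mathbb{R}$ let $D_\alpha=\exp(\alpha(a^\dagger-a))$ (unitary displacement operator). Let $M_g=\cos(\theta+N\phi)$ and $M_e=\sin(\theta+N\phi)$, and set $\phi_n=\theta+n\phi$. Lyapunov function: for $\delta>0$ define $V:\bar B_1\to[0,\infty]$ by $$V(|\psi\rangle)=\sum_{n=0}^\infty\sigma_n|\langle\psi|n\rangle|^2+\delta\big(\cos^4\phi_{\bar n}+\sin^4\phi_{\bar n}\big)-\delta\big(\|M_g|\psi\rangle\|^4+\|M_e|\psi\rangle\|^4\big),$$ where $\sigma_{\bar n}=0$; for $n>\bar n$, $\sigma_n=\sum_{k=\bar n+1}^{n}\big(\tfrac1k+\tfrac1{k^2}\big)$; for $1\le n<\bar n$, $\sigma_n=\sum_{k=n+1}^{\bar n}\big(\tfrac1k-\tfrac1{k^2}\big)$; and if $0<\bar n$, $\sigma_0=\tfrac18+\sum_{k=1}^{\bar n}\big(\tfrac1k-\tfrac1{k^2}\big)$. Closed-loop dynamics: given $|\psi_k\rangle\in\bar B_1$, set $|\psi_{k+1/2}\rangle=M_s|\psi_k\rangle/\|M_s|\psi_k\rangle\|$ with probability $\|M_s|\psi_k\rangle\|^2$, for $s\in\{g,e\}$; then $|\psi_{k+1}\rangle=D_{\alpha_k}|\psi_{k+1/2}\rangle$ with feedback $\alpha_k\in\arg\min_{\alpha\in[-\bar\alpha,\bar\alpha]}V(D_\alpha|\psi_{k+1/2}\rangle)$.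 This defines a discrete-time Markov process on $\bar B_1$; $\Gamma_k(\mu)$ denotes the probability distribution of $|\psi_k\rangle$ when $|\psi_0\rangle$ has distribution $\mu$. Weak-$\ast$ convergence: $\mu_n\to\mu$ if $\mathbb{E}_{\mu_n}[f]\to\mathbb{E}_\mu[f]$ for every bounded continuous $f$ on $\bar B_1$ (norm topology).
   Formalization: Fock states are taken up to a global phase (c|n⟩ with |c|=1), in the support claim and in the mass of the target, since starting at i|n̄⟩ the literal claim fails; Assumption A1 is the non-degeneracy of the eigenvalues, not the parenthetical irrationality of π/φ. *)

(* Defs.v *)
From HB Require Import structures.
From mathcomp Require Import all_boot all_algebra.
From mathcomp Require Import all_classical all_reals all_analysis.
From mathcomp Require Export complex.
Set Implicit Arguments. Unset Strict Implicit. Unset Printing Implicit Defensive.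
Import GRing.Theory Num.Theory.
Local Open Scope classical_set_scope.
Local Open Scope ring_scope.

Section Fock.
Variable R : realType.

(* Vectors of the Fock space, written in the Fock basis |0>,|1>,|2>,...:
   psi n = <n|psi>. *)
Definition cseq := nat -> R[i].

Definition sqmod (z : R[i]) : R := (complex.Re z) ^+ 2 + (complex.Im z) ^+ 2.

Definition nrm2 (psi : cseq) : \bar R := (\sum_(0 <= n <oo) (sqmod (psi n))%:E)%E.

Definition fock (m : nat) : cseq := fun n => if n == m then 1 else 0.

Definition unit_vec (psi : cseq) : Prop := nrm2 psi = 1%:E.

Lemma unit_fock0 : unit_vec (fock 0).
Proof.
rewrite /unit_vec /nrm2 (nneseries_split 0 1).
  rewrite big_nat1 (@eseries0 _ _ _ xpredT); last first.
    by move=> i; rewrite add0n /fock; case: i => //= i _ _; rewrite /sqmod /= expr2 mul0r addr0.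
  by rewrite adde0 /fock /= /sqmod /= expr1n expr2 mul0r addr0.
by move=> k _; rewrite lee_fin /sqmod addr_ge0 // sqr_ge0.
Qed.

Record state := State { svec :> nat -> R[i] ; sunit : unit_vec svec }.

HB.instance Definition _ := gen_eqMixin state.
HB.instance Definition _ := gen_choiceMixin state.
HB.instance Definition _ := isPointed.Build state (State unit_fock0).

Definition sball (psi : state) (r : R) : set state :=
  [set phi : state | (nrm2 (fun n => (psi n - phi n)%R) < (r ^+ 2)%:E)%E].

Definition sopen (U : set state) : Prop :=
  forall psi, U psi -> exists2 r : R, 0 < r & sball psi r `<=` U.

Definition Bstate := g_sigma_algebraType sopen.

Definition scontinuous (f : state -> R) : Prop :=
  forall psi (e : R), 0 < e -> exists2 d : R, 0 < d &
    forall phi, sball psi d phi -> `|f psi - f phi| < e.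

Definition sbounded (f : state -> R) : Prop := exists M : R, forall psi, `|f psi| <= M.

Definition Eexp (mu : probability Bstate R) (f : state -> \bar R) : \bar R :=
  (\int[mu]_x f x)%E.

Definition wconv (nu : nat -> probability Bstate R) (mu : probability Bstate R) : Prop :=
  forall f : state -> R, sbounded f -> scontinuous f ->
    (fun k => Eexp (nu k) (fun x => (f x)%:E)) @ \oo --> Eexp mu (fun x => (f x)%:E).

Definition msupport (mu : probability Bstate R) : set state :=
  [set psi : state | forall r : R, 0 < r -> (0 < mu (sball psi r : set Bstate))%E].

Definition rC (x : R) : R[i] := Complex x 0.

(* annihilation a|n> = sqrt n |n-1>, i.e. (a psi)_n = sqrt(n+1) psi_(n+1) *)
Definition ann (psi : cseq) : cseq := fun n => rC (Num.sqrt (n.+1)%:R) * psi n.+1.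
Definition cre (psi : cseq) : cseq :=
  fun n => if n is m.+1 then rC (Num.sqrt n%:R) * psi m else 0.
Definition gen (psi : cseq) : cseq := fun n => cre psi n - ann psi n.

Definition exp_partial (alpha : R) (psi : cseq) (K : nat) : cseq :=
  fun n => \sum_(k < K) rC (alpha ^+ k / (k`!)%:R) * iter k gen psi n.

Definition trunc (N : nat) (psi : cseq) : cseq := fun n => if (n < N)%N then psi n else 0.

Definition l2lim (x : nat -> cseq) (y : cseq) : Prop :=
  (fun K => nrm2 (fun n => x K n - y n)) @ \oo --> 0%E.

(* D_alpha psi = exp(alpha (a^dag - a)) psi: the exponential series converges in norm
   on the finitely supported vectors trunc N psi (analytic vectors), and D_alpha is
   extended to H by continuity. *)
Definition disp_graph (alpha : R) (psi chi : cseq) : Prop :=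
  exists chiN : nat -> cseq,
    (forall N, l2lim (exp_partial alpha (trunc N psi)) (chiN N)) /\ l2lim chiN chi.

Definition disp (alpha : R) (psi : cseq) : cseq :=
  match pselect (exists chi, disp_graph alpha psi chi) with
  | left h => proj1_sig (cid h)
  | right _ => psi
  end.

(* view a vector as an element of \bar B_1 (the fallback is never used when the
   vector has norm one) *)
Definition tostate (chi : cseq) (fallback : state) : state :=
  match pselect (unit_vec chi) with
  | left h => State h
  | right _ => fallback
  end.

Definition Dst (alpha : R) (psi : state) : state := tostate (disp alpha psi) psi.

Definition phin (theta phi : R) (n : nat) : R := theta + n%:R * phi.
Definition Mg (theta phi : R) (psi : cseq) : cseq := fun n => rC (cos (phin theta phi n)) * psi n.
Definition Me (theta phi : R) (psi : cseq) : cseq := fun n => rC (sin (phin theta phi n)) * psi n.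

Definition A1 (theta phi : R) : Prop :=
  injective (fun n : nat => cos (phin theta phi n)) /\
  injective (fun n : nat => sin (phin theta phi n)).

Definition sigma (nbar n : nat) : R :=
  if (nbar < n)%N then \sum_(nbar.+1 <= k < n.+1) ((k%:R)^-1 + ((k%:R) ^+ 2)^-1)
  else if n == nbar then 0
  else if (0 < n)%N then \sum_(n.+1 <= k < nbar.+1) ((k%:R)^-1 - ((k%:R) ^+ 2)^-1)
  else 8^-1 + \sum_(1 <= k < nbar.+1) ((k%:R)^-1 - ((k%:R) ^+ 2)^-1).

Definition V (nbar : nat) (theta phi delta : R) (psi : state) : \bar R :=
  ((\sum_(0 <= n <oo) (sigma nbar n * sqmod (psi n))%R%:E)
   + (delta * (cos (phin theta phi nbar) ^+ 4 + sin (phin theta phi nbar) ^+ 4))%R%:E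
   - (delta * (fine (nrm2 (Mg theta phi psi)) ^+ 2 + fine (nrm2 (Me theta phi psi)) ^+ 2))%R%:E)%E.

Definition qprob (M : cseq -> cseq) (psi : state) : R := fine (nrm2 (M psi)).

Definition qhalf (M : cseq -> cseq) (psi : state) : state :=
  tostate (fun n => rC ((Num.sqrt (qprob M psi))^-1) * M psi n) psi.

Definition feedback (nbar : nat) (theta phi delta abar : R) (a : state -> R) : Prop :=
  forall chi : state, -abar <= a chi <= abar /\
    forall b : R, -abar <= b <= abar ->
      (V nbar theta phi delta (Dst (a chi) chi) <= V nbar theta phi delta (Dst b chi))%E.

Definition qnext (a : state -> R) (M : cseq -> cseq) (psi : state) : state :=
  Dst (a (qhalf M psi)) (qhalf M psi).

Definition law_seq (theta phi : R) (a : state -> R) (mu : probability Bstate R)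
    (nu : nat -> probability Bstate R) : Prop :=
  (forall A : set Bstate, measurable A -> nu 0%N A = mu A) /\
  forall k (A : set Bstate), measurable A ->
    nu k.+1 A = (\int[nu k]_psi
       ((qprob (Mg theta phi) psi)%:E * (\1_A (qnext a (Mg theta phi) psi) : R)%:E
      + (qprob (Me theta phi) psi)%:E * (\1_A (qnext a (Me theta phi) psi) : R)%:E))%E.

Definition in_limit_set (nu : nat -> probability Bstate R) (mu : probability Bstate R) : Prop :=
  exists f : nat -> nat, {homo f : m n / (m < n)%N >-> (m < n)%N} /\ wconv (nu \o f) mu.

Definition is_fock_ph (n : nat) (psi : state) : Prop :=
  exists c : R[i], sqmod c = 1 /\ forall m, psi m = c * fock n m.

End Fock.

(* Main.v *)
Require Import Defs.
From HB Require Import structures.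
From mathcomp Require Import all_boot all_order all_algebra.
From mathcomp Require Import all_classical all_reals all_analysis.
From mathcomp Require Import measurable_realfun.
From mathcomp Require Import complex lra ring zify.
Set Implicit Arguments. Unset Strict Implicit. Unset Printing Implicit Defensive.
Import Order.TTheory GRing.Theory Num.Theory.
Import numFieldNormedType.Exports.
Local Open Scope classical_set_scope.
Local Open Scope ring_scope.

(** Write W = sum_n sigma_n |psi_n|^2 and call the variance of cos^2 (phi_n) under the
    photon-number distribution |psi_n|^2 the spread of psi. Since alpha = 0 is an
    admissible control, V is a supermartingale, and a measurement alone lowers it in
    expectation by at least 2 delta spread^2. Near a Fock state |n> with n <> nbar,
    (n+1) sigma_(n+1) + n sigma_(n-1) < (2n+1) sigma_n, so displacing by a fixed small
    abar lowers V by a constant times abar^2. Summing the decrements, the expected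
    squared spread and the mass near each |n> with n <= n0, n <> nbar, tend to 0. By A1
    the spread vanishes only at Fock states, and the uniform bound on E[W] together with
    the divergence of sigma makes the mass beyond n0 at most eps.

    For the existence of weak limits, states concentrated on a single coordinate n are
    coded by a real number near 8n (the phase on the circle of |n>). The distribution
    functions of the codes converge at the rationals along a subsequence, hence their
    quantile functions converge almost everywhere, and the limit law is the image of the
    uniform measure on [0, 1]. *)

(** * The displacement flow *)

Section PowerSeries.
Variable R : realType.
Implicit Types (c : nat -> R) (M t : R).

(** The order in which the constants are fixed matters. The cutoff [n0] must make eps times sigma at
    [n0.+1] exceed the bound on the expected W. That bound is C + delta, whereas delta is chosen
    only once the gains near the states |n> with n <= n0 are known. Keeping delta <= 1 breaks the
    circle, since C + 1 then serves. The control size comes next, and the radius of the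
    neighbourhoods last.

    The displacement operator is defined only as a closure of exponential series. No group law is
    proved: V is compared at the controls 0 and [abar] alone, so times in [0, 1/4] suffice. At such
    times the flow of a finitely supported vector has coordinates that decay like 4^-n, so that
    cutting a sum at L costs C / 4^L, which disappears in the limit.

    Fock states occur up to a phase, so the limit laws live on countably many circles rather than on
    countably many points. This is why a state is coded by a real number and not by an integer. *)

Lemma pseries_bounded_cvg c M t :
  (forall k, `|c k| <= M) -> `|t| < 1 -> cvgn (pseries c t).
Proof.
move=> cM t1; apply: normed_cvg.
apply: (@series_le_cvg _ _ (geometric M `|t|)) => [k|k|k|].
- exact: normr_ge0.
- by rewrite mulr_ge0 ?exprn_ge0// (le_trans _ (cM k)).
- by rewrite /= normrM normrX ler_wpM2r ?exprn_ge0.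
- by apply: is_cvg_geometric_series; rewrite normr_id.
Qed.

Lemma cvgn_norm_le (u : nat -> R) (l B : R) :
  u @ \oo --> l -> (\forall n \near \oo, `|u n| <= B) -> `|l| <= B.
Proof.
move=> ul uB; have cl : (fun n => `|u n|) @ \oo --> `|l| by apply: cvg_norm.
rewrite -(cvg_lim (@Rhausdorff R) cl); apply: limr_le => //.
by apply/cvg_ex; exists `|l|.
Qed.

(** For t <= 1/2 a geometric tail is at most twice its first term. *)
Lemma pseries_tail c M t j :
  (forall k, `|c k| <= M) -> 0 <= t <= 2^-1 ->
  `|limn (pseries c t) - \sum_(k < j) c k * t ^+ k| <= 2 * M * t ^+ j.
Proof.
move=> cM /andP[t0 t1].
have cc : cvgn (pseries c t).
  by apply: pseries_bounded_cvg cM _; rewrite ger0_norm//; lra.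
have M0 : 0 <= M by exact: le_trans (cM 0%N).
have c1 : (fun n => pseries c t n - \sum_(k < j) c k * t ^+ k) @ \oo -->
   limn (pseries c t) - \sum_(k < j) c k * t ^+ k.
  by apply: cvgB => //; apply: cvg_cst.
apply: (cvgn_norm_le c1).
near=> n; have jn : (j <= n)%N by near: n; exists j.
rewrite /pseries /series /= -(big_mkord xpredT (fun k => c k * t ^+ k)).
rewrite (big_cat_nat (leq0n j) jn)/= addrAC subrr add0r.
have geo m : \sum_(0 <= k < m) t ^+ k <= 2 - 2 * t ^+ m.
  elim: m => [|m IH]; first by rewrite big_nil expr0; lra.
  rewrite big_nat_recr//= exprS.
  have : 0 <= t ^+ m by rewrite exprn_ge0.
  nra.
apply: (le_trans (ler_norm_sum _ _ _)).
apply: (@le_trans _ _ (\sum_(j <= k < n) M * t ^+ k)).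
  by apply: ler_sum => k _; rewrite normrM normrX (ger0_norm t0) ler_wpM2r ?exprn_ge0.
rewrite -{1}(add0n j) big_addn -mulr_sumr.
rewrite (mulrC 2) -mulrA ler_wpM2l//.
under eq_bigr do rewrite exprD.
rewrite -mulr_suml ler_wpM2r ?exprn_ge0//.
apply: (le_trans (geo _)).
by rewrite lerBlDr lerDl mulr_ge0 ?exprn_ge0.
Unshelve. all: by end_near. Qed.

Lemma exp_coeff_le t k : 0 <= t -> exp_coeff t k <= expR t.
Proof.
move=> t0; have h : nondecreasing_seq (series (exp_coeff t)).
  by apply: nondecreasing_series => i _ _; rewrite exp_coeff_ge0.
have := nondecreasing_cvgn_le h (is_cvg_series_exp_coeff t) k.+1.
apply: le_trans; rewrite /series /= big_nat_recr//= lerDr sumr_ge0// => i _.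
exact: exp_coeff_ge0.
Qed.

End PowerSeries.

Section Flow.
Variable R : realType.
Implicit Types (x y : nat -> R) (t : R).

(** The matrix of a^dag - a in the Fock basis. Its entries are real, so real and imaginary parts of
    the amplitudes evolve separately and the analysis is done on real sequences. *)
Definition gshift x n : R :=
  (if n is m.+1 then Num.sqrt n%:R * x m else 0) - Num.sqrt n.+1%:R * x n.+1.

Definition fsupp N x := forall n, (N <= n)%N -> x n = 0.

Definition gcoef x n k : R := iter k gshift x n / k`!%:R.

Definition flow x t n : R := limn (pseries (gcoef x n) t).

Lemma gshift_fsupp N x : fsupp N x -> fsupp N.+1 (gshift x).
Proof.
move=> xN [|n] //; rewrite ltnS => Nn.
by rewrite /gshift (xN n)// (xN n.+2) ?mulr0 ?subr0// (leq_trans Nn)// -addn2 leq_addr.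
Qed.

Lemma iter_gshift_fsupp N x k : fsupp N x -> fsupp (N + k) (iter k gshift x).
Proof.
by move=> xN; elim: k => [|k IH]; rewrite ?addn0// addnS; apply: gshift_fsupp.
Qed.

(** After k steps the support lies below N + k, so the next step has entries at most sqrt(N + k + 1)
    and multiplies the bound on squares by at most 8 N (k + 1). The factor k! so gained is
    affordable, as the squared Taylor coefficient is divided by k!^2. *)
Lemma iter_gshift_sqr N x S k n : (0 < N)%N -> fsupp N x -> (forall m, x m ^+ 2 <= S) ->
  (iter k gshift x n) ^+ 2 <= S * (8 * N%:R) ^+ k * k`!%:R.
Proof.
move=> N0 xN xS.
elim: k n => [|k IH] n; first by rewrite expr0 fact0 !mulr1.
have S0 : 0 <= S by rewrite (le_trans _ (xS 0%N))// sqr_ge0.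
set B := S * (8 * N%:R) ^+ k * k`!%:R in IH.
have B0 : 0 <= B by rewrite !mulr_ge0// exprn_ge0// mulr_ge0.
have -> : S * (8 * N%:R) ^+ k.+1 * k.+1`!%:R = 8 * (N%:R * k.+1%:R) * B.
  by rewrite /B exprS factS natrM; ring.
have [nN|nN] := leqP (N + k).+1 n.
  by rewrite (iter_gshift_fsupp (k := k.+1) xN) ?addnS// expr0n /= mulr_ge0// mulr_ge0// mulr_ge0.
have n1 : n.+1%:R <= (2 * (N%:R * k.+1%:R) : R) by rewrite -!natrM ler_nat; nia.
have n2 : n%:R <= n.+1%:R :> R by rewrite ler_nat.
rewrite iterS /gshift.
apply: (@le_trans _ _ (2 * (n%:R * B) + 2 * (n.+1%:R * B))); last by nra.
have sq (m i : nat) : (Num.sqrt m%:R * iter k gshift x i) ^+ 2 <= m%:R * B.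
  by rewrite exprMn sqr_sqrtr// ler_wpM2l.
have h (a b : R) : (a - b) ^+ 2 <= 2 * a ^+ 2 + 2 * b ^+ 2 by have := sqr_ge0 (a + b); rewrite !expr2; lra.
apply: (le_trans (h _ _)); apply: lerD; rewrite ler_wpM2l//.
by case: (n) => [|m] //; rewrite expr0n /= mul0r.
Qed.

Lemma gcoef_bounded N x : fsupp N x ->
  exists2 M, 0 <= M & forall n k, `|gcoef x n k| <= M.
Proof.
move=> xN.
have xN1 : fsupp N.+1 x by move=> n Nn; apply: xN; apply: ltnW.
pose S := \sum_(i < N.+1) x i ^+ 2.
have S0 : 0 <= S by apply: sumr_ge0 => i _; rewrite sqr_ge0.
have xS m : x m ^+ 2 <= S.
  have [mN|mN] := ltnP m N.+1; last by rewrite xN1// expr0n.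
  by rewrite /S (bigD1 (Ordinal mN))//= lerDl sumr_ge0// => i _; rewrite sqr_ge0.
pose q : R := 8 * N.+1%:R.
have q0 : 0 <= q by rewrite mulr_ge0.
(* From g^2 <= Y follows |g| <= 1 + Y, which avoids a square root. *)
exists (1 + S * expR q) => [|n k].
  by rewrite addr_ge0// mulr_ge0// expR_ge0.
have h : gcoef x n k ^+ 2 <= S * expR q.
  rewrite /gcoef expr_div_n ler_pdivrMr ?exprn_gt0 ?ltr0n ?fact_gt0//.
  apply: (le_trans (iter_gshift_sqr k n _ xN1 xS)) => //.
  have := exp_coeff_le k q0; rewrite /exp_coeff /= ler_pdivrMr ?ltr0n ?fact_gt0// => h.
  rewrite -/q expr2 mulrA ler_wpM2r// -mulrA ler_wpM2l//.
have := normr_ge0 (gcoef x n k); move: h; rewrite -real_normK ?num_real//; nra.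
Qed.

Lemma gcoef_eq0 N x n k : fsupp N x -> (N + k <= n)%N -> gcoef x n k = 0.
Proof. by move=> xN nk; rewrite /gcoef (iter_gshift_fsupp xN)// mul0r. Qed.

Lemma flow_cvg N x n t : fsupp N x -> `|t| < 1 -> cvgn (pseries (gcoef x n) t).
Proof. by move=> /gcoef_bounded[M _ h]; apply: pseries_bounded_cvg. Qed.

Lemma pseries_diffs_gcoef x n : pseries_diffs (gcoef x n) = gcoef (gshift x) n.
Proof.
apply/funext => k; rewrite /pseries_diffs /gcoef iterSr factS natrM invfM.
by rewrite mulrCA (mulrA k.+1%:R) mulfV ?pnatr_eq0// mul1r.
Qed.

Lemma flow_derive N x n t : fsupp N x -> `|t| < 1 ->
  is_derive t (1 : R) (fun t => flow x t n) (flow (gshift x) t n).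
Proof.
move=> xN t1; pose K : R := (`|t| + 1) / 2.
have K1 : `|K| < 1 by rewrite ger0_norm /K; have := normr_ge0 t; lra.
rewrite /flow -pseries_diffs_gcoef.
apply: (@pseries_snd_diffs _ _ K); rewrite ?pseries_diffs_gcoef.
- exact: flow_cvg xN K1.
- exact: flow_cvg (gshift_fsupp xN) K1.
- exact: flow_cvg (gshift_fsupp (gshift_fsupp xN)) K1.
- by rewrite [ltRHS]ger0_norm /K; have := normr_ge0 t; lra.
Qed.

Lemma gshiftZD a x b y : gshift (fun n => a * x n + b * y n) =
  (fun n => a * gshift x n + b * gshift y n).
Proof. by apply/funext => -[|n]; rewrite /gshift; ring. Qed.

Lemma gcoefZD a x b y n : gcoef (fun n => a * x n + b * y n) n =
  (fun k => a * gcoef x n k + b * gcoef y n k).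
Proof.
apply/funext => k; rewrite /gcoef.
suff -> : iter k gshift (fun n => a * x n + b * y n) =
  (fun n => a * iter k gshift x n + b * iter k gshift y n) by rewrite mulrDl !mulrA.
by elim: k => [|k IH] //; rewrite !iterS IH gshiftZD.
Qed.

Lemma pseriesZD (c d : nat -> R) a b t : cvgn (pseries c t) -> cvgn (pseries d t) ->
  limn (pseries (fun k => a * c k + b * d k) t) =
  a * limn (pseries c t) + b * limn (pseries d t).
Proof.
move=> cc cd; apply: cvg_lim => //.
have -> : pseries (fun k => a * c k + b * d k) t = a *: pseries c t + b *: pseries d t.
  apply/funext => n; rewrite /pseries /series /= !fctE /= [in RHS]/GRing.scale /=.
  by rewrite !mulr_sumr -big_split /=; apply: eq_bigr => i _; ring.
by apply: cvgD; apply: cvgZr.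
Qed.

Lemma flowZD N a x b y t n : fsupp N x -> fsupp N y -> `|t| < 1 ->
  flow (fun n => a * x n + b * y n) t n = a * flow x t n + b * flow y t n.
Proof.
by move=> xN yN t1; rewrite /flow gcoefZD pseriesZD//; [exact: flow_cvg xN t1|exact: flow_cvg yN t1].
Qed.

Lemma gcoef_gshift x n k : gcoef (gshift x) n k = gshift (fun m => gcoef x m k) n.
Proof.
by rewrite /gcoef -iterSr iterS; case: n => [|n]; rewrite /gshift; ring.
Qed.

Lemma flow_gshift N x t n : fsupp N x -> `|t| < 1 ->
  flow (gshift x) t n = gshift (flow x t) n.
Proof.
move=> xN t1; rewrite /flow (_ : gcoef (gshift x) n =
  fun k => gshift (fun m => gcoef x m k) n); last by apply/funext => k; rewrite gcoef_gshift.
have h m := @flow_cvg N x m t xN t1; case: n => [|n]; rewrite /gshift.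
  rewrite (_ : (fun _ => _) = fun k => 0 * gcoef x 0 k + (- Num.sqrt 1) * gcoef x 1 k).
    by rewrite pseriesZD// mul0r mulNr.
  by apply/funext => k; rewrite mul0r mulNr.
rewrite (_ : (fun _ => _) = fun k => Num.sqrt n.+1%:R * gcoef x n k + (- Num.sqrt n.+2%:R) * gcoef x n.+2 k).
  by rewrite pseriesZD// mulNr.
by apply/funext => k; rewrite mulNr.
Qed.

Lemma flow0 N x n : fsupp N x -> flow x 0 n = x n.
Proof.
move=> xN; apply: cvg_lim => //; apply: cvg_near_cst; exists 1%N => // -[|k]// _.
rewrite /pseries /series /= big_nat_recl//= big1 => [|i _]; last by rewrite expr0n mulr0.
by rewrite expr0 mulr1 addr0 /gcoef fact0 divr1.
Qed.

(** Each step moves the support by one, so the coefficients of index below n + 1 - N vanish. The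
    remainder is thus small both in the number K of terms and in the position n, as convergence in
    norm requires. *)
Lemma flow_tail N x : fsupp N x -> exists2 M, 0 <= M & forall t n K, 0 <= t <= 2^-1 ->
  `|flow x t n - \sum_(k < K) gcoef x n k * t ^+ k| <= M * t ^+ maxn K (n.+1 - N).
Proof.
move=> xN; have [M M0 gM] := gcoef_bounded xN; exists (2 * M) => [|t n K t01].
  by rewrite mulr_ge0.
have -> : \sum_(k < K) gcoef x n k * t ^+ k = \sum_(k < maxn K (n.+1 - N)) gcoef x n k * t ^+ k.
  rewrite -!(big_mkord xpredT (fun k => gcoef x n k * t ^+ k)).
  rewrite [RHS](big_cat_nat (leq0n K) (leq_maxl _ _)) /= [X in _ + X]big1_seq ?addr0// => i.
  rewrite mem_index_iota => /andP[_ /andP[Ki]]; rewrite leq_max ltnNge Ki /= => iN.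
  by rewrite (gcoef_eq0 xN) ?mul0r//; lia.
exact: pseries_tail.
Qed.

End Flow.

(** * Weighted quadratic forms along the flow *)

Section Energy.
Variable R : realType.
Implicit Types (x y u v s : nat -> R) (t : R).

Definition energy s u v L : R := \sum_(n < L) s n * (u n * v n).

(** [gshift] is antisymmetric, so the two contributions of each pair of neighbours cancel up to the
    increment of the weight. Cutting at L leaves one boundary term. *)
Lemma energy_by_parts s u v L :
  \sum_(n < L.+1) s n * (gshift u n * v n + u n * gshift v n) =
  \sum_(n < L) Num.sqrt n.+1%:R * (s n.+1 - s n) * (u n * v n.+1 + u n.+1 * v n)
  - s L * Num.sqrt L.+1%:R * (u L.+1 * v L + u L * v L.+1).
Proof.
elim: L => [|L IH]; first by rewrite big_ord_recl !big_ord0 /gshift /=; ring.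
by rewrite big_ord_recr /= IH [in RHS]big_ord_recr /= /gshift; ring.
Qed.

Lemma flow_decay N x : fsupp N x -> exists2 M, 0 <= M & forall t n, 0 <= t <= 4^-1 ->
  `|flow x t n| <= M / 4 ^+ n.
Proof.
move=> xN; have [M M0 h] := flow_tail xN; exists (M * 4 ^+ N) => [|t n /andP[t0 t1]].
  by rewrite mulr_ge0// exprn_ge0.
have t2 : 0 <= t <= 2^-1 by rewrite t0 /=; lra.
have := h t n 0%N t2; rewrite big_ord0 subr0 max0n => /le_trans; apply.
rewrite -mulrA ler_wpM2l// ler_pdivlMr ?exprn_gt0//.
apply: (@le_trans _ _ (4^-1 ^+ (n.+1 - N) * 4 ^+ n)).
  by rewrite ler_wpM2r ?exprn_ge0// lerXn2r ?nnegrE//; lra.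
rewrite exprVn mulrC ler_pdivrMr ?exprn_gt0// -exprD.
by rewrite ler_weXn2l ?ler1n//; lia.
Qed.

Lemma pow2_gt L : L.+1%:R <= 2 ^+ L :> R.
Proof. by rewrite -natrX ler_nat; apply: ltn_expl. Qed.

Lemma flow_energy_derive N s x y L t : fsupp N x -> fsupp N y -> `|t| < 1 ->
  is_derive t (1 : R) (fun t => energy s (flow x t) (flow y t) L)
   (\sum_(n < L) s n * (gshift (flow x t) n * flow y t n + flow x t n * gshift (flow y t) n)).
Proof.
move=> xN yN t1.
rewrite (_ : (fun t => _) = \sum_(n < L) (fun t => s n * (flow x t n * flow y t n))); last first.
  by apply/funext => r; rewrite fct_sumE.
have D (n : 'I_L) : is_derive t (1 : R) (fun t => s n * (flow x t n * flow y t n))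
    (s n * (gshift (flow x t) n * flow y t n + flow x t n * gshift (flow y t) n)).
  have dx := @flow_derive _ N x n t xN t1; have dy := @flow_derive _ N y n t yN t1.
  have -> : s n * (gshift (flow x t) n * flow y t n + flow x t n * gshift (flow y t) n)
    = s n *: (flow x t n *: flow (gshift y) t n + flow y t n *: flow (gshift x) t n).
    by rewrite /GRing.scale /= (flow_gshift _ xN)// (flow_gshift _ yN)//; ring.
  exact: (@is_deriveZ _ _ _ _ (s n) t 1 _ (@is_deriveM _ _ _ _ t 1 _ _ dx dy)).
exact: is_derive_sum.
Qed.

Lemma energy_mvt N s x y L t : fsupp N x -> fsupp N y -> 0 <= t <= 4^-1 ->
  exists2 r, 0 <= r <= t & energy s (flow x t) (flow y t) L - energy s x y L =
  (\sum_(n < L) s n * (gshift (flow x r) n * flow y r n + flow x r n * gshift (flow y r) n)) * t.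
Proof.
move=> xN yN /andP[t0 t1].
have d r : 0 <= r <= t -> `|r| < 1 by move=> /andP[r0 r1]; rewrite ger0_norm//; lra.
have [r0 rt||r] := @MVT_segment R (fun t => energy s (flow x t) (flow y t) L)
  (fun r => \sum_(n < L) s n * (gshift (flow x r) n * flow y r n + flow x r n * gshift (flow y r) n)) 0 t t0.
- rewrite in_itv /= in rt; apply: (flow_energy_derive _ _ xN yN).
  by case/andP: rt => ? ?; apply: d; rewrite !ltW.
- apply: derivable_within_continuous => r; rewrite in_itv /= => /d rt.
  by have [] := flow_energy_derive s L xN yN rt.
- rewrite in_itv /= subr0 => rt; rewrite (_ : energy s (flow x 0) _ L = energy s x y L); first by exists r.
  by apply: eq_bigr => n _; rewrite (flow0 _ xN) (flow0 _ yN).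
Qed.

(** The product of two flows decays like 4^-L twice; one of the two factors absorbs the growth (L +
    1)^2 <= 4^L of the weight and of the square root. *)
Lemma flow_boundary N s S x y : fsupp N x -> fsupp N y -> (forall n, `|s n| <= S * n.+1%:R) ->
  exists2 C, 0 <= C & forall t L, 0 <= t <= 4^-1 ->
  `|s L * Num.sqrt L.+1%:R * (flow x t L.+1 * flow y t L + flow x t L * flow y t L.+1)| <= C / 4 ^+ L.
Proof.
move=> xN yN sS; have [M M0 hx] := flow_decay xN; have [M' M'0 hy] := flow_decay yN.
have S0 : 0 <= S by have := sS 0%N; rewrite mulr1; apply: le_trans.
exists (S * (2 * M * M')) => [|t L t01]; first by rewrite !mulr_ge0.
have p0 : 0 < (4 ^+ L)^-1 :> R by rewrite invr_gt0 exprn_gt0.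
have p1 : (4 ^+ L.+1)^-1 <= (4 ^+ L)^-1 :> R by rewrite exprS invfM; lra.
have hx1 : `|flow x t L.+1| <= M / 4 ^+ L by apply: (le_trans (hx _ _ t01)); rewrite ler_wpM2l.
have hy1 : `|flow y t L.+1| <= M' / 4 ^+ L by apply: (le_trans (hy _ _ t01)); rewrite ler_wpM2l.
have hx0 := hx _ L t01; have hy0 := hy _ L t01.
have sq : Num.sqrt L.+1%:R <= L.+1%:R :> R.
  rewrite -[leRHS]ger0_norm// -sqrtr_sqr ler_wsqrtr// expr2 -natrM ler_nat; nia.
rewrite !normrM (ger0_norm (sqrtr_ge0 _)).
apply: (@le_trans _ _ (S * L.+1%:R * L.+1%:R * (2 * (M / 4 ^+ L) * (M' / 4 ^+ L)))).
  apply: ler_pM; rewrite ?normr_ge0 ?mulr_ge0 ?sqrtr_ge0//.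
    by apply: ler_pM => //; rewrite ?sqrtr_ge0.
  apply: (le_trans (ler_normD _ _)); rewrite !normrM.
  have := ler_pM (normr_ge0 _) (normr_ge0 _) hx1 hy0.
  have := ler_pM (normr_ge0 _) (normr_ge0 _) hx0 hy1.
  lra.
have L2 : L.+1%:R * L.+1%:R <= 4 ^+ L :> R.
  have := pow2_gt L => h; rewrite (_ : 4 = 2 * 2 :> R) ?exprMn; last by lra.
  by apply: ler_pM.
rewrite (_ : S * _ * _ * _ = S * (2 * M * M') / 4 ^+ L * (L.+1%:R * L.+1%:R / 4 ^+ L)); last by ring.
by rewrite ler_piMr// ?mulr_ge0// ?invr_ge0 ?exprn_ge0// ler_pdivrMr ?exprn_gt0// mul1r.
Qed.

(** A constant weight has no increments, so only the boundary term remains. *)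
Lemma flow_isometry N x y : fsupp N x -> fsupp N y ->
  exists2 C, 0 <= C & forall t L, 0 <= t <= 4^-1 ->
  `|energy (fun=> 1) (flow x t) (flow y t) L.+1 - energy (fun=> 1) x y L.+1| <= C / 4 ^+ L.
Proof.
move=> xN yN; have [|C C0 hC] := @flow_boundary N (fun=> 1) 1 x y xN yN.
  by move=> n; rewrite normr1 mul1r ler1n.
exists C => // t L t01.
have [r /andP[r0 r1] ->] := energy_mvt (fun=> 1) L.+1 xN yN t01.
case/andP: t01 => t0 t1.
have /= -> := energy_by_parts (fun=> 1) (flow x r) (flow y r) L.
rewrite big1 => [|i _]; last by rewrite subrr mulr0 mul0r.
rewrite sub0r normrM normrN (ger0_norm t0) mulrC.
have := hC r L; rewrite r0 (le_trans r1 t1) => /(_ isT) h.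
by apply: le_trans h; rewrite ler_piMl//; lra.
Qed.

(** The hypothesis on b says that the commutator of the weight with the generator is bounded, which
    bounds the derivative of the form by norms. The weight [tau] of Young's inequality stays free
    because y will be much smaller than x. *)
Lemma flow_energy N s S b tau x y : fsupp N x -> fsupp N y ->
  (forall n, `|s n| <= S * n.+1%:R) ->
  (forall n, Num.sqrt n.+1%:R * `|s n.+1 - s n| <= b) -> 0 < tau ->
  exists2 C, 0 <= C & forall t L, 0 <= t <= 4^-1 ->
  `|energy s (flow x t) (flow y t) L.+1 - energy s x y L.+1| <=
   t * (b * (tau * energy (fun=> 1) x x L.+1 + tau^-1 * energy (fun=> 1) y y L.+1)) + C / 4 ^+ L.
Proof.
move=> xN yN sS sb tau0.
have [C C0 hC] := flow_boundary xN yN sS.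
have [Cx Cx0 hCx] := flow_isometry xN xN.
have [Cy Cy0 hCy] := flow_isometry yN yN.
have b0 : 0 <= b by apply: le_trans (sb 0%N); rewrite mulr_ge0// sqrtr_ge0.
have ti0 : 0 < tau^-1 by rewrite invr_gt0.
exists (b * (tau * Cx + tau^-1 * Cy) + C) => [|t L t01].
  by rewrite addr_ge0// mulr_ge0// addr_ge0// mulr_ge0// ltW.
have [r /andP[r0 r1] ->] := energy_mvt s L.+1 xN yN t01.
case/andP: t01 => t0 t1.
have r01 : 0 <= r <= 4^-1 by rewrite r0 (le_trans r1 t1).
rewrite energy_by_parts normrM (ger0_norm t0) mulrC.
have e0 : 0 <= (4 ^+ L)^-1 :> R by rewrite invr_ge0 exprn_ge0.
set X := energy _ x x _; set Y := energy _ y y _.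
have hX : energy (fun=> 1) (flow x r) (flow x r) L.+1 <= X + Cx / 4 ^+ L.
  by have := hCx r L r01; rewrite ler_norml => /andP[_]; rewrite lerBlDl.
have hY : energy (fun=> 1) (flow y r) (flow y r) L.+1 <= Y + Cy / 4 ^+ L.
  by have := hCy r L r01; rewrite ler_norml => /andP[_]; rewrite lerBlDl.
have hS (w : nat -> R) : \sum_(n < L) (w n ^+ 2 + w n.+1 ^+ 2) <= 2 * energy (fun=> 1) w w L.+1.
  rewrite big_split /= /energy mulr2n mulrDl !mul1r; apply: lerD.
    by rewrite big_ord_recr /=; under eq_bigr do rewrite expr2 -[_ * _]mul1r; rewrite lerDl mul1r -expr2 sqr_ge0.
  by rewrite big_ord_recl /=; under eq_bigr do rewrite expr2 -[_ * _]mul1r; rewrite lerDr mul1r -expr2 sqr_ge0.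
have main : `|\sum_(n < L) Num.sqrt n.+1%:R * (s n.+1 - s n) *
    (flow x r n * flow y r n.+1 + flow x r n.+1 * flow y r n)| <=
   b * (tau * (X + Cx / 4 ^+ L) + tau^-1 * (Y + Cy / 4 ^+ L)).
  apply: (le_trans (ler_norm_sum _ _ _)).
  apply: (@le_trans _ _ (\sum_(n < L) b * (2^-1 * (tau * (flow x r n ^+ 2 + flow x r n.+1 ^+ 2)
     + tau^-1 * (flow y r n ^+ 2 + flow y r n.+1 ^+ 2))))).
    apply: ler_sum => n _; rewrite !normrM (ger0_norm (sqrtr_ge0 _)).
    apply: ler_pM; rewrite ?normr_ge0 ?mulr_ge0 ?sqrtr_ge0//.
    have am (p q : R) : `|p * q| <= 2^-1 * (tau * p ^+ 2 + tau^-1 * q ^+ 2).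
      have E : tau * tau^-1 = 1 by rewrite mulfV// gt_eqF.
      have h1 := mulr_ge0 (ltW ti0) (sqr_ge0 (tau * p + q)).
      have h2 := mulr_ge0 (ltW ti0) (sqr_ge0 (tau * p - q)).
      rewrite [X in 0 <= X](_ : _ = tau * tau^-1 * tau * p ^+ 2 + tau * tau^-1 * (2 * (p * q)) + tau^-1 * q ^+ 2) in h1; last by ring.
      rewrite [X in 0 <= X](_ : _ = tau * tau^-1 * tau * p ^+ 2 - tau * tau^-1 * (2 * (p * q)) + tau^-1 * q ^+ 2) in h2; last by ring.
      rewrite E !mul1r in h1 h2.
      rewrite ler_norml; lra.
    apply: (le_trans (ler_normD _ _)).
    have := am (flow x r n) (flow y r n.+1); have := am (flow x r n.+1) (flow y r n); lra.
  rewrite -mulr_sumr ler_wpM2l// -mulr_sumr big_split /= -!mulr_sumr.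
  have := hS (flow x r); have := hS (flow y r).
  set a1 := \sum_(_ < _) _; set a2 := \sum_(_ < _) _ => k1 k2.
  have l2 : a2 <= 2 * (X + Cx / 4 ^+ L) by lra.
  have l1 : a1 <= 2 * (Y + Cy / 4 ^+ L) by lra.
  have := ler_wpM2l (ltW tau0) l2; have := ler_wpM2l (ltW ti0) l1.
  lra.
have hB := hC r L r01.
apply: (@le_trans _ _ (t * (b * (tau * (X + Cx / 4 ^+ L) + tau^-1 * (Y + Cy / 4 ^+ L)) + C / 4 ^+ L))).
  rewrite ler_wpM2l//; apply: (le_trans (ler_normB _ _)); exact: lerD.
have k0 : 0 <= (b * (tau * Cx + tau^-1 * Cy) + C) / 4 ^+ L.
  by rewrite mulr_ge0// addr_ge0// mulr_ge0// addr_ge0// mulr_ge0// ltW.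
rewrite (_ : t * _ = t * (b * (tau * X + tau^-1 * Y)) + t * ((b * (tau * Cx + tau^-1 * Cy) + C) / 4 ^+ L)); last by ring.
by rewrite lerD2l ler_piMl//; lra.
Qed.

End Energy.

(** * The weights of the Lyapunov function *)

Section Sigma.
Variable R : realType.
Variable nbar : nat.
Local Notation sg := (sigma R nbar).

Definition sigma_incr n : R :=
  if (nbar <= n)%N then n.+1%:R^-1 + (n.+1%:R ^+ 2)^-1
  else if (0 < n)%N then (n.+1%:R ^+ 2)^-1 - n.+1%:R^-1 else - 8^-1.

Lemma sigmaS n : sg n.+1 = sg n + sigma_incr n.
Proof.
rewrite /sigma_incr /sigma; have [h|h|h] := ltngtP n nbar.
- rewrite [(nbar < n.+1)%N]ltnNge h /=.
  have [h1|h1] := eqVneq n.+1 nbar.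
    rewrite -h1 !big_nat1; case: ifP => n0.
      by ring.
    have -> : n = 0%N by case: (n) n0.
    by rewrite big_nat1 expr1n invr1; ring.
  have lt2 : (n.+1 < nbar)%N by rewrite ltn_neqAle h1.
  case: ifP => n0.
    rewrite [in RHS]big_ltn; last by rewrite ltnS ltnW.
    by ring.
  have -> : n = 0%N by case: (n) n0.
  have nb0 : (1 < nbar.+1)%N by rewrite ltnS (leq_ltn_trans _ h).
  by rewrite [in RHS]big_ltn// expr1n invr1; ring.
- rewrite ltnS ltnW// [LHS]big_nat_recr//=.
  by rewrite ltnW.
- by rewrite h ltnSn big_nat1 add0r.
Qed.

Lemma sigma_nbar : sg nbar = 0.
Proof. by rewrite /sigma ltnn eqxx. Qed.

Lemma sigma_incr_gt0 n : (nbar <= n)%N -> 0 < sigma_incr n.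
Proof. by move=> h; rewrite /sigma_incr h addr_gt0// invr_gt0// exprn_gt0. Qed.

Lemma invn_lt1 n : (0 < n)%N -> n.+1%:R^-1 <= 2^-1 :> R.
Proof. by move=> n0; rewrite lef_pV2 ?posrE// ler_nat. Qed.

Lemma sigma_incr_le0 n : (n < nbar)%N -> sigma_incr n <= 0.
Proof.
move=> h; rewrite /sigma_incr leqNgt h /=; case: ifP => n0; last by lra.
have := invn_lt1 n0; rewrite -exprVn; have : 0 < n.+1%:R^-1 :> R by rewrite invr_gt0.
by move: (n.+1%:R^-1) => a; nra.
Qed.

Lemma sigma_mono n m : (nbar <= n)%N -> (n <= m)%N -> sg n <= sg m.
Proof.
move=> h; elim: m => [|m IH]; first by rewrite leqn0 => /eqP ->.
rewrite leq_eqVlt => /orP[/eqP <-//|]; rewrite ltnS => nm.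
rewrite (le_trans (IH nm))// sigmaS lerDl ltW// sigma_incr_gt0//; exact: leq_trans nm.
Qed.

Lemma sigma_ge0 n : 0 <= sg n.
Proof.
have [h|h] := leqP nbar n; first by rewrite -sigma_nbar sigma_mono.
rewrite -(subKn (ltnW h)); elim: (nbar - n)%N => [|j IH].
  by rewrite subn0 sigma_nbar.
have [jn|jn] := ltnP j nbar; last first.
  by rewrite (_ : (nbar - j.+1 = nbar - j)%N)//; lia.
have := sigmaS (nbar - j.+1); rewrite subnSK// => E.
have : sigma_incr (nbar - j.+1) <= 0 by apply: sigma_incr_le0; lia.
lra.
Qed.

Lemma sigma_incr_abs n : `|sigma_incr n| <= 2 * n.+1%:R^-1.
Proof.
rewrite /sigma_incr -!exprVn; have p0 : 0 < n.+1%:R^-1 :> R by rewrite invr_gt0.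
have p1 : n.+1%:R^-1 <= 1 :> R by rewrite invf_le1// ler1n.
case: ifP => h1; [|case: ifP => h2]; rewrite ler_norml.
- by move: (n.+1%:R^-1) p0 p1 => a; nra.
- by move: (n.+1%:R^-1) p0 p1 => a; nra.
have -> : n = 0%N by case: (n) h2.
by rewrite invr1; lra.
Qed.

Lemma sigma_incr_sqrt n : Num.sqrt n.+1%:R * `|sg n.+1 - sg n| <= 2.
Proof.
rewrite sigmaS addrAC subrr add0r.
apply: (@le_trans _ _ (n.+1%:R * (2 * n.+1%:R^-1))); last by rewrite mulrCA mulfV ?pnatr_eq0// mulr1.
apply: ler_pM; rewrite ?sqrtr_ge0 ?sigma_incr_abs//.
rewrite -[leRHS]ger0_norm// -sqrtr_sqr ler_wsqrtr// expr2 -natrM ler_nat; nia.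
Qed.

Lemma sigma_growth : exists2 S : R, 0 <= S & forall n, `|sg n| <= S * n.+1%:R.
Proof.
exists (2 + sg 0); first by rewrite addr_ge0 ?sigma_ge0.
move=> n; rewrite ger0_norm ?sigma_ge0//.
elim: n => [|n IH]; first by rewrite mulr1 lerDr.
rewrite sigmaS -(natr1 n.+1) mulrDr mulr1 lerD//.
apply: (le_trans (ler_norm _)); apply: (le_trans (sigma_incr_abs _)).
have : n.+1%:R^-1 <= 1 :> R by rewrite invf_le1// ler1n.
by have := sigma_ge0 0; move: (n.+1%:R^-1) => a; lra.
Qed.

(** As for the harmonic series, the terms between m and 2m contribute at least 1/2. *)
Lemma sigma_unbounded (B : R) : exists2 m, (nbar <= m)%N & B <= sg m.
Proof.
have H j : exists2 m, (nbar < m)%N & j%:R / 2 <= sg m.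
  elim: j => [|j [m mn IH]]; first by exists nbar.+1 => //; rewrite mul0r sigma_ge0.
  exists (m + m)%N; first by rewrite (leq_trans mn)// leq_addr.
  (* The second alternative lets the induction on i run without a side condition. *)
  have K i : sg m + i%:R / (m + m)%:R <= sg (m + i) \/ (m < i)%N.
    elim: i => [|i [IHi|IHi]]; first by left; rewrite addn0 mul0r addr0.
      have [im|im] := leqP i.+1 m; last by right.
      left; rewrite addnS sigmaS -natr1 mulrDl addrA lerD//.
      rewrite /sigma_incr (leq_trans (ltnW mn) (leq_addr _ _)) mul1r.
      apply: (@le_trans _ _ (m + i).+1%:R^-1); last by rewrite lerDl invr_ge0 exprn_ge0.
      rewrite lef_pV2 ?posrE ?ltr0n//; last by lia.
      by rewrite ler_nat; lia.
    by right; lia.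
  have [K1|] := K m; last by rewrite ltnn.
  apply: le_trans K1; rewrite natrD.
  have m0 : 0 < m%:R :> R by rewrite ltr0n; lia.
  rewrite -natr1 mulrDl lerD// mul1r ler_pdivlMr ?addr_gt0//; lra.
have [m mn h] := H (Num.bound (2 * `|B|)).
exists m; first exact: ltnW.
have := archi_boundP (mulr_ge0 (ler0n R 2) (normr_ge0 B)); have := ler_norm B; lra.
Qed.

(** To leading order a displacement by t sends |n> to |n+1> and |n-1> with probabilities (n+1) t^2
    and n t^2, so this is the coefficient of t^2 in the loss of the mean of sigma. At n = 0 the
    value at [n.-1] has factor 0. *)
Definition kappa n : R :=
  - (n.+1%:R * (sg n.+1 - sg n) + n%:R * (sg n.-1 - sg n)).

(** The harmonic parts cancel, as k times 1/k is 1 for both neighbours; the parts 1/k^2 leave 1/n -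
    1/(n+1) on either side of the target. Next to the vacuum the constant 1/8 takes over: it gives
    1/8 at n = 0 and 3/8 at n = 1 below the target. *)
Lemma kappa_gt0 n : n != nbar -> 0 < kappa n.
Proof.
move=> nn; rewrite /kappa sigmaS [sg n + _ - _]addrAC subrr add0r.
have inv m : m.+1%:R * m.+1%:R^-1 = 1 :> R by rewrite mulfV// pnatr_eq0.
case: n nn => [|n] nn.
  rewrite mul0r addr0 /sigma_incr leqn0 eq_sym (negbTE nn) /=; lra.
have lt0 : (n.+2%:R^-1 : R) < n.+1%:R^-1 by rewrite ltf_pV2 ?posrE// ltr_nat.
rewrite /= sigmaS (_ : sg n - (sg n + sigma_incr n) = - sigma_incr n); last by ring.
move: (inv n) (inv n.+1).
rewrite /sigma_incr -!exprVn; set a := n.+1%:R^-1; set b := n.+2%:R^-1.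
rewrite ltn0Sn.
have [h|h] := leqP nbar n.+1.
  have h' : (nbar <= n)%N by rewrite -ltnS ltn_neqAle eq_sym nn.
  rewrite h' => e1 e2.
  rewrite !mulrN !mulrDr !expr2 !mulrA e1 e2; rewrite -/a -/b in lt0; lra.
rewrite leqNgt (ltn_trans _ h)//=.
case: (posnP n) => [n0|n0] e1 e2.
  by rewrite n0 /= /b n0; lra.
rewrite !mulrN !mulrBr !expr2 !mulrA e1 e2; rewrite -/a -/b in lt0; lra.
Qed.

End Sigma.

(** * Displaced Fock states to second order *)

Section Basis.
Variable R : realType.

Definition bvec (n m : nat) : R := (m == n)%:R.

Lemma bvec_fsupp n : fsupp n.+1 (bvec n).
Proof. by move=> m nm; rewrite /bvec gtn_eqF. Qed.

Lemma iter_gshift_lower n m k : (m + k < n)%N -> iter k (@gshift R) (bvec n) m = 0.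
Proof.
elim: k m => [|k IH] m mk; first by rewrite /= /bvec ltn_eqF//; lia.
rewrite iterS /gshift (IH m.+1) ?mulr0 ?subr0; last by lia.
by case: m mk => // m mk; rewrite IH ?mulr0//; lia.
Qed.

(** Subtraction is truncated, so one summand is 0 and the sum is |m - n|. *)
Definition absd (m n : nat) := ((m - n) + (n - m))%N.

Lemma gcoef_bvec0 n m k : (k < absd m n)%N -> gcoef (bvec n) m k = 0.
Proof.
rewrite /absd => h; have [mn|mn] := leqP n m.
  by apply: gcoef_eq0 (@bvec_fsupp n) _; lia.
by rewrite /gcoef iter_gshift_lower ?mul0r//; lia.
Qed.

Definition nbr_amp n m : R :=
  if m == n.+1 then Num.sqrt n.+1%:R else if m.+1 == n then - Num.sqrt n%:R else 0.

Lemma gcoef_bvec1 n m : m != n -> gcoef (bvec n) m 1 = nbr_amp n m.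
Proof.
move=> mn; rewrite /gcoef (_ : 1`!%:R = 1)// divr1 /= /gshift /nbr_amp /bvec.
case: m mn => [|m] mn.
  by rewrite eq_sym /=; case: eqP => [<-|_]; rewrite ?mulr1 ?mulr0 sub0r// oppr0.
rewrite eqSS; case: eqP => [->|_].
  by rewrite mulr1 gtn_eqF ?mulr0 ?subr0.
by rewrite mulr0 sub0r; case: eqP => [<-|_]; rewrite ?mulr1 ?mulr0 ?oppr0.
Qed.

(** Reaching m from n takes |m - n| steps, so the lower Taylor coefficients vanish. Off the diagonal
    the constant term is therefore 0, and the linear one is the matrix entry of a^dag - a. *)
Lemma flow_bvec (n : nat) : exists2 K : R, 0 <= K & forall (t : R) m, 0 <= t <= 4^-1 ->
  `|flow (bvec n) t m| <= K * t ^+ absd m n /\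
  (m != n -> `|flow (bvec n) t m - nbr_amp n m * t| <= K * t ^+ 2).
Proof.
have [M M0 gM] := gcoef_bounded (@bvec_fsupp n).
exists (2 * M) => [|t m /andP[t0 t1]]; first by rewrite mulr_ge0.
have t2 : 0 <= t <= 2^-1 by rewrite t0 /=; lra.
split=> [|mn].
  have := pseries_tail (absd m n) (gM m) t2.
  by rewrite big1 ?subr0// => i _; rewrite gcoef_bvec0 ?mul0r.
have := pseries_tail 2 (gM m) t2.
rewrite !big_ord_recl big_ord0 addr0 /= gcoef_bvec1// gcoef_bvec0 ?mul0r ?add0r ?expr1//.
by rewrite /absd; lia.
Qed.

Lemma geo_half_sum L : \sum_(m < L) (2 ^+ m)^-1 <= 2 :> R.
Proof.
suff : \sum_(m < L) (2 ^+ m)^-1 <= 2 - 2 / 2 ^+ L :> R.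
  by move/le_trans; apply; rewrite lerBlDr lerDl divr_ge0// exprn_ge0.
elim: L => [|L IH]; first by rewrite big_ord0 expr0 divr1 subrr.
rewrite big_ord_recr /= exprS invfM; move: IH; move: (2 ^+ L)^-1 (\sum_(i < L) _) => a b; lra.
Qed.

(** Of the 2 |m - n| powers of t, e are kept; the others, at least |m - n| - 1 of them, are traded
    for decay in m by t <= 1/4. *)
Lemma absd_pow (t : R) m n e : 0 <= t <= 4^-1 -> (e <= 2 * absd m n)%N -> (e <= (absd m n).+1)%N ->
  t ^+ (2 * absd m n) <= t ^+ e * (4 ^+ n.+1 / 4 ^+ m) :> R.
Proof.
move=> /andP[t0 t1] e1 e2.
rewrite -{1}(subnKC e1) exprD ler_wpM2l ?exprn_ge0//.
apply: (@le_trans _ _ (4^-1 ^+ (2 * absd m n - e))).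
  by rewrite lerXn2r ?nnegrE//; lra.
rewrite exprVn -[leLHS]mul1r ler_pdivrMr ?exprn_gt0// mulrAC ler_pdivlMr ?exprn_gt0// mul1r -exprD.
by rewrite ler_weXn2l ?ler1n//; move: e1 e2; rewrite /absd; lia.
Qed.

Lemma pow42 m : (4 ^+ m)^-1 = (2 ^+ m)^-1 * (2 ^+ m)^-1 :> R.
Proof. by rewrite -invfM -exprMn; congr (_ ^+ _)^-1; lra. Qed.

Lemma pow2_inv_le1 m : (2 ^+ m)^-1 <= 1 :> R.
Proof. by rewrite invf_le1 ?exprn_gt0// exprn_ege1// ler1n. Qed.

Lemma flow_bvec_lost (n : nat) : exists2 Z : R, 0 <= Z & forall (t : R) L, 0 <= t <= 4^-1 ->
  \sum_(m < L | val m != n) flow (bvec n) t m ^+ 2 <= Z * t ^+ 2.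
Proof.
have [K K0 hK] := flow_bvec n.
exists (K ^+ 2 * 4 ^+ n.+1 * 2) => [|t L t01].
  by rewrite !mulr_ge0// exprn_ge0.
have [t0 t1] := andP t01.
apply: (@le_trans _ _ (\sum_(m < L) K ^+ 2 * 4 ^+ n.+1 * t ^+ 2 * (2 ^+ m)^-1)); last first.
  by rewrite -mulr_sumr [leRHS]mulrAC ler_wpM2l ?geo_half_sum// !mulr_ge0 ?exprn_ge0.
rewrite [leRHS](bigID (fun m : 'I_L => val m != n)) /=.
rewrite -[leLHS]addr0 lerD//; last by apply: sumr_ge0 => i _; rewrite !mulr_ge0 ?invr_ge0 ?exprn_ge0.
apply: ler_sum => m mn.
have [h _] := hK t m t01.
apply: (@le_trans _ _ ((K * t ^+ absd m n) ^+ 2)).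
  by rewrite -real_normK ?num_real// lerXn2r ?nnegrE// mulr_ge0 ?exprn_ge0.
have d1 : (1 <= absd m n)%N by move: mn; rewrite /absd /=; lia.
rewrite exprMn -exprM mulnC.
rewrite [leRHS](_ : _ = K ^+ 2 * (t ^+ 2 * (4 ^+ n.+1 * (2 ^+ m)^-1))); last by ring.
rewrite ler_wpM2l ?exprn_ge0//.
apply: (@le_trans _ _ (t ^+ 2 * (4 ^+ n.+1 / 4 ^+ m))); first by apply: absd_pow => //; lia.
rewrite ler_wpM2l ?exprn_ge0// ler_wpM2l ?exprn_ge0//.
by rewrite pow42 ler_piMl ?invr_ge0 ?exprn_ge0// pow2_inv_le1.
Qed.

Variable nbar : nat.
Local Notation sg := (sigma R nbar).

(** With sigma measured from its value at n, the diagonal term drops out, the two neighbours produce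
    - kappa t^2 up to t^3, and the sites at distance at least 2 contribute squares of order t^4 or
    smaller. The constant subtracted is restored by norm conservation. *)
Lemma flow_bvec_gain (n : nat) : n != nbar -> exists2 Z : R, 0 <= Z & forall t : R, 0 <= t <= 4^-1 ->
  exists2 C, 0 <= C & forall L, (n < L)%N ->
  energy sg (flow (bvec n) t) (flow (bvec n) t) L.+1 <=
   sg n - kappa R nbar n * t ^+ 2 + Z * t ^+ 3 + C / 4 ^+ L.
Proof.
move=> nn; have [K K0 hK] := flow_bvec n.
have [S S0 hS] := sigma_growth R nbar.
pose B := 2 * n.+1%:R * K + K ^+ 2.
have B0 : 0 <= B by rewrite !addr_ge0// ?mulr_ge0// ?exprn_ge0.
pose D := 2 * S * n.+1%:R.
have D0 : 0 <= D by rewrite !mulr_ge0.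
have hD m : `|sg m - sg n| <= D * 2 ^+ m.
  apply: (le_trans (ler_normB _ _)); apply: (le_trans (lerD (hS m) (hS n))).
  have := pow2_gt R m; have : 1 <= n.+1%:R :> R by rewrite ler1n.
  have : 1 <= m.+1%:R :> R by rewrite ler1n.
  rewrite /D; move: (2 ^+ m) n.+1%:R m.+1%:R => p a b b1 a1 bp.
  rewrite -mulrDr -!mulrA mulrCA ler_wpM2l//; nra.
pose w m : R := (sg m - sg n) * nbr_amp n m ^+ 2.
(* The available decay 4^-m is used as 2^-m twice: once against the growth of sigma, once to sum
   over m. *)
have hw t m : 0 <= t <= 4^-1 ->
  (sg m - sg n) * flow (bvec n) t m ^+ 2 <= w m * t ^+ 2 + D * B * (4 ^+ n.+1) * t ^+ 3 * (2 ^+ m)^-1.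
  move=> t01; have [h1 h2] := hK t m t01; have [t0 t1] := andP t01.
  have [->|mn] := eqVneq m n.
    by rewrite /w subrr !mul0r add0r !mulr_ge0// ?invr_ge0 ?exprn_ge0.
  rewrite /w -lerBlDl [leLHS](_ : _ = (sg m - sg n) *
    (flow (bvec n) t m ^+ 2 - t ^+ 2 * nbr_amp n m ^+ 2)); last by ring.
  apply: (le_trans (ler_norm _)); rewrite normrM.
  suff hB : `|flow (bvec n) t m ^+ 2 - t ^+ 2 * nbr_amp n m ^+ 2| <= B * 4 ^+ n.+1 * t ^+ 3 / (2 ^+ m * 2 ^+ m).
    apply: (le_trans (ler_pM (normr_ge0 _) (normr_ge0 _) (hD m) hB)).
    have E : 2 ^+ m / 2 ^+ m = 1 :> R by rewrite mulfV// expf_neq0// pnatr_eq0.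
    rewrite invfM [leLHS](_ : _ = 2 ^+ m / 2 ^+ m * (D * B * 4 ^+ n.+1 * t ^+ 3 * (2 ^+ m)^-1)).
      by rewrite E mul1r.
    by move: (2 ^+ m : R)^-1 => p; ring.
  have [d1|d2] := leqP (absd m n) 1.
    have cn : `|nbr_amp n m| <= n.+1%:R.
      have sq k : (k <= n.+1)%N -> Num.sqrt k%:R <= n.+1%:R :> R.
        move=> kn; rewrite -[leRHS]ger0_norm// -sqrtr_sqr ler_wsqrtr// expr2 -natrM ler_nat; nia.
      rewrite /nbr_amp; case: ifP => _; first by rewrite ger0_norm ?sqrtr_ge0// sq.
      by case: ifP => _; rewrite ?normr0// normrN ger0_norm ?sqrtr_ge0// sq.
    have -> : flow (bvec n) t m ^+ 2 - t ^+ 2 * nbr_amp n m ^+ 2 =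
      (flow (bvec n) t m - nbr_amp n m * t) * (flow (bvec n) t m - nbr_amp n m * t + 2 * (nbr_amp n m * t)) by ring.
    rewrite normrM; have := h2 mn; move: (_ - _) => r hr.
    apply: (@le_trans _ _ (B * t ^+ 3)).
      apply: (@le_trans _ _ (K * t ^+ 2 * (K * t ^+ 2 + 2 * (n.+1%:R * t)))).
        apply: ler_pM => //; apply: (le_trans (ler_normD _ _)); rewrite lerD//.
        by rewrite !normrM (ger0_norm t0) ger0_norm// ler_wpM2l// ler_wpM2r.
      rewrite (_ : K * t ^+ 2 * _ = K ^+ 2 * (t ^+ 3 * t) + 2 * n.+1%:R * K * t ^+ 3); last by ring.
      rewrite [leRHS](_ : _ = K ^+ 2 * t ^+ 3 + 2 * n.+1%:R * K * t ^+ 3); last by rewrite /B; ring.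
      rewrite lerD2r ler_wpM2l ?exprn_ge0// ler_piMr ?exprn_ge0//; lra.
    rewrite [leRHS](_ : _ = B * t ^+ 3 * (4 ^+ n.+1 / (2 ^+ m * 2 ^+ m))); last by ring.
    rewrite ler_peMr ?mulr_ge0 ?exprn_ge0//.
    rewrite ler_pdivlMr ?mul1r ?mulr_gt0 ?exprn_gt0// -exprMn (_ : 2 * 2 = 4 :> R); last by lra.
    by rewrite ler_weXn2l ?ler1n//; move: d1; rewrite /absd; lia.
  rewrite (_ : nbr_amp n m = 0); last first.
    move: d2; rewrite /nbr_amp /absd; case: eqP => [->|_]; first by lia.
    by case: eqP => [<-|_]//; lia.
  rewrite expr0n /= mulr0 subr0 ger0_norm ?sqr_ge0//.
  apply: (@le_trans _ _ ((K * t ^+ absd m n) ^+ 2)).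
    by rewrite -real_normK ?num_real// lerXn2r ?nnegrE// mulr_ge0 ?exprn_ge0.
  rewrite exprMn -exprM mulnC.
  apply: (@le_trans _ _ (K ^+ 2 * (t ^+ 3 * (4 ^+ n.+1 / 4 ^+ m)))).
    by rewrite ler_wpM2l ?exprn_ge0//; apply: absd_pow => //; lia.
  rewrite pow42 -invfM (_ : B * _ * _ / _ = B * (t ^+ 3 * (4 ^+ n.+1 / (2 ^+ m * 2 ^+ m)))); last by ring.
  apply: ler_wpM2r; last by rewrite /B lerDr !mulr_ge0.
  by rewrite !mulr_ge0// ?invr_ge0 ?mulr_ge0 ?exprn_ge0.
exists (D * B * 4 ^+ n.+1 * 2); first by rewrite !mulr_ge0// exprn_ge0.
move=> t t01; have [t0 t1] := andP t01.
have [C C0 hC] := flow_isometry (@bvec_fsupp n) (@bvec_fsupp n).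
exists (sg n * C) => [|L nL]; first by rewrite mulr_ge0 ?sigma_ge0.
have E1 : energy (fun=> 1) (bvec n) (bvec n) L.+1 = 1.
  have nL' : (n < L.+1)%N by rewrite ltnW.
  rewrite /energy (bigD1 (Ordinal nL'))//= big1 => [|i /negbTE ni]; first by rewrite /bvec eqxx !mul1r addr0.
  by rewrite /bvec (_ : (i == n :> nat) = false) ?mul0r ?mulr0// -ni.
have hE : energy (fun=> 1) (flow (bvec n) t) (flow (bvec n) t) L.+1 <= 1 + C / 4 ^+ L.
  by have := hC t L t01; rewrite E1 ler_norml => /andP[_]; rewrite lerBlDl.
have -> : energy sg (flow (bvec n) t) (flow (bvec n) t) L.+1 =
   \sum_(m < L.+1) (sg m - sg n) * flow (bvec n) t m ^+ 2 +
   sg n * energy (fun=> 1) (flow (bvec n) t) (flow (bvec n) t) L.+1.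
  by rewrite /energy mulr_sumr -big_split /=; apply: eq_bigr => i _; ring.
have sw : \sum_(m < L.+1) w m = - kappa R nbar n.
  have n1L : (n.+1 < L.+1)%N by rewrite ltnS.
  have -> : \sum_(m < L.+1) w m = \sum_(m < L.+1) ((m == n.+1 :> nat)%:R * (n.+1%:R * (sg n.+1 - sg n)) +
     (m.+1 == n :> nat)%:R * (n%:R * (sg n.-1 - sg n))).
    apply: eq_bigr => m _; rewrite /w /nbr_amp; case: eqP => [->|_].
      by rewrite sqr_sqrtr// gtn_eqF// mul0r addr0 mul1r mulrC.
    case: eqP => [<-|_]; last by rewrite expr0n /= !mul0r mulr0 addr0.
    by rewrite sqrrN sqr_sqrtr// mul0r add0r mul1r mulrC.
  rewrite big_split /= /kappa opprK; congr (_ + _).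
    rewrite (bigD1 (Ordinal n1L))//= big1 => [|i /negbTE ni]; first by rewrite eqxx mul1r addr0.
    by rewrite (_ : (i == n.+1 :> nat) = false) ?mul0r// -ni.
  have [n0|n0] := posnP n.
    by rewrite big1 => [|i _]; rewrite (_ : n%:R = 0) ?n0// mul0r ?mulr0.
  have kL' : (n.-1 < L.+1)%N by lia.
  rewrite (bigD1 (Ordinal kL'))//= big1 => [|i ni]; first by rewrite prednK// eqxx mul1r addr0.
  rewrite (_ : (i.+1 == n :> nat) = false) ?mul0r//; apply/eqP => ni'.
  by move/eqP: ni; apply; apply: val_inj; rewrite /= -ni'.
have h1 : \sum_(m < L.+1) (sg m - sg n) * flow (bvec n) t m ^+ 2 <=
   - kappa R nbar n * t ^+ 2 + D * B * 4 ^+ n.+1 * 2 * t ^+ 3.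
  apply: (@le_trans _ _ (\sum_(m < L.+1) (w m * t ^+ 2 + D * B * 4 ^+ n.+1 * t ^+ 3 * (2 ^+ m)^-1))).
    by apply: ler_sum => m _; apply: hw.
  rewrite big_split /= -mulr_suml sw lerD2l -mulr_sumr [leRHS]mulrAC.
  by rewrite ler_wpM2l ?geo_half_sum// !mulr_ge0 ?exprn_ge0.
have h2 := ler_wpM2l (sigma_ge0 R nbar n) hE.
rewrite mulrDr mulr1 mulrA in h2.
move: h1 h2; rewrite mulNr; lra.
Qed.

End Basis.

(** * Extension of the flow to square-summable sequences *)

Section RealDisplacement.
Variable R : realType.
Implicit Types (x y w a : nat -> R) (t : R).

Lemma cvgn_sum_ord (u : nat -> nat -> R) (l : nat -> R) L :
  (forall n, (fun N => u N n) @ \oo --> l n) ->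
  (fun N => \sum_(n < L) u N n) @ \oo --> \sum_(n < L) l n.
Proof.
move=> ul; elim: L => [|L IH].
  by rewrite big_ord0; under eq_fun do rewrite big_ord0; apply: cvg_cst.
by rewrite big_ord_recr /=; under eq_fun do rewrite big_ord_recr /=; apply: cvgD.
Qed.

Definition sqs x L : R := \sum_(n < L) x n ^+ 2.

Lemma sqs_energy x L : energy (fun=> 1) x x L = sqs x L.
Proof. by apply: eq_bigr => i _; rewrite mul1r expr2. Qed.

Lemma sqs_mono x : {homo sqs x : L L' / (L <= L')%N >-> L <= L'}.
Proof.
move=> L L' LL'; rewrite /sqs -!(big_mkord xpredT (fun i => x i ^+ 2)).
rewrite (big_cat_nat (leq0n L) LL') /= lerDl; apply: sumr_ge0 => i _; exact: sqr_ge0.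
Qed.

Lemma sqs_fsupp N x L : fsupp N x -> sqs x L <= sqs x N.
Proof.
move=> xN; have [LN|NL] := leqP L N; first exact: sqs_mono.
rewrite /sqs -!(big_mkord xpredT (fun i => x i ^+ 2)).
rewrite (big_cat_nat (leq0n N) (ltnW NL)) /= [X in _ + X]big1_seq ?addr0// => i.
by rewrite mem_index_iota => /andP[_ /andP[Ni _]]; rewrite xN// expr0n.
Qed.

(** Removes the boundary errors by sending the cutoff to infinity. *)
Lemma le_geo (p q C : R) L0 : (forall L, (L0 <= L)%N -> p <= q + C / 4 ^+ L) -> p <= q.
Proof.
move=> h; have c : (fun L => q + C / 4 ^+ L) @ \oo --> q.
  rewrite -[X in _ --> X]addr0; apply: cvgD; first exact: cvg_cst.
  rewrite (_ : (fun L => C / 4 ^+ L) = geometric C 4^-1); last by apply/funext => L; rewrite /= exprVn.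
  by apply: cvg_geometric; rewrite ger0_norm//; lra.
rewrite -(cvg_lim (@Rhausdorff R) c); apply: limr_ge; first by apply/cvg_ex; exists q.
by exists L0 => // L /= /h.
Qed.

Lemma flow_contract N x L t : fsupp N x -> 0 <= t <= 4^-1 ->
  sqs (flow x t) L <= sqs x N.
Proof.
move=> xN t01; have [C C0 h] := flow_isometry xN xN.
apply: (@le_geo _ _ C L) => L' LL'.
have := h t L' t01; rewrite ler_norml lerBlDl !sqs_energy => /andP[_].
have := sqs_fsupp L'.+1 xN; have : sqs (flow x t) L <= sqs (flow x t) L'.+1 by apply: sqs_mono; lia.
lra.
Qed.

Lemma flow_expand N x t (B : R) : fsupp N x -> 0 <= t <= 4^-1 ->
  (forall L, sqs (flow x t) L <= B) -> sqs x N <= B.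
Proof.
move=> xN t01 hB; have [C C0 h] := flow_isometry xN xN.
apply: (@le_geo _ _ C N) => L NL.
have := h t L t01; rewrite ler_norml lerBrDl !sqs_energy => /andP[+ _].
have := hB L.+1; have : sqs x N <= sqs x L.+1 by apply: sqs_mono; lia.
lra.
Qed.

Definition rtrunc N x : nat -> R := fun n => if (n < N)%N then x n else 0.

Lemma rtrunc_fsupp N x : fsupp N (rtrunc N x).
Proof. by move=> n Nn; rewrite /rtrunc ltnNge Nn. Qed.

Lemma fsuppW N M x : (N <= M)%N -> fsupp N x -> fsupp M x.
Proof. by move=> NM xN n Mn; apply: xN; apply: leq_trans Mn. Qed.

Lemma sqs_rtrunc N x : sqs (rtrunc N x) N = sqs x N.
Proof. by apply: eq_bigr => i _; rewrite /rtrunc ltn_ord. Qed.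

(** By linearity the difference is the flow of the part of x between N and M, whose norm the flow
    does not increase. *)
Lemma flow_rtruncB x N M t L : (N <= M)%N -> 0 <= t <= 4^-1 ->
  sqs (fun n => flow (rtrunc M x) t n - flow (rtrunc N x) t n) L <= sqs x M - sqs x N.
Proof.
move=> NM t01; have t1 : `|t| < 1 by case/andP: t01 => t0 t1; rewrite ger0_norm//; lra.
pose w n := 1 * rtrunc M x n + (-1) * rtrunc N x n.
have wM : fsupp M w.
  by move=> n Mn; rewrite /w (@rtrunc_fsupp M)// (@rtrunc_fsupp N) ?(leq_trans NM)// !mulr0 addr0.
have -> : (fun n => flow (rtrunc M x) t n - flow (rtrunc N x) t n) = flow w t.
  apply/funext => n; rewrite /w (flowZD 1 (-1) n (@rtrunc_fsupp M x) (fsuppW NM (@rtrunc_fsupp N x)))//.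
  by rewrite mul1r mulN1r.
apply: (le_trans (flow_contract L wM t01)).
rewrite /sqs -!(big_mkord xpredT (fun i => x i ^+ 2)) -(big_mkord xpredT (fun i => w i ^+ 2)).
rewrite [X in _ <= X - _](big_cat_nat (leq0n N) NM) /= addrAC subrr add0r.
rewrite (big_cat_nat (leq0n N) NM) /= big1_seq => [|i]; last first.
  by rewrite mem_index_iota /= /w /rtrunc => iN; rewrite iN (leq_trans iN NM) mul1r mulN1r subrr expr0n.
rewrite add0r; apply: ler_sum_nat => i /andP[Ni iM].
by rewrite /w /rtrunc iM ltnNge Ni /= mulr0 addr0 mul1r.
Qed.

Definition dflow x t n : R := limn (fun N => flow (rtrunc N x) t n).

Variables (x : nat -> R) (T t : R).
Hypothesis xT : sqs x @ \oo --> T.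
Hypothesis t01 : 0 <= t <= 4^-1.

Lemma sqs_le_lim N : sqs x N <= T.
Proof.
rewrite -(cvg_lim (@Rhausdorff R) xT).
apply: nondecreasing_cvgn_le; last by apply/cvg_ex; exists T.
exact: sqs_mono.
Qed.

Lemma sqs_lim_near (e : R) : 0 < e -> exists N, T - sqs x N < e.
Proof.
move=> e0; have /cvgrPdist_lt/(_ _ e0)[N _ h] := xT.
by exists N; have := h N (leqnn N); apply: le_lt_trans; exact: ler_norm.
Qed.

Lemma dflow_cvg n : (fun N => flow (rtrunc N x) t n) @ \oo --> dflow x t n.
Proof.
suff : cvgn (fun N => flow (rtrunc N x) t n) by [].
apply/cauchy_cvgP; apply: cauchy_exP => e e0.
have [N hN] := sqs_lim_near (exprn_gt0 2 e0).
exists (flow (rtrunc N x) t n); exists N => // M /= NM.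
rewrite /ball /= -ltr_sqr ?nnegrE ?normr_ge0 ?(ltW e0)//.
rewrite real_normK ?num_real// -sqrrN opprB.
apply: le_lt_trans hN; apply: (@le_trans _ _ (sqs x M - sqs x N)); last by rewrite lerD2r sqs_le_lim.
apply: le_trans (flow_rtruncB x n.+1 NM t01).
by rewrite /sqs big_ord_recr /= lerDr sumr_ge0// => i _; rewrite sqr_ge0.
Qed.

(** Finite sums pass to the limit coordinate by coordinate, so bounds that are uniform in the
    truncation carry over to general vectors. *)
Lemma dflow_sum_le a L N0 (B : R) :
  (forall N, (N0 <= N)%N -> \sum_(n < L) a n * flow (rtrunc N x) t n ^+ 2 <= B) ->
  \sum_(n < L) a n * dflow x t n ^+ 2 <= B.
Proof.
move=> h.
have c : (fun N => \sum_(n < L) a n * flow (rtrunc N x) t n ^+ 2) @ \oo -->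
   \sum_(n < L) a n * dflow x t n ^+ 2.
  apply: (@cvgn_sum_ord (fun N n => a n * flow (rtrunc N x) t n ^+ 2) (fun n => a n * dflow x t n ^+ 2)) => n.
  apply: cvgMl_tmp; rewrite expr2; under eq_fun do rewrite expr2.
  by apply: cvgM; apply: dflow_cvg.
rewrite -(cvg_lim (@Rhausdorff R) c); apply: limr_le; first by apply/cvg_ex; eexists; exact: c.
by exists N0 => // N /= /h.
Qed.

Lemma dflow_sqs_le L : sqs (dflow x t) L <= T.
Proof.
rewrite /sqs; under eq_bigr do rewrite -[_ ^+ 2]mul1r.
apply: (@dflow_sum_le (fun=> 1) L 0) => N _.
under eq_bigr do rewrite mul1r.
apply: (le_trans (flow_contract L (@rtrunc_fsupp N x) t01)).
by rewrite sqs_rtrunc sqs_le_lim.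
Qed.

Lemma dflow_dist N L : sqs (fun n => flow (rtrunc N x) t n - dflow x t n) L <= T - sqs x N.
Proof.
have c : (fun M => sqs (fun n => flow (rtrunc M x) t n - flow (rtrunc N x) t n) L) @ \oo -->
   sqs (fun n => flow (rtrunc N x) t n - dflow x t n) L.
  apply: (@cvgn_sum_ord (fun M n => (flow (rtrunc M x) t n - flow (rtrunc N x) t n) ^+ 2)
    (fun n => (flow (rtrunc N x) t n - dflow x t n) ^+ 2)) => n.
  rewrite -sqrrN opprB expr2; under eq_fun do rewrite expr2.
  have cB : (fun M => flow (rtrunc M x) t n - flow (rtrunc N x) t n) @ \oo --> dflow x t n - flow (rtrunc N x) t n.
    by apply: cvgB; [exact: dflow_cvg|exact: cvg_cst].
  exact: cvgM.
rewrite -(cvg_lim (@Rhausdorff R) c); apply: limr_le; first by apply/cvg_ex; eexists; exact: c.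
exists N => // M /= NM; apply: (le_trans (flow_rtruncB x L NM t01)).
by rewrite lerD2r sqs_le_lim.
Qed.

(** No norm is lost in the limit: a truncation has the norm of its flow, and this flow differs from
    [dflow] by a tail of x, compared through Young's inequality. *)
Lemma dflow_sqs_ge (B : R) : (forall L, sqs (dflow x t) L <= B) -> T <= B.
Proof.
move=> hB; have T0 : 0 <= T.
  by have := sqs_le_lim 0; rewrite /sqs big_ord0.
have B0 : 0 <= B by have := hB 0%N; rewrite /sqs big_ord0.
apply/ler_addgt0Pr => e e0.
(* This weight gives k B <= e / 2; the tail is then chosen small against 2 + 1/k. *)
pose k := e / (2 * (B + 1)).
have k0 : 0 < k by rewrite divr_gt0// mulr_gt0//; lra.
have e2 : 0 < e / 2 / (2 + k^-1) by rewrite divr_gt0 ?divr_gt0// addr_gt0// invr_gt0.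
have [N hN] := sqs_lim_near e2.
have kB : k * B <= e / 2.
  by rewrite /k mulrAC ler_pdivrMr; last lra; nra.
have ki : k * k^-1 = 1 by rewrite mulfV// gt_eqF.
have h1 : sqs (rtrunc N x) N <= (1 + k) * B + (1 + k^-1) * (T - sqs x N).
  apply: (flow_expand (@rtrunc_fsupp N x) t01) => L.
  apply: (@le_trans _ _ ((1 + k) * sqs (dflow x t) L +
     (1 + k^-1) * sqs (fun n => flow (rtrunc N x) t n - dflow x t n) L)); last first.
    by rewrite lerD// ler_wpM2l ?dflow_dist ?addr_ge0 ?invr_ge0 ?(ltW k0).
  rewrite /sqs !mulr_sumr -big_split /=; apply: ler_sum => n _.
  move: (flow _ _ _) (dflow _ _ _) => p q.
  have := mulr_ge0 (ltW k0) (sqr_ge0 (q - k^-1 * (p - q))).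
  rewrite [X in 0 <= X](_ : _ = k * q ^+ 2 - 2 * (k * k^-1) * q * (p - q) + k * k^-1 * k^-1 * (p - q) ^+ 2); last by ring.
  by rewrite ki; move: k^-1 => k'; nra.
rewrite sqs_rtrunc in h1.
have k'0 : 0 < k^-1 by rewrite invr_gt0.
move: hN; rewrite ltr_pdivlMr; last by lra.
have := sqs_le_lim N; move: k'0 h1; move: k^-1 (sqs x N) => k' s ? ? ? ?; nra.
Qed.

End RealDisplacement.

(** * The displacement operator and its norm conservation *)

Section Displacement.
Variable R : realType.
Implicit Types (psi chi : cseq R) (f : nat -> R).

Lemma sqmod_ge0 (z : R[i]) : 0 <= sqmod z.
Proof. by rewrite addr_ge0// sqr_ge0. Qed.

Lemma rser_le f (B : R) : (forall n, 0 <= f n) -> (forall L, \sum_(n < L) f n <= B) ->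
  (\sum_(0 <= n <oo) (f n)%:E <= B%:E)%E.
Proof.
move=> f0 fB; apply: lime_le; first by apply: is_cvg_nneseries => n _ _; rewrite lee_fin.
by apply: nearW => L; rewrite sumEFin lee_fin big_mkord.
Qed.

Lemma rser_ge f L : (forall n, 0 <= f n) ->
  ((\sum_(n < L) f n)%:E <= \sum_(0 <= n <oo) (f n)%:E)%E.
Proof.
move=> f0; rewrite -(big_mkord xpredT f) -sumEFin.
by apply: nneseries_lim_ge => n _ _; rewrite lee_fin.
Qed.

Lemma rser_ge1 f n : (forall n, 0 <= f n) -> ((f n)%:E <= \sum_(0 <= n <oo) (f n)%:E)%E.
Proof.
move=> f0; apply: le_trans (rser_ge n.+1 f0).
by rewrite lee_fin big_ord_recr /= lerDr sumr_ge0.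
Qed.

Lemma rser_cvg f (B : R) : (forall n, 0 <= f n) -> (\sum_(0 <= n <oo) (f n)%:E = B%:E)%E ->
  (fun L => \sum_(n < L) f n) @ \oo --> B.
Proof.
move=> f0 E; have c : (fun L => (\sum_(0 <= n < L) (f n)%:E)%E) @ \oo --> B%:E.
  by rewrite -E; apply: is_cvg_nneseries => n _ _; rewrite lee_fin.
have -> : (fun L => \sum_(n < L) f n) = fine \o (fun L => (\sum_(0 <= n < L) (f n)%:E)%E).
  by apply/funext => L; rewrite /= sumEFin /= big_mkord.
exact: fine_cvg.
Qed.

Definition cre_ psi n : R := complex.Re (psi n).
Definition cim_ psi n : R := complex.Im (psi n).

Lemma complexE (z : R[i]) : z = Complex (complex.Re z) (complex.Im z).
Proof. by case: z. Qed.

Lemma complex_add (p q p' q' : R) : Complex p q + Complex p' q' = Complex (p + p') (q + q').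
Proof. by []. Qed.

Lemma complex_sub (p q p' q' : R) : Complex p q - Complex p' q' = Complex (p - p') (q - q').
Proof. by []. Qed.

Lemma rCM (p : R) (z : R[i]) : rC p * z = Complex (p * complex.Re z) (p * complex.Im z).
Proof. by case: z => u v; congr Complex; rewrite /= mul0r ?subr0 ?addr0. Qed.

Lemma genE psi n : gen psi n = Complex (gshift (cre_ psi) n) (gshift (cim_ psi) n).
Proof.
rewrite /gen /cre /ann /gshift; case: n => [|n]; rewrite !rCM.
  by rewrite (complexE 0) complex_sub.
by rewrite complex_sub.
Qed.

Lemma iter_genE psi k n :
  iter k (@gen R) psi n = Complex (iter k (@gshift R) (cre_ psi) n) (iter k (@gshift R) (cim_ psi) n).
Proof.
elim: k n => [|k IH] n; first by rewrite /= -complexE.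
rewrite !iterS genE; congr (Complex (gshift _ _) (gshift _ _)); apply/funext => m.
- by rewrite /cre_ IH.
- by rewrite /cim_ IH.
Qed.

Lemma exp_partialE psi t K n : exp_partial t psi K n =
  Complex (\sum_(k < K) gcoef (cre_ psi) n k * t ^+ k) (\sum_(k < K) gcoef (cim_ psi) n k * t ^+ k).
Proof.
rewrite /exp_partial; elim: K => [|K IH]; first by rewrite !big_ord0.
rewrite !big_ord_recr /= IH iter_genE rCM complex_add /gcoef /=.
by congr Complex; congr (_ + _); ring.
Qed.

Definition cflow psi t : cseq R := fun n => Complex (flow (cre_ psi) t n) (flow (cim_ psi) t n).

Definition cdisp psi t : cseq R := fun n => Complex (dflow (cre_ psi) t n) (dflow (cim_ psi) t n).

Lemma cre_trunc N psi : cre_ (trunc N psi) = rtrunc N (cre_ psi).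
Proof. by apply/funext => n; rewrite /cre_ /trunc /rtrunc; case: ifP. Qed.

Lemma cim_trunc N psi : cim_ (trunc N psi) = rtrunc N (cim_ psi).
Proof. by apply/funext => n; rewrite /cim_ /trunc /rtrunc; case: ifP. Qed.

Lemma nrm2_ge0 psi : (0 <= nrm2 psi)%E.
Proof. by apply: nneseries_ge0 => n _ _; rewrite lee_fin sqmod_ge0. Qed.

Lemma l2lim_le (x : nat -> cseq R) (y : cseq R) (b : nat -> R) :
  (forall K L, \sum_(n < L) sqmod (x K n - y n) <= b K) -> b @ \oo --> (0 : R) -> l2lim x y.
Proof.
move=> xb b0; rewrite /l2lim; apply: (@squeeze_cvge _ _ _ _ (fun=> 0%E) _ (EFin \o b)).
- apply: nearW => K; rewrite nrm2_ge0 /=; apply: rser_le => [n|L]; first exact: sqmod_ge0.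
  exact: xb.
- exact: cvg_cst.
- by apply: cvg_EFin => //; apply: nearW.
Qed.

Lemma l2lim_near (x : nat -> cseq R) (y : cseq R) (e : R) : 0 < e -> l2lim x y ->
  \forall K \near \oo, forall n, sqmod (x K n - y n) < e.
Proof.
move=> e0 /fine_cvgP[fn /cvgrPdist_lt/(_ _ e0) h].
near=> K => n.
have fK : nrm2 (fun n => x K n - y n) \is a fin_num by near: K.
have hK : `|0 - fine (nrm2 (fun n => x K n - y n))| < e by near: K.
rewrite -lte_fin; apply: (@le_lt_trans _ _ (nrm2 (fun n => x K n - y n))).
  by apply: (rser_ge1 (f := fun n => sqmod (x K n - y n))) => m; exact: sqmod_ge0.
by rewrite -(fineK fK) lte_fin; apply: le_lt_trans hK; rewrite sub0r normrN ler_norm.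
Unshelve. all: by end_near. Qed.

Lemma l2lim_uniq (x : nat -> cseq R) (y z : cseq R) : l2lim x y -> l2lim x z -> y = z.
Proof.
move=> xy xz; apply/funext => n.
suff h : sqmod (y n - z n) <= 0.
  move: h; case: (y n) (z n) => a b [c d]; rewrite complex_sub /sqmod /= => h.
  have h1 : a = c by have := sqr_ge0 (b - d); have := sqr_ge0 (a - c); nra.
  have h2 : b = d by have := sqr_ge0 (b - d); have := sqr_ge0 (a - c); nra.
  by rewrite h1 h2.
apply/ler_addgt0Pr => e e0; rewrite add0r.
have e4 : 0 < e / 4 by rewrite divr_gt0.
near \oo => K.
have h1 : sqmod (x K n - y n) < e / 4 by near: K; apply: filterS (l2lim_near e4 xy) => K.
have h2 : sqmod (x K n - z n) < e / 4 by near: K; apply: filterS (l2lim_near e4 xz) => K.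
move: h1 h2; case: (y n) (z n) (x K n) => a b [c d] [p q]; rewrite !complex_sub /sqmod /=.
have := sqr_ge0 ((p - a) + (p - c)); have := sqr_ge0 ((q - b) + (q - d)); nra.
Unshelve. all: by end_near. Qed.

Lemma exp_partial_l2 N psi t : fsupp N (cre_ psi) -> fsupp N (cim_ psi) -> 0 <= t <= 4^-1 ->
  l2lim (exp_partial t psi) (cflow psi t).
Proof.
move=> xN yN t01; have [t0 t1] := andP t01.
have t2 : 0 <= t <= 2^-1 by rewrite t0 /=; lra.
have [M M0 hx] := flow_tail xN; have [M' M'0 hy] := flow_tail yN.
apply: (@l2lim_le _ _ (fun K => (M ^+ 2 + M' ^+ 2) * 4 ^+ N * 2 / 4 ^+ K)) => [K L|]; last first.
  rewrite (_ : (fun K => _) = geometric ((M ^+ 2 + M' ^+ 2) * 4 ^+ N * 2) 4^-1); last by apply/funext => K; rewrite /= exprVn.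
  by apply: cvg_geometric; rewrite ger0_norm//; lra.
(* Twice a maximum is at least the sum, so the square supplies decay in K and in n together. *)
have key n : (t ^+ maxn K (n.+1 - N)) ^+ 2 <= 4 ^+ N / 4 ^+ K * (2 ^+ n)^-1.
  apply: (@le_trans _ _ (4^-1 ^+ (K + (n.+1 - N)))).
    rewrite -exprM; apply: (@le_trans _ _ (4^-1 ^+ (maxn K (n.+1 - N) * 2))).
      by rewrite lerXn2r ?nnegrE//; lra.
    by apply: ler_wiXn2l; [lra|lra|lia].
  apply: (@le_trans _ _ (4 ^+ N / 4 ^+ K * (4 ^+ n)^-1)); last first.
    rewrite ler_wpM2l ?mulr_ge0 ?invr_ge0 ?exprn_ge0//.
    by rewrite pow42 ler_piMl ?invr_ge0 ?exprn_ge0// pow2_inv_le1.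
  rewrite exprVn -mulrA -invfM -[leLHS]mul1r ler_pdivrMr ?exprn_gt0// mulrAC ler_pdivlMr ?mulr_gt0 ?exprn_gt0//.
  by rewrite mul1r -!exprD ler_weXn2l ?ler1n//; lia.
have hsq (u m : R) n : 0 <= m -> `|u| <= m * t ^+ maxn K (n.+1 - N) -> u ^+ 2 <= m ^+ 2 * (4 ^+ N / 4 ^+ K * (2 ^+ n)^-1).
  move=> m0 um; apply: (@le_trans _ _ ((m * t ^+ maxn K (n.+1 - N)) ^+ 2)).
    by rewrite -real_normK ?num_real// lerXn2r ?nnegrE// mulr_ge0 ?exprn_ge0.
  by rewrite exprMn ler_wpM2l ?exprn_ge0.
apply: (@le_trans _ _ (\sum_(n < L) (M ^+ 2 + M' ^+ 2) * (4 ^+ N / 4 ^+ K) * (2 ^+ n)^-1)).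
  apply: ler_sum => n _; rewrite exp_partialE /cflow complex_sub /sqmod /=.
  rewrite -mulrA mulrDl lerD//; apply: hsq => //; rewrite distrC; [exact: hx|exact: hy].
rewrite -mulr_sumr [leRHS](_ : _ = (M ^+ 2 + M' ^+ 2) * (4 ^+ N / 4 ^+ K) * 2); last by ring.
by rewrite ler_wpM2l ?geo_half_sum// !mulr_ge0 ?addr_ge0 ?invr_ge0 ?exprn_ge0.
Qed.

Variables (psi : cseq R) (t : R).
Hypothesis psi1 : unit_vec psi.
Hypothesis t01 : 0 <= t <= 4^-1.

Lemma sqmodE n : sqmod (psi n) = cre_ psi n ^+ 2 + cim_ psi n ^+ 2.
Proof. by []. Qed.

Lemma unit_parts : exists Tx Ty : R,
  [/\ sqs (cre_ psi) @ \oo --> Tx, sqs (cim_ psi) @ \oo --> Ty & Tx + Ty = 1].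
Proof.
have s0 n : 0 <= sqmod (psi n) by exact: sqmod_ge0.
have c1 : (fun L => \sum_(n < L) sqmod (psi n)) @ \oo --> (1 : R).
  exact: (@rser_cvg (fun n => sqmod (psi n)) 1 s0 psi1).
have E L : \sum_(n < L) sqmod (psi n) = sqs (cre_ psi) L + sqs (cim_ psi) L.
  by rewrite /sqs -big_split.
have le1 L : sqs (cre_ psi) L + sqs (cim_ psi) L <= 1.
  rewrite -E -lee_fin; apply: le_trans (rser_ge L s0) _.
  by rewrite -[leLHS]/(nrm2 psi) psi1.
have p0 (x : nat -> R) L : 0 <= sqs x L by apply: sumr_ge0 => i _; rewrite sqr_ge0.
have cx : cvgn (sqs (cre_ psi)).
  apply: nondecreasing_is_cvgn; first exact: sqs_mono.
  by exists 1 => _ [L _ <-]; have := le1 L; have := p0 (cim_ psi) L; lra.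
have cy : cvgn (sqs (cim_ psi)).
  apply: nondecreasing_is_cvgn; first exact: sqs_mono.
  by exists 1 => _ [L _ <-]; have := le1 L; have := p0 (cre_ psi) L; lra.
exists (limn (sqs (cre_ psi))), (limn (sqs (cim_ psi))); split => //.
have c2 : (fun L => \sum_(n < L) sqmod (psi n)) @ \oo --> limn (sqs (cre_ psi)) + limn (sqs (cim_ psi)).
  by under eq_fun do rewrite E; apply: cvgD.
by rewrite -(cvg_lim (@Rhausdorff R) c1) -(cvg_lim (@Rhausdorff R) c2).
Qed.

Lemma disp_graph_cdisp : disp_graph t psi (cdisp psi t).
Proof.
have [Tx [Ty [cx cy T1]]] := unit_parts.
exists (fun N => cflow (trunc N psi) t); split=> [N|].
  apply: (@exp_partial_l2 N) => //; rewrite ?cre_trunc ?cim_trunc; exact: rtrunc_fsupp.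
apply: (@l2lim_le _ _ (fun N => (Tx - sqs (cre_ psi) N) + (Ty - sqs (cim_ psi) N))) => [N L|]; last first.
  rewrite (_ : 0 = (Tx - Tx) + (Ty - Ty)); last by rewrite !subrr addr0.
  by apply: cvgD; apply: cvgB => //; exact: cvg_cst.
have -> : \sum_(n < L) sqmod (cflow (trunc N psi) t n - cdisp psi t n) =
  sqs (fun n => flow (rtrunc N (cre_ psi)) t n - dflow (cre_ psi) t n) L +
  sqs (fun n => flow (rtrunc N (cim_ psi)) t n - dflow (cim_ psi) t n) L.
  rewrite /sqs -big_split /=; apply: eq_bigr => n _.
  by rewrite /cflow /cdisp complex_sub cre_trunc cim_trunc.
by apply: lerD; apply: dflow_dist.
Qed.

(** Norm limits are unique, first those of the exponential series of each truncation and then that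
    of the truncations, so the limit picked by choice is the computed one. *)
Lemma dispE : disp t psi = cdisp psi t.
Proof.
rewrite /disp; case: pselect => [h|[]]; last by exists (cdisp psi t); exact: disp_graph_cdisp.
case: cid => chi /= [c1 [h1 h2]]; have [c2 [g1 g2]] := disp_graph_cdisp.
apply: (@l2lim_uniq c1) => //.
suff -> : c1 = c2 by [].
apply/funext => N; exact: l2lim_uniq (h1 N) (g1 N).
Qed.

Lemma cdisp_unit : unit_vec (cdisp psi t).
Proof.
have [Tx [Ty [cx cy T1]]] := unit_parts.
have s0 n : 0 <= sqmod (cdisp psi t n) by exact: sqmod_ge0.
have E L : \sum_(n < L) sqmod (cdisp psi t n) = sqs (dflow (cre_ psi) t) L + sqs (dflow (cim_ psi) t) L.
  by rewrite /sqs -big_split.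
have le1 : (nrm2 (cdisp psi t) <= 1%:E)%E.
  apply: rser_le => // L; rewrite E -T1; apply: lerD; exact: dflow_sqs_le.
have fn : nrm2 (cdisp psi t) \is a fin_num.
  by rewrite ge0_fin_numE ?nrm2_ge0// (le_lt_trans le1)// ltry.
apply/eqP; rewrite eq_le le1 /=; rewrite -(fineK fn) lee_fin -T1.
set B := fine _.
have hB L : sqs (dflow (cre_ psi) t) L + sqs (dflow (cim_ psi) t) L <= B.
  by rewrite -E -lee_fin fineK//; exact: rser_ge.
rewrite -lerBrDr; apply: (dflow_sqs_ge cx t01) => L.
rewrite lerBrDr -lerBrDl; apply: (dflow_sqs_ge cy t01) => L'.
rewrite lerBrDl; apply: le_trans (hB (maxn L L')).
by rewrite lerD// sqs_mono ?leq_maxl ?leq_maxr.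
Qed.

End Displacement.

Section StateDisplacement.
Variable R : realType.

Lemma Dst_val (psi : state R) t : 0 <= t <= 4^-1 -> svec (Dst t psi) = cdisp psi t.
Proof.
move=> t01; have p1 := sunit psi; rewrite /Dst (dispE p1 t01) /tostate.
by case: pselect => // -[]; exact: cdisp_unit.
Qed.

Lemma Dst0_val (psi : state R) : svec (Dst 0 psi) = psi.
Proof.
have t01 : 0 <= (0 : R) <= 4^-1 by rewrite lexx /= invr_ge0.
rewrite Dst_val//; apply/funext => n; rewrite /cdisp [RHS]complexE.
have h (x : nat -> R) : dflow x 0 n = x n.
  apply: cvg_lim => //; apply: cvg_near_cst; exists n.+1 => // N /= nN.
  by rewrite (flow0 _ (@rtrunc_fsupp _ N x)) /rtrunc nN.
by rewrite !h.
Qed.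

End StateDisplacement.

(** * Weighted sums over photon numbers *)

Section WeightedSums.
Variable R : realType.
Implicit Types (a b : nat -> R) (psi chi : cseq R) (s : state R).

Definition wsum a psi : \bar R := (\sum_(0 <= n <oo) (a n * sqmod (psi n))%:E)%E.

Definition lsum a psi : R := fine (wsum a psi).

Definition bweight a := forall n, 0 <= a n <= 1.

Lemma wsum_ge0 a psi : (forall n, 0 <= a n) -> (0 <= wsum a psi)%E.
Proof. by move=> a0; apply: nneseries_ge0 => n _ _; rewrite lee_fin mulr_ge0 ?sqmod_ge0. Qed.

Lemma le_wsum a b psi : (forall n, 0 <= a n) -> (forall n, a n <= b n) ->
  (wsum a psi <= wsum b psi)%E.
Proof.
move=> a0 ab; apply: lee_nneseries => n _; first by rewrite lee_fin mulr_ge0 ?sqmod_ge0.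
by rewrite lee_fin ler_wpM2r ?sqmod_ge0.
Qed.

Lemma wsumD a b psi : (forall n, 0 <= a n) -> (forall n, 0 <= b n) ->
  wsum (fun n => a n + b n) psi = (wsum a psi + wsum b psi)%E.
Proof.
move=> a0 b0; rewrite /wsum -nneseriesD => [|n _ _|n _ _].
- by apply: eq_eseriesr => n _; rewrite mulrDl EFinD.
- by rewrite lee_fin mulr_ge0 ?sqmod_ge0.
- by rewrite lee_fin mulr_ge0 ?sqmod_ge0.
Qed.

Lemma wsum1 s : wsum (fun=> 1) s = 1%:E.
Proof. by rewrite -(sunit s); apply: eq_eseriesr => n _; rewrite mul1r. Qed.

Lemma wsumZ (k : R) a psi : 0 <= k -> (forall n, 0 <= a n) ->
  wsum (fun n => k * a n) psi = (k%:E * wsum a psi)%E.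
Proof.
move=> k0 a0; rewrite /wsum -nneseriesZl => [|n _].
  by apply: eq_eseriesr => n _; rewrite -mulrA EFinM.
by rewrite lee_fin mulr_ge0 ?sqmod_ge0.
Qed.

Lemma wsum_le1 a s : bweight a -> (wsum a s <= 1)%E.
Proof.
move=> a01; rewrite -(wsum1 s); apply: le_wsum => n; by case/andP: (a01 n).
Qed.

Lemma wsum_fin a s : bweight a -> wsum a s \is a fin_num.
Proof.
move=> a01; rewrite ge0_fin_numE ?(le_lt_trans (wsum_le1 s a01)) ?ltry//.
by apply: wsum_ge0 => n; case/andP: (a01 n).
Qed.

Lemma lsumK a s : bweight a -> (lsum a s)%:E = wsum a s.
Proof. by move=> a01; rewrite fineK// wsum_fin. Qed.

Lemma lsum_ge0 a s : bweight a -> 0 <= lsum a s.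
Proof. by move=> a01; rewrite fine_ge0// wsum_ge0// => n; case/andP: (a01 n). Qed.

Lemma lsum_le1 a s : bweight a -> lsum a s <= 1.
Proof. by move=> a01; rewrite -lee_fin lsumK// wsum_le1. Qed.

Lemma lsumD a b s : bweight a -> bweight b ->
  lsum (fun n => a n + b n) s = lsum a s + lsum b s.
Proof.
move=> ha hb; rewrite {1}/lsum wsumD => [|n|n].
- by rewrite fineD ?wsum_fin.
- by case/andP: (ha n).
- by case/andP: (hb n).
Qed.

Lemma le_lsum a b s : bweight a -> bweight b -> (forall n, a n <= b n) -> lsum a s <= lsum b s.
Proof.
move=> ha hb ab; rewrite -lee_fin !lsumK//; apply: le_wsum => // n; by case/andP: (ha n).
Qed.

Lemma lsum1 s : lsum (fun=> 1) s = 1.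
Proof. by rewrite /lsum wsum1. Qed.

Lemma lsum_compl a s : bweight a -> lsum (fun n => 1 - a n) s = 1 - lsum a s.
Proof.
move=> ha; have hb : bweight (fun n => 1 - a n) by move=> n; case/andP: (ha n); lra.
rewrite -[in RHS](lsum1 s) (_ : (fun=> 1) = (fun n => a n + (1 - a n))).
  by rewrite lsumD// addrAC subrr add0r.
by apply/funext => n; rewrite addrC subrK.
Qed.

Lemma sqmod_rC (p : R) z : sqmod (rC p * z) = p ^+ 2 * sqmod z.
Proof. by rewrite rCM /sqmod /=; ring. Qed.

Variables (theta phi : R).
Local Notation cs n := (cos (phin theta phi n)).
Local Notation sn n := (sin (phin theta phi n)).

Definition cos2w n : R := cs n ^+ 2.
Definition sin2w n : R := sn n ^+ 2.

Lemma cos2w_bw : bweight cos2w.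
Proof. by move=> n; rewrite sqr_ge0 /= /cos2w; have := cos2Dsin2 (phin theta phi n); have := sqr_ge0 (sn n); lra. Qed.

Lemma sin2w_bw : bweight sin2w.
Proof. by move=> n; rewrite sqr_ge0 /= /sin2w; have := cos2Dsin2 (phin theta phi n); have := sqr_ge0 (cs n); lra. Qed.

Lemma sin2wE n : sin2w n = 1 - cos2w n.
Proof. by rewrite /sin2w /cos2w; have := cos2Dsin2 (phin theta phi n); lra. Qed.

Lemma nrm2_Mg psi : nrm2 (Mg theta phi psi) = wsum cos2w psi.
Proof. by apply: eq_eseriesr => n _; rewrite /Mg sqmod_rC. Qed.

Lemma nrm2_Me psi : nrm2 (Me theta phi psi) = wsum sin2w psi.
Proof. by apply: eq_eseriesr => n _; rewrite /Me sqmod_rC. Qed.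

Lemma lsum_sin2w s : lsum sin2w s = 1 - lsum cos2w s.
Proof.
rewrite -(lsum_compl s cos2w_bw); congr (lsum _ s); apply/funext => n; exact: sin2wE.
Qed.

(** For p the probability of outcome g, this is the sum of the fourth powers of the norms of [Mg]
    and [Me] applied to the state. *)
Definition purity (p : R) : R := p ^+ 2 + (1 - p) ^+ 2.

Variables (nbar : nat) (delta : R).

Lemma VE s : V nbar theta phi delta s =
  (wsum (sigma R nbar) s + (delta * (cs nbar ^+ 4 + sn nbar ^+ 4)
     - delta * purity (lsum cos2w s))%:E)%E.
Proof.
by rewrite /V nrm2_Mg nrm2_Me -/(lsum _ _) -/(lsum _ _) lsum_sin2w /purity EFinB addeA.
Qed.

End WeightedSums.

(** * Decrease of the Lyapunov function near Fock states *)

Section Gain.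
Variable R : realType.

Definition offdiag n (x : nat -> R) : nat -> R := fun m => if m == n then 0 else x m.

Lemma rtrunc_decomp N n (x : nat -> R) : (n < N)%N ->
  rtrunc N x = (fun m => x n * bvec R n m + 1 * offdiag n (rtrunc N x) m).
Proof.
move=> nN; apply/funext => m; rewrite /rtrunc /offdiag /bvec.
by case: eqVneq => [->|_]; rewrite ?nN ?mulr1 ?mulr0 ?addr0 ?add0r ?mul1r.
Qed.

Lemma offdiag_fsupp N n (x : nat -> R) : fsupp N x -> fsupp N (offdiag n x).
Proof. by move=> xN m Nm; rewrite /offdiag xN//; case: ifP. Qed.

Lemma sqs_offdiag_rtrunc N n (x : nat -> R) L :
  sqs (offdiag n (rtrunc N x)) L <= sqs (offdiag n x) L.
Proof.
apply: ler_sum => m _; rewrite /offdiag /rtrunc.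
by do 2!case: ifP => _ //; rewrite expr0n sqr_ge0.
Qed.

Lemma sqs_bvec n L : sqs (bvec R n) L <= 1.
Proof.
apply: (le_trans (sqs_fsupp L (@bvec_fsupp R n))).
rewrite /sqs big_ord_recr /= big1 => [|i _]; first by rewrite /bvec eqxx add0r expr1n.
by rewrite /bvec ltn_eqF// expr0n.
Qed.

Lemma energyZD (s : nat -> R) (a b : R) u v L :
  energy s (fun m => a * u m + b * v m) (fun m => a * u m + b * v m) L =
  a ^+ 2 * energy s u u L + 2 * a * b * energy s u v L + b ^+ 2 * energy s v v L.
Proof. by rewrite /energy !mulr_sumr -!big_split /=; apply: eq_bigr => i _; ring. Qed.

Lemma energy_bvec_offdiag s n x L : energy s (bvec R n) (offdiag n x) L = 0.
Proof.
by apply: big1 => m _; rewrite /bvec /offdiag; case: eqP => _; rewrite ?mul0r ?mulr0.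
Qed.

Lemma le_energy (s u : nat -> R) L L' : (forall n, 0 <= s n) -> (L <= L')%N -> energy s u u L <= energy s u u L'.
Proof.
move=> s0 LL'; rewrite /energy -!(big_mkord xpredT (fun i => s i * (u i * u i))).
rewrite (big_cat_nat (leq0n L) LL') /= lerDl; apply: sumr_ge0 => i _.
by rewrite mulr_ge0// -expr2 sqr_ge0.
Qed.

Lemma flow_decomp N n x t m : (n < N)%N -> 0 <= t <= 4^-1 ->
  flow (rtrunc N x) t m = x n * flow (bvec R n) t m + 1 * flow (offdiag n (rtrunc N x)) t m.
Proof.
move=> nN /andP[t0 t1]; rewrite (rtrunc_decomp x nN) (@flowZD _ N).
- by rewrite -(rtrunc_decomp x nN).
- exact: fsuppW (@bvec_fsupp R n).
- by apply: offdiag_fsupp; exact: rtrunc_fsupp.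
- by rewrite ger0_norm//; lra.
Qed.

Variable nbar : nat.
Local Notation sg := (sigma R nbar).

(** Split x into its component on |n> and a rest of mass at most q. The component loses energy by
    [flow_bvec_gain]. The cross term starts at 0, the weight being diagonal, and [tau] balances its
    growth against the small q. The rest can gain at most 4 q t, by [flow_energy] with [tau] = 1. *)
Lemma real_gain n : n != nbar -> exists2 Z : R, 0 <= Z &
  forall (x : nat -> R) (t tau q T Wx : R), 0 <= t <= 4^-1 -> 0 < tau ->
  sqs x @ \oo --> T -> `|x n| <= 1 -> (forall L, sqs (offdiag n x) L <= q) ->
  (forall L, energy sg x x L <= Wx) ->
  forall L, \sum_(m < L) sg m * dflow x t m ^+ 2 <=
    Wx + x n ^+ 2 * (- kappa R nbar n * t ^+ 2 + Z * t ^+ 3)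
    + t * (4 * (tau + tau^-1 * q) + 4 * q).
Proof.
move=> nn; have [Z Z0 hZ] := flow_bvec_gain R nn; exists Z => // x t tau q T Wx t01 tau0 xT xn1 xq xW L.
have [t0 t1] := andP t01.
have [S S0 hS] := sigma_growth R nbar.
have sb := @sigma_incr_sqrt R nbar.
have ti0 : 0 < tau^-1 by rewrite invr_gt0.
apply: (dflow_sum_le xT t01 (N0 := n.+1)) => N nN.
have [C1 C10 h1] := hZ t t01.
pose w := offdiag n (rtrunc N x).
have wN : fsupp N w by apply: offdiag_fsupp; exact: rtrunc_fsupp.
have bN : fsupp N (bvec R n) by exact: fsuppW (@bvec_fsupp R n).
have [C2 C20 h2] := flow_energy bN wN hS sb tau0.
have [C3 C30 h3] := flow_energy wN wN hS sb (ltr01 : (0 : R) < 1).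
apply: (@le_geo _ _ _ (C1 + 2 * C2 + C3) (maxn L n.+1)) => L'.
rewrite geq_max => /andP[LL' nL'].
have wq : sqs w L'.+1 <= q by apply: le_trans (xq L'.+1); exact: sqs_offdiag_rtrunc.
apply: (@le_trans _ _ (energy sg (flow (rtrunc N x) t) (flow (rtrunc N x) t) L'.+1)).
  apply: (@le_trans _ _ (energy sg (flow (rtrunc N x) t) (flow (rtrunc N x) t) L)).
    by apply: ler_sum => i _; rewrite expr2.
  by apply: le_energy => [m|]; [exact: sigma_ge0|exact: leqW].
have -> : flow (rtrunc N x) t = (fun m => x n * flow (bvec R n) t m + 1 * flow w t m).
  by apply/funext => m; rewrite (flow_decomp _ _ nN).
rewrite energyZD expr1n mul1r mulr1.
have e1 := h1 L' nL'.
have := h2 t L' t01; rewrite energy_bvec_offdiag subr0 !sqs_energy => e2.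
have := h3 t L' t01; rewrite !sqs_energy ler_norml lerBlDl invr1 !mul1r => /andP[_ e3].
have E : energy sg (rtrunc N x) (rtrunc N x) L'.+1 = x n ^+ 2 * sg n + energy sg w w L'.+1.
  rewrite (rtrunc_decomp x nN) energyZD -/w expr1n mul1r mulr1 energy_bvec_offdiag mulr0 addr0.
  congr (_ * _ + _); have nL : (n < L'.+1)%N by exact: leqW.
  rewrite /energy (bigD1 (Ordinal nL))//= big1 => [|i /negbTE ni]; first by rewrite /bvec eqxx !mulr1 addr0.
  by rewrite /bvec (_ : (i == n :> nat) = false) ?mul0r ?mulr0// -ni.
have Ew : energy sg (rtrunc N x) (rtrunc N x) L'.+1 <= Wx.
  apply: le_trans (xW L'.+1); apply: ler_sum => i _; rewrite /rtrunc; case: ifP => // _.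
  by rewrite !mulr0 mulr_ge0 ?sigma_ge0// -expr2 sqr_ge0.
have x2 : x n ^+ 2 <= 1 by rewrite -real_normK ?num_real// expr_le1.
have p0 : 0 <= (4 ^+ L')^-1 :> R by rewrite invr_ge0 exprn_ge0.
have f1 := ler_wpM2l (sqr_ge0 (x n)) e1.
have f2 : 2 * x n * energy sg (flow (bvec R n) t) (flow w t) L'.+1 <=
   2 * (t * (2 * (tau + tau^-1 * q)) + C2 / 4 ^+ L').
  rewrite -mulrA ler_wpM2l//; apply: (le_trans (ler_norm _)); rewrite normrM.
  apply: (@le_trans _ _ `|energy sg (flow (bvec R n) t) (flow w t) L'.+1|).
    by rewrite ler_piMl.
  apply: (le_trans e2); rewrite lerD2r ler_wpM2l// ler_wpM2l// lerD//.
    by rewrite -[leRHS]mulr1 ler_wpM2l ?sqs_bvec// ltW.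
  by rewrite ler_wpM2l// ltW.
have f3 : energy sg (flow w t) (flow w t) L'.+1 <= energy sg w w L'.+1 + (t * (4 * q) + C3 / 4 ^+ L').
  apply: (le_trans e3); rewrite lerD2l lerD2r ler_wpM2l//; lra.
have g1 : x n ^+ 2 * (C1 / 4 ^+ L') <= C1 / 4 ^+ L' by rewrite ler_piMl// mulr_ge0.
move: f1 f2 f3 g1 Ew; rewrite E; move: (4 ^+ L')^-1 p0 => P p0.
move: (energy _ _ _ _) (energy _ _ _ _) (energy _ _ _ _) (energy _ _ _ _) => E1 E2 E3 E4.
move: (x n ^+ 2) => X; move: tau^-1 => ti; lra.
Qed.

(** Only a fraction of order t^2 of the mass on |n> leaves it. This keeps the outcome probabilities,
    hence the purity term of V, nearly constant under the control. *)
Lemma real_leak n : exists2 Z : R, 0 <= Z &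
  forall (a x : nat -> R) (t tau q T : R), bweight a -> 0 <= t <= 4^-1 -> 0 < tau ->
  sqs x @ \oo --> T -> (forall L, sqs (offdiag n x) L <= q) ->
  forall L, \sum_(m < L) a m * dflow x t m ^+ 2 <=
    (1 + tau) * x n ^+ 2 * (a n + Z * t ^+ 2) + (1 + tau^-1) * q.
Proof.
have [Z Z0 hZ] := flow_bvec_lost R n; exists Z => // a x t tau q T a01 t01 tau0 xT xq L.
have [t0 t1] := andP t01.
have ti0 : 0 < tau^-1 by rewrite invr_gt0.
have ki : tau * tau^-1 = 1 by rewrite mulfV// gt_eqF.
apply: (dflow_sum_le xT t01 (N0 := n.+1)) => N nN.
pose w := offdiag n (rtrunc N x).
have wN : fsupp N w by apply: offdiag_fsupp; exact: rtrunc_fsupp.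
have hw : sqs (flow w t) L <= q.
  apply: (le_trans (flow_contract L wN t01)); apply: le_trans (xq N); exact: sqs_offdiag_rtrunc.
have he : \sum_(m < L) a m * flow (bvec R n) t m ^+ 2 <= a n + Z * t ^+ 2.
  rewrite (bigID (fun m : 'I_L => val m == n)) /=; apply: lerD.
    apply: (@le_trans _ _ (a n * sqs (flow (bvec R n) t) L)).
      rewrite /sqs mulr_sumr [leRHS](bigID (fun m : 'I_L => val m == n)) /= -[leLHS]addr0 lerD//.
        by apply: ler_sum => m /eqP ->.
      by apply: sumr_ge0 => m _; rewrite mulr_ge0 ?sqr_ge0//; case/andP: (a01 n).
    rewrite ler_piMr//; first by case/andP: (a01 n).
    apply: (le_trans (flow_contract L (@bvec_fsupp R n) t01)); exact: sqs_bvec.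
  apply: le_trans (hZ t L t01); apply: ler_sum => m _.
  by rewrite ler_piMl ?sqr_ge0//; case/andP: (a01 m).
apply: (@le_trans _ _ ((1 + tau) * x n ^+ 2 * (\sum_(m < L) a m * flow (bvec R n) t m ^+ 2)
   + (1 + tau^-1) * sqs (flow w t) L)); last first.
  have k1 : 0 <= (1 + tau) * x n ^+ 2 by rewrite mulr_ge0 ?sqr_ge0// addr_ge0// ltW.
  have k2 : 0 <= 1 + tau^-1 by rewrite addr_ge0// ltW.
  by apply: lerD; apply: ler_wpM2l.
rewrite /sqs !mulr_sumr -big_split /=; apply: ler_sum => m _.
rewrite (flow_decomp _ _ nN)// -/w mul1r; have [a0 a1] := andP (a01 m).
move: (flow (bvec R n) t m) (flow w t m) => p r.
have k0 : (x n * p + r) ^+ 2 <= (1 + tau) * x n ^+ 2 * p ^+ 2 + (1 + tau^-1) * r ^+ 2.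
  have := mulr_ge0 (ltW tau0) (sqr_ge0 (x n * p - tau^-1 * r)).
  rewrite [X in 0 <= X](_ : _ = tau * (x n * p) ^+ 2 - 2 * (tau * tau^-1) * (x n * p) * r + tau * tau^-1 * tau^-1 * r ^+ 2); last by ring.
  by rewrite ki; move: tau^-1 => k'; nra.
apply: (@le_trans _ _ (a m * ((1 + tau) * x n ^+ 2 * p ^+ 2 + (1 + tau^-1) * r ^+ 2))).
  by rewrite ler_wpM2l.
rewrite mulrDr mulrCA lerD2l; apply: ler_piMl => //.
by rewrite mulr_ge0 ?sqr_ge0// addr_ge0// ltW.
Qed.

End Gain.

(** * Decrease of V for states close to a Fock state *)

Section StateGain.
Variable R : realType.

(** Turns a joint bound on the energies of real and imaginary parts into separate bounds with the
    same total. *)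
Lemma nondecreasing_sum_split (u v : nat -> R) (B : R) :
  nondecreasing_seq u -> nondecreasing_seq v -> (forall L, 0 <= u L) -> (forall L, 0 <= v L) ->
  (forall L, u L + v L <= B) ->
  exists a b : R, [/\ forall L, u L <= a, forall L, v L <= b & a + b <= B].
Proof.
move=> nu nv u0 v0 uvB.
have cu : cvgn u.
  by apply: nondecreasing_is_cvgn => //; exists B => _ [L _ <-]; have := uvB L; have := v0 L; lra.
have cv : cvgn v.
  by apply: nondecreasing_is_cvgn => //; exists B => _ [L _ <-]; have := uvB L; have := u0 L; lra.
exists (limn u), (limn v); split=> [L|L|].
- exact: nondecreasing_cvgn_le.
- exact: nondecreasing_cvgn_le.
- have c : (fun L => u L + v L) @ \oo --> limn u + limn v by apply: cvgD.
  rewrite -(cvg_lim (@Rhausdorff R) c); apply: limr_le; first by apply/cvg_ex; eexists; exact: c.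
  by apply: nearW => L.
Qed.

Lemma sqs_offdiag (x : nat -> R) (T : R) n L : sqs x @ \oo --> T ->
  sqs (offdiag n x) L <= T - x n ^+ 2.
Proof.
move=> xT; apply: (@le_trans _ _ (sqs (offdiag n x) (maxn L n.+1))).
  by apply: sqs_mono; exact: leq_maxl.
rewrite lerBrDr; apply: le_trans (sqs_le_lim xT (maxn L n.+1)).
have nL : (n < maxn L n.+1)%N by exact: leq_maxr.
rewrite /sqs (bigD1 (Ordinal nL)) //= [leRHS](bigD1 (Ordinal nL)) //=.
have -> : offdiag n x n ^+ 2 = 0 by rewrite /offdiag eqxx expr0n.
rewrite add0r [leLHS]addrC lerD2l; apply: ler_sum => i ni.
by rewrite /offdiag; case: ifP => //; rewrite expr0n sqr_ge0.
Qed.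

Lemma wsum_cdisp_le (psi : cseq R) (a : nat -> R) t (B : R) : (forall n, 0 <= a n) ->
  (forall L, \sum_(m < L) a m * dflow (cre_ psi) t m ^+ 2
     + \sum_(m < L) a m * dflow (cim_ psi) t m ^+ 2 <= B) ->
  (wsum a (cdisp psi t) <= B%:E)%E.
Proof.
move=> a0 h; apply: rser_le => [n|L]; first by rewrite mulr_ge0 ?sqmod_ge0.
apply: le_trans (h L); rewrite -big_split /=; apply: ler_sum => m _.
by rewrite /cdisp /sqmod /= mulrDr.
Qed.

Lemma sqmod_parts (psi : state R) n : exists Tx Ty : R,
  [/\ sqs (cre_ psi) @ \oo --> Tx, sqs (cim_ psi) @ \oo --> Ty,
     (Tx - cre_ psi n ^+ 2) + (Ty - cim_ psi n ^+ 2) = 1 - sqmod (psi n),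
     `|cre_ psi n| <= 1 & `|cim_ psi n| <= 1].
Proof.
have [Tx [Ty [cx cy T1]]] := unit_parts (sunit psi).
exists Tx, Ty; split => //.
- rewrite sqmodE; lra.
- have h : cre_ psi n ^+ 2 <= 1.
    have := sqs_offdiag n 0 cx; have := sqs_le_lim cy 0; rewrite /sqs !big_ord0; lra.
  by rewrite -(@expr_le1 _ 2)// real_normK ?num_real.
- have h : cim_ psi n ^+ 2 <= 1.
    have := sqs_offdiag n 0 cy; have := sqs_le_lim cx 0; rewrite /sqs !big_ord0; lra.
  by rewrite -(@expr_le1 _ 2)// real_normK ?num_real.
Qed.

(** The mass off |n> is below tau^2, so with [tau] as weight in Young's inequality the term q / tau
    is at most [tau]. *)
Lemma leak_bound n : exists2 Z : R, 0 <= Z & forall (a : nat -> R) (t tau : R) (psi : state R),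
  bweight a -> 0 <= t <= 4^-1 -> 0 < tau <= 2^-1 -> 1 - tau ^+ 2 < sqmod (psi n) ->
  lsum a (Dst t psi) <= lsum a psi + Z * t ^+ 2 + tau * (4 + Z).
Proof.
have [Z Z0 hZ] := real_leak R n; exists Z => // a t tau psi a01 t01 /andP[tau0 tau1] hn.
have [t0 t1] := andP t01.
have [Tx [Ty [cx cy Txy xn1 yn1]]] := sqmod_parts psi n.
have a0 m : 0 <= a m by case/andP: (a01 m).
have lo : a n * sqmod (psi n) <= lsum a psi.
  rewrite -lee_fin lsumK//; apply: (rser_ge1 (f := fun n => a n * sqmod (psi n))) => m.
  by rewrite mulr_ge0 ?sqmod_ge0.
have ki : tau * tau^-1 = 1 by rewrite mulfV// gt_eqF.
set r := sqmod (psi n) in hn lo Txy.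
have r1 : r <= 1.
  have := sqs_offdiag n 0 cx; have := sqs_offdiag n 0 cy; rewrite /sqs !big_ord0; lra.
have up : lsum a (Dst t psi) <= (1 + tau) * r * (a n + Z * t ^+ 2) + (1 + tau^-1) * (1 - r).
  rewrite -lee_fin lsumK// Dst_val//; apply: wsum_cdisp_le => // L.
  have := hZ a (cre_ psi) t tau _ Tx a01 t01 tau0 cx (fun L => sqs_offdiag n L cx) L.
  have := hZ a (cim_ psi) t tau _ Ty a01 t01 tau0 cy (fun L => sqs_offdiag n L cy) L.
  rewrite -Txy /r sqmodE; move: tau^-1 (\sum_(_ < _) _) (\sum_(_ < _) _) => ti s1 s2; lra.
apply: (le_trans up).
have h1 : (1 + tau^-1) * (1 - r) <= tau ^+ 2 + tau.
  have ti0 : 0 < tau^-1 by rewrite invr_gt0.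
  have : tau^-1 * (1 - r) <= tau^-1 * tau ^+ 2 by rewrite ler_wpM2l ?(ltW ti0)//; lra.
  rewrite expr2 mulrA mulVf ?gt_eqF// mul1r; lra.
have an1 : a n <= 1 by case/andP: (a01 n).
have z0 : 0 <= Z * t ^+ 2 by rewrite mulr_ge0 ?sqr_ge0.
have z1 : Z * t ^+ 2 <= Z by rewrite ler_piMr// expr_le1//; lra.
have h2 : (1 + tau) * r * (a n + Z * t ^+ 2) <= (1 + tau) * (a n + Z * t ^+ 2).
  by rewrite ler_wpM2r ?addr_ge0// ler_piMr//; lra.
have h3 : a n * r >= a n - tau ^+ 2.
  have := a0 n; nra.
have h4 : tau * (a n + Z * t ^+ 2) <= tau * (1 + Z) by rewrite ler_wpM2l ?(ltW tau0)//; lra.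
have h5 : tau ^+ 2 <= tau * 2^-1 by rewrite expr2 ler_wpM2l// ltW.
lra.
Qed.

Variables (nbar : nat) (theta phi : R).

Lemma energy_gain n : n != nbar -> exists2 Z : R, 0 <= Z &
  forall (t tau : R) (psi : state R), 0 <= t <= 4^-1 -> 0 < tau <= 2^-1 ->
  1 - tau ^+ 2 < sqmod (psi n) ->
  (wsum (sigma R nbar) (Dst t psi) <= wsum (sigma R nbar) psi +
   (- kappa R nbar n * t ^+ 2 / 2 + Z * t ^+ 3 + 16 * t * tau)%:E)%E.
Proof.
move=> nn; have [Z Z0 hZ] := real_gain R nn; exists Z => // t tau psi t01 /andP[tau0 tau1] hn.
have [t0 t1] := andP t01.
have k0 := kappa_gt0 R nn.
have [Tx [Ty [cx cy Txy xn1 yn1]]] := sqmod_parts psi n.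
have s0 := @sigma_ge0 R nbar.
have W0 : (0 <= wsum (sigma R nbar) psi)%E by exact: wsum_ge0.
have [->|Woo] := eqVneq (wsum (sigma R nbar) psi) +oo%E; first by rewrite addye// leey.
have Wf : wsum (sigma R nbar) psi \is a fin_num.
  by rewrite ge0_fin_numE// lt_neqAle Woo leey.
have E0 (x : nat -> R) L : 0 <= energy (sigma R nbar) x x L.
  by apply: sumr_ge0 => i _; rewrite mulr_ge0// -expr2 sqr_ge0.
have [|||Wx [Wy [hx hy hW]]] := @nondecreasing_sum_split
  (energy (sigma R nbar) (cre_ psi) (cre_ psi)) (energy (sigma R nbar) (cim_ psi) (cim_ psi))
  (fine (wsum (sigma R nbar) psi)) _ _ (E0 _) (E0 _).
- by move=> L L' LL'; apply: le_energy.
- by move=> L L' LL'; apply: le_energy.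
- move=> L; rewrite -lee_fin fineK//.
  apply: le_trans (@rser_ge _ (fun n => sigma R nbar n * sqmod (psi n)) L _) => [|m].
    by rewrite lee_fin -big_split /=; apply: ler_sum => m _; rewrite sqmodE -mulrDr !expr2.
  by rewrite mulr_ge0 ?sqmod_ge0.
rewrite -[X in (_ <= X + _)%E](fineK Wf) -EFinD Dst_val//.
have ki : tau * tau^-1 = 1 by rewrite mulfV// gt_eqF.
have ti0 : 0 < tau^-1 by rewrite invr_gt0.
set r := sqmod (psi n) in hn Txy.
have r1 : r <= 1.
  have := sqs_offdiag n 0 cx; have := sqs_offdiag n 0 cy; rewrite /sqs !big_ord0; lra.
apply: wsum_cdisp_le => // L.
have g1 := hZ (cre_ psi) t tau _ Tx Wx t01 tau0 cx xn1 (fun L => sqs_offdiag n L cx) hx L.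
have g2 := hZ (cim_ psi) t tau _ Ty Wy t01 tau0 cy yn1 (fun L => sqs_offdiag n L cy) hy L.
have h1 : tau^-1 * (1 - r) <= tau.
  have : tau^-1 * (1 - r) <= tau^-1 * tau ^+ 2 by rewrite ler_wpM2l ?(ltW ti0)//; lra.
  by rewrite expr2 mulrA mulVf ?gt_eqF// mul1r.
have h5 : tau ^+ 2 <= tau * 2^-1 by rewrite expr2 ler_wpM2l// ltW.
have h6 : t * (4 * (2 * tau + tau^-1 * (1 - r)) + 4 * (1 - r)) <= t * (16 * tau).
  by rewrite ler_wpM2l//; lra.
have t20 : 0 <= t ^+ 2 by rewrite sqr_ge0.
have t30 : 0 <= Z * t ^+ 3 by rewrite mulr_ge0 ?exprn_ge0.
have r2 : 2^-1 <= r by lra.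
have h7 : r * (- kappa R nbar n * t ^+ 2 + Z * t ^+ 3) <= - kappa R nbar n * t ^+ 2 / 2 + Z * t ^+ 3.
  rewrite mulrDr lerD//; last by rewrite ler_piMl.
  have : 0 <= kappa R nbar n * t ^+ 2 by rewrite mulr_ge0// ltW.
  by rewrite !mulNr mulrN => k1; nra.
rewrite -Txy in h6; rewrite {1}/r sqmodE in h7.
move: g1 g2 h6 h7 hW; move: tau^-1 (\sum_(_ < _) _) (\sum_(_ < _) _) => ti S1 S2; lra.
Qed.

Lemma V_gain n : n != nbar -> exists k Z : R, [/\ 0 < k, 0 <= Z &
  forall (t tau delta : R) (psi : state R), 0 <= t <= 4^-1 -> 0 < tau <= 2^-1 -> 0 <= delta ->
  1 - tau ^+ 2 < sqmod (psi n) ->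
  (V nbar theta phi delta (Dst t psi) <= V nbar theta phi delta psi +
   (- k * t ^+ 2 + Z * t ^+ 3 + 16 * t * tau + 2 * delta * (Z * t ^+ 2 + tau * (4 + Z)))%:E)%E].
Proof.
move=> nn; have [Z1 Z10 h1] := energy_gain nn; have [Z2 Z20 h2] := leak_bound n.
have k0 := kappa_gt0 R nn.
exists (kappa R nbar n / 2), (Z1 + Z2); split; [by rewrite divr_gt0|by rewrite addr_ge0|].
move=> t tau delta psi t01 tau01 d0 hn; have [t0 t1] := andP t01; have [tau0 tau1] := andP tau01.
have e1 := h1 t tau psi t01 tau01 hn.
(* Upper bounds for a weight and for its complement bound the change of the outcome probability from
   both sides. *)
have ec := h2 _ t tau psi (@cos2w_bw R theta phi) t01 tau01 hn.
have es := h2 _ t tau psi (@sin2w_bw R theta phi) t01 tau01 hn.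
rewrite !lsum_sin2w in es; rewrite !VE.
set p := lsum _ psi in ec es *; set p' := lsum _ _ in ec es *.
have /andP[p0 p1] : 0 <= p <= 1 by rewrite lsum_ge0 ?lsum_le1//; exact: cos2w_bw.
have /andP[p'0 p'1] : 0 <= p' <= 1 by rewrite lsum_ge0 ?lsum_le1//; exact: cos2w_bw.
set k := _ ^+ 4 + _.
apply: (@le_trans _ _ (wsum (sigma R nbar) psi + (- kappa R nbar n * t ^+ 2 / 2 + Z1 * t ^+ 3 + 16 * t * tau)%:E
  + (delta * k - delta * purity p')%:E)%E); first by rewrite leeD2r.
rewrite -!addeA leeD2l// -!EFinD lee_fin.
set s := Z2 * t ^+ 2 + tau * (4 + Z2).
have hp : purity p - purity p' <= 2 * s.
  have s1 : p' - p <= s by rewrite /s; lra.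
  have s2 : p - p' <= s by rewrite /s; lra.
  rewrite /purity; nra.
have hd := ler_wpM2l d0 hp.
have t20 : 0 <= t ^+ 2 by rewrite sqr_ge0.
have t30 : 0 <= t ^+ 3 by rewrite exprn_ge0.
have i1 : Z1 * t ^+ 3 <= (Z1 + Z2) * t ^+ 3 by rewrite ler_wpM2r//; lra.
have i2 : s <= (Z1 + Z2) * t ^+ 2 + tau * (4 + (Z1 + Z2)).
  rewrite /s lerD//; first by rewrite ler_wpM2r//; lra.
  by rewrite ler_wpM2l ?(ltW tau0)//; lra.
have := ler_wpM2l d0 i2; move: i1 hd; rewrite !mulNr; move: (purity p) (purity p') => f f'; lra.
Qed.

Lemma V_gain_uniform n0 : exists k Z : R, [/\ 0 < k, 0 <= Z &
  forall n (t tau delta : R) (psi : state R), (n <= n0)%N -> n != nbar ->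
  0 <= t <= 4^-1 -> 0 < tau <= 2^-1 -> 0 <= delta ->
  1 - tau ^+ 2 < sqmod (psi n) ->
  (V nbar theta phi delta (Dst t psi) <= V nbar theta phi delta psi +
   (- k * t ^+ 2 + Z * t ^+ 3 + 16 * t * tau + 2 * delta * (Z * t ^+ 2 + tau * (4 + Z)))%:E)%E].
Proof.
pose P (k Z : R) n := forall (t tau delta : R) (psi : state R), 0 <= t <= 4^-1 ->
  0 < tau <= 2^-1 -> 0 <= delta -> 1 - tau ^+ 2 < sqmod (psi n) ->
  (V nbar theta phi delta (Dst t psi) <= V nbar theta phi delta psi +
   (- k * t ^+ 2 + Z * t ^+ 3 + 16 * t * tau + 2 * delta * (Z * t ^+ 2 + tau * (4 + Z)))%:E)%E.
have mono k Z k' Z' n : k' <= k -> Z <= Z' -> P k Z n -> P k' Z' n.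
  move=> kk ZZ h t tau delta psi t01 tau01 d0 hn.
  apply: (le_trans (h _ _ _ _ t01 tau01 d0 hn)); rewrite leeD2l// lee_fin.
  have [t0 t1] := andP t01; have [tau0 tau1] := andP tau01.
  have t20 : 0 <= t ^+ 2 by rewrite sqr_ge0.
  have t30 : 0 <= t ^+ 3 by rewrite exprn_ge0.
  have i1 := ler_wpM2r t20 kk; have i2 := ler_wpM2r t30 ZZ.
  have i3 : Z * t ^+ 2 + tau * (4 + Z) <= Z' * t ^+ 2 + tau * (4 + Z').
    by rewrite lerD ?ler_wpM2r// ler_wpM2l ?(ltW tau0)//; lra.
  have := ler_wpM2l d0 i3; rewrite !mulNr; lra.
suff [k [Z [k0 Z0 h]]] : exists k Z : R, [/\ 0 < k, 0 <= Z & forall n, (n <= n0)%N -> n != nbar -> P k Z n].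
  by exists k, Z; split => // n t tau delta psi nn0 nn; exact: h.
have one n : exists k Z : R, [/\ 0 < k, 0 <= Z & n != nbar -> P k Z n].
  have [->|nn] := eqVneq n nbar; first by exists 1, 0; split.
  by have [k [Z [? ? ?]]] := V_gain nn; exists k, Z.
elim: n0 => [|n0 [k [Z [k0 Z0 h]]]].
  by have [k [Z [? ? h]]] := one 0%N; exists k, Z; split => // n; rewrite leqn0 => /eqP ->.
have [k' [Z' [k'0 Z'0 h']]] := one n0.+1.
exists (Num.min k k'), (Num.max Z Z'); split.
- by rewrite lt_min k0.
- by rewrite le_max Z0.
- move=> n; rewrite leq_eqVlt => /orP[/eqP -> nn|]; last rewrite ltnS => nn0 nn.
    by apply: mono (h' nn); rewrite ?ge_min ?le_max ?lexx ?orbT.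
  by apply: mono (h n nn0 nn); rewrite ?ge_min ?le_max ?lexx ?orbT.
Qed.

End StateGain.

(** * The one-step supermartingale inequality *)

Section OneStep.
Variable R : realType.
Implicit Types (psi : state R) (m a : nat -> R).

(** Here p and A are the means of cos^2 and cos^4, and the two quotients are the probabilities of g
    after the outcomes g and e, with mean p. Purity being quadratic, the Jensen gap is exactly 2 (A
    - p^2)^2 / (p (1 - p)). At p = 0 and p = 1 the quotient by 0 is 0 and the gap vanishes. *)
Lemma purity_jensen (p A : R) : 0 <= p <= 1 -> 0 <= A <= p -> p - A <= 1 - p ->
  purity p + 2 * (A - p ^+ 2) ^+ 2 <= p * purity (A / p) + (1 - p) * purity ((p - A) / (1 - p)).
Proof.
move=> /andP[p0 p1] /andP[A0 Ap] pA.
have [pe0|pn0] := eqVneq p 0.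
  have A00 : A = 0 by lra.
  by rewrite pe0 A00 /purity !(mul0r, subr0, divr1); lra.
have [pe1|pn1] := eqVneq p 1.
  have A1 : A = 1 by lra.
  by rewrite pe1 A1 /purity !(subrr, mul0r, divr1); lra.
have p0' : 0 < p by rewrite lt_neqAle eq_sym pn0.
have p1' : 0 < 1 - p by rewrite subr_gt0 lt_neqAle pn1.
have e : p * purity (A / p) + (1 - p) * purity ((p - A) / (1 - p)) =
  purity p + 2 * (A - p ^+ 2) ^+ 2 / (p * (1 - p)).
  by rewrite /purity; field; rewrite pn0 /= subr_eq0 eq_sym pn1.
have pp : p * (1 - p) <= 1 by have := sqr_ge0 p; rewrite expr2; lra.
by rewrite e lerD2l ler_pdivlMr ?mulr_gt0// ler_piMr// mulr_ge0// sqr_ge0.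
Qed.

Definition Mdiag m (psi : cseq R) : cseq R := fun n => rC (m n) * psi n.

Definition sqw m : nat -> R := fun n => m n ^+ 2.

Lemma nrm2_Mdiag m (psi : cseq R) : nrm2 (Mdiag m psi) = wsum (sqw m) psi.
Proof. by apply: eq_eseriesr => n _; rewrite /Mdiag sqmod_rC. Qed.

Lemma qprob_Mdiag m psi : qprob (Mdiag m) psi = lsum (sqw m) psi.
Proof. by rewrite /qprob nrm2_Mdiag. Qed.

Lemma sqmod_qhalf m psi n : bweight (sqw m) -> 0 < lsum (sqw m) psi ->
  sqmod (qhalf (Mdiag m) psi n) = (lsum (sqw m) psi)^-1 * (sqw m n * sqmod (psi n)).
Proof.
move=> m1 p0; rewrite /qhalf qprob_Mdiag /tostate.
have E k : sqmod (rC (Num.sqrt (lsum (sqw m) psi))^-1 * Mdiag m psi k) =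
   (lsum (sqw m) psi)^-1 * (sqw m k * sqmod (psi k)).
  by rewrite sqmod_rC exprVn sqr_sqrtr ?(ltW p0)// /Mdiag sqmod_rC.
case: pselect => [h|[]]; first by rewrite /= E.
rewrite /unit_vec /nrm2; under eq_eseriesr do rewrite E EFinM.
rewrite nneseriesZl => [|k _]; last by rewrite lee_fin mulr_ge0 ?sqmod_ge0//; case/andP: (m1 k).
by rewrite -/(wsum _ _) -lsumK// -EFinM mulVf// gt_eqF.
Qed.

Lemma wsum_qhalf m a psi : bweight (sqw m) -> (forall n, 0 <= a n) -> 0 < lsum (sqw m) psi ->
  ((lsum (sqw m) psi)%:E * wsum a (qhalf (Mdiag m) psi) = wsum (fun n => a n * sqw m n)%R psi)%E.
Proof.
move=> m1 a0 p0; rewrite /wsum -nneseriesZl => [|n _]; last by rewrite lee_fin mulr_ge0 ?sqmod_ge0.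
apply: eq_eseriesr => n _; rewrite sqmod_qhalf// -EFinM; congr EFin.
have : lsum (sqw m) psi / lsum (sqw m) psi = 1 by rewrite mulfV// gt_eqF.
move: (_^-1) => v e; rewrite [LHS](_ : _ = lsum (sqw m) psi * v * (a n * sqw m n * sqmod (psi n))); last by ring.
by rewrite e mul1r.
Qed.

Lemma bweightM a m : bweight a -> bweight m -> bweight (fun n => a n * m n).
Proof.
move=> ha hm n; have /andP[a0 a1] := ha n; have /andP[m0 m1] := hm n.
by rewrite mulr_ge0//= -[leRHS]mulr1 ler_pM.
Qed.

Lemma lsum_qhalf m a psi : bweight (sqw m) -> bweight a -> 0 < lsum (sqw m) psi ->
  lsum a (qhalf (Mdiag m) psi) = lsum (fun n => a n * sqw m n) psi / lsum (sqw m) psi.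
Proof.
move=> m1 a1 p0.
have <- : lsum (sqw m) psi * lsum a (qhalf (Mdiag m) psi) = lsum (fun n => a n * sqw m n) psi.
  apply: EFin_inj; rewrite EFinM !lsumK//; last exact: bweightM.
  by rewrite -(lsumK _ m1) wsum_qhalf// => n; case/andP: (a1 n).
by rewrite mulrAC mulfV ?gt_eqF// mul1r.
Qed.

Lemma lsum_delta n (k : R) psi : 0 <= k <= 1 ->
  lsum (fun i => if i == n then k else 0) psi = k * sqmod (psi n).
Proof.
move=> /andP[k0 k1].
have d0 i : 0 <= (if i == n then k else 0) * sqmod (psi i) by case: ifP; rewrite ?mul0r// mulr_ge0 ?sqmod_ge0.
apply: EFin_inj; rewrite lsumK; last by move=> i; case: ifP; rewrite ?k0 ?lexx ?ler01.
apply/eqP; rewrite eq_le; apply/andP; split; last first.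
  by apply: le_trans (rser_ge1 n d0); rewrite eqxx.
apply: rser_le => // L; have [nL|Ln] := ltnP n L.
  rewrite (bigD1 (Ordinal nL))//= eqxx big1 ?addr0// => i /negbTE ni.
  by rewrite (_ : (i == n :> nat) = false) ?mul0r// -ni.
rewrite big1 => [|i _]; first by rewrite mulr_ge0 ?sqmod_ge0.
by rewrite ltn_eqF ?mul0r// (leq_trans _ Ln).
Qed.

Lemma lsum_le_split m n psi : bweight m -> lsum m psi <= m n * sqmod (psi n) + (1 - sqmod (psi n)).
Proof.
move=> m1; have /andP[mn0 mn1] := m1 n.
have h : bweight (fun i => if i == n then 1 - m n else 0).
  by move=> i; case: ifP => _; rewrite ?lexx ?ler01//; lra.
apply: (@le_trans _ _ (lsum (fun i => 1 - (if i == n then 1 - m n else 0)) psi)).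
  apply: le_lsum => // i; first by case/andP: (h i); lra.
  by case: eqP => [->|_]; [lra|case/andP: (m1 i); lra].
by rewrite lsum_compl// lsum_delta; lra.
Qed.

Variables (nbar : nat) (theta phi delta abar : R) (fb : state R -> R).
Hypothesis d0 : 0 < delta.
Hypothesis abar01 : 0 <= abar <= 4^-1.
Hypothesis fbP : feedback nbar theta phi delta abar fb.

Local Notation VV := (V nbar theta phi delta).
Local Notation c2 := (cos2w theta phi).
Local Notation s2 := (sin2w theta phi).
Local Notation kk := (cos (phin theta phi nbar) ^+ 4 + sin (phin theta phi nbar) ^+ 4).

(** Purity is at most 1, so the shift makes V nonnegative and gives access to integrals defined as
    suprema. *)
Definition V' psi : \bar R := (VV psi + delta%:E)%E.

Lemma V'E psi : V' psi = (wsum (sigma R nbar) psi + (delta * (kk + 1) - delta * purity (lsum c2 psi))%:E)%E.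
Proof. by rewrite /V' VE -addeA -EFinD; congr (_ + _%:E)%E; ring. Qed.

Lemma purity01 (p : R) : 0 <= p <= 1 -> 0 <= purity p <= 1.
Proof. by rewrite /purity => /andP[h1 h2]; nra. Qed.

Lemma kk_ge0 : 0 <= kk.
Proof. by rewrite addr_ge0// exprn_even_ge0. Qed.

Lemma V'_ge0 psi : (0 <= V' psi)%E.
Proof.
rewrite V'E adde_ge0//; first by apply: wsum_ge0; exact: sigma_ge0.
rewrite lee_fin -mulrBr mulr_ge0 ?(ltW d0)//.
have : 0 <= lsum c2 psi <= 1 by rewrite lsum_ge0 ?lsum_le1//; exact: cos2w_bw.
by move/purity01 => /andP[_]; have := kk_ge0; lra.
Qed.

Lemma V_qnext_le M psi (c : R) : (VV (Dst abar (qhalf M psi)) + c%:E <= VV (qhalf M psi))%E ->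
  (VV (qnext fb M psi) + c%:E <= VV (qhalf M psi))%E.
Proof.
move=> h; have [_ hb] := fbP (qhalf M psi).
have ab : - abar <= abar <= abar by case/andP: abar01 => h1 h2; rewrite lexx andbT; lra.
have {}hb := hb abar ab.
by apply: le_trans h; apply: leeD; [exact: hb|exact: lexx].
Qed.

Lemma V_qnext_le0 M psi : (VV (qnext fb M psi) <= VV (qhalf M psi))%E.
Proof.
have -> : VV (qhalf M psi) = VV (Dst 0 (qhalf M psi)) by rewrite !VE Dst0_val.
have [_ hb] := fbP (qhalf M psi).
have ab : - abar <= 0 <= abar by case/andP: abar01 => h1 h2; rewrite h1 andbT; lra.
exact: (hb 0 ab).
Qed.

(** An outcome of probability 0 contributes nothing, so the decrease c is required only where the
    state after measurement is a genuine normalization. *)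
Lemma branch_le m psi (c : R) : bweight (sqw m) ->
  (0 < lsum (sqw m) psi ->
     (VV (qnext fb (Mdiag m) psi) + c%:E <= VV (qhalf (Mdiag m) psi))%E) ->
  ((qprob (Mdiag m) psi)%:E * V' (qnext fb (Mdiag m) psi) +
    (lsum (sqw m) psi * c)%:E <=
   wsum (fun n => sigma R nbar n * sqw m n)%R psi +
   (lsum (sqw m) psi * (delta * (kk + 1)) - delta * (lsum (sqw m) psi *
     purity (lsum (fun n => c2 n * sqw m n) psi / lsum (sqw m) psi)))%:E)%E.
Proof.
move=> m1 hc; rewrite qprob_Mdiag.
have w0 : (0 <= wsum (fun n => sigma R nbar n * sqw m n)%R psi)%E.
  by apply: wsum_ge0 => n; rewrite mulr_ge0 ?sigma_ge0//; case/andP: (m1 n).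
have [p0|] := ltP 0 (lsum (sqw m) psi); last first.
  move=> h; have -> : lsum (sqw m) psi = 0 by apply/eqP; rewrite eq_le h lsum_ge0.
  by rewrite mul0e !mul0r mulr0 subr0 !adde0.
have {}hc := hc p0.
have -> : ((lsum (sqw m) psi)%:E * V' (qnext fb (Mdiag m) psi) + (lsum (sqw m) psi * c)%:E =
  (lsum (sqw m) psi)%:E * (VV (qnext fb (Mdiag m) psi) + c%:E + delta%:E))%E.
  by rewrite -addeA (addeC c%:E) addeA -/(V' _) [RHS]muleDr// ?EFinM// fin_num_adde_defl.
apply: (@le_trans _ _ ((lsum (sqw m) psi)%:E * V' (qhalf (Mdiag m) psi))%E).
  by rewrite lee_pmul2l ?lte_fin// leeD2r.
rewrite V'E (lsum_qhalf m1 (@cos2w_bw R theta phi) p0).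
rewrite muleDr// ?fin_num_adde_defl//.
rewrite wsum_qhalf//; last exact: sigma_ge0.
by rewrite leeD2l// -EFinM lee_fin; set z := purity _; lra.
Qed.

Definition Tstep (g : state R -> \bar R) psi : \bar R :=
  ((qprob (Mg theta phi) psi)%:E * g (qnext fb (Mg theta phi) psi) +
   (qprob (Me theta phi) psi)%:E * g (qnext fb (Me theta phi) psi))%E.

Definition cos4w n : R := c2 n * c2 n.

Lemma cos4w_bw : bweight cos4w.
Proof. by apply: bweightM; exact: cos2w_bw. Qed.

Lemma cossin_lsum psi : lsum (fun n => c2 n * s2 n) psi = lsum c2 psi - lsum cos4w psi.
Proof.
apply/eqP; rewrite eq_sym subr_eq -lsumD; first last.
- exact: cos4w_bw.
- by apply: bweightM; [exact: cos2w_bw|exact: sin2w_bw].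
by apply/eqP; congr (lsum _ psi); apply/funext => n; rewrite sin2wE /cos4w; ring.
Qed.

Definition spread psi : R := lsum cos4w psi - lsum c2 psi ^+ 2.

(** Measuring preserves the mean of sigma because cos^2 + sin^2 = 1. What is lost comes from the
    Jensen gap of the purity and from the decreases due to the control, weighted by the outcome
    probabilities. *)
Lemma Tstep_le psi (cg ce : R) :
  (0 < lsum c2 psi -> (VV (qnext fb (Mg theta phi) psi) + cg%:E <= VV (qhalf (Mg theta phi) psi))%E) ->
  (0 < lsum s2 psi -> (VV (qnext fb (Me theta phi) psi) + ce%:E <= VV (qhalf (Me theta phi) psi))%E) ->
  (Tstep V' psi + (2 * delta * spread psi ^+ 2 + (lsum c2 psi * cg + lsum s2 psi * ce))%:E <= V' psi)%E.
Proof.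
move=> hg he.
have bg := @branch_le (fun n => cos (phin theta phi n)) psi cg (@cos2w_bw R theta phi) hg.
have be := @branch_le (fun n => sin (phin theta phi n)) psi ce (@sin2w_bw R theta phi) he.
have b := leeD bg be; move: b.
rewrite -[sqw (fun n => cos _)]/c2 -[sqw (fun n => sin _)]/s2.
rewrite -[Mdiag (fun n => cos _)]/(Mg theta phi) -[Mdiag (fun n => sin _)]/(Me theta phi).
rewrite addeACA -/(Tstep V' psi) -EFinD addeACA -EFinD -wsumD; first last.
- by move=> n; rewrite mulr_ge0 ?sigma_ge0//; case/andP: (@sin2w_bw R theta phi n).
- by move=> n; rewrite mulr_ge0 ?sigma_ge0//; case/andP: (@cos2w_bw R theta phi n).
have -> : (fun n => sigma R nbar n * c2 n + sigma R nbar n * s2 n) = sigma R nbar.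
  by apply/funext => n; rewrite sin2wE; ring.
rewrite -[lsum (fun n => c2 n * c2 n) psi]/(lsum cos4w psi) cossin_lsum lsum_sin2w.
set p := lsum c2 psi; set A := lsum cos4w psi => b.
have /andP[p0 p1] : 0 <= p <= 1 by rewrite lsum_ge0 ?lsum_le1//; exact: cos2w_bw.
have A0 : 0 <= A by rewrite lsum_ge0//; exact: cos4w_bw.
have Ap : A <= p.
  apply: le_lsum; [exact: cos4w_bw|exact: cos2w_bw|] => n.
  by have /andP[h1 h2] := @cos2w_bw R theta phi n; rewrite ler_piMl.
have pA : p - A <= 1 - p.
  rewrite -cossin_lsum -lsum_sin2w; apply: le_lsum; [|exact: sin2w_bw|].
    by apply: bweightM; [exact: cos2w_bw|exact: sin2w_bw].
  move=> n; have /andP[h1 h2] := @cos2w_bw R theta phi n.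
  by have /andP[h3 h4] := @sin2w_bw R theta phi n; rewrite ler_piMl.
have J := purity_jensen (introT andP (conj p0 p1)) (introT andP (conj A0 Ap)) pA.
have dJ := ler_wpM2l (ltW d0) J.
rewrite V'E -/p /spread -/p -/A [X in (_ + X <= _)%E]EFinD (addeC (_ * _)%:E) addeA.
apply: (@le_trans _ _ (wsum (sigma R nbar) psi +
  (p * (delta * (kk + 1)) - delta * (p * purity (A / p)) +
   ((1 - p) * (delta * (kk + 1)) - delta * ((1 - p) * purity ((p - A) / (1 - p)))))%:E
  + (2 * delta * (A - p ^+ 2) ^+ 2)%:E)%E); first by rewrite leeD2r.
rewrite -addeA leeD2l// -EFinD lee_fin.
by move: dJ; move: (purity _) (purity _) (purity _) => f1 f2 f3; lra.
Qed.

Lemma Tstep_spread psi : (Tstep V' psi + (2 * delta * spread psi ^+ 2)%:E <= V' psi)%E.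
Proof.
have h0 M : (VV (qnext fb M psi) + 0%:E <= VV (qhalf M psi))%E.
  by rewrite adde0; exact: V_qnext_le0.
have h := Tstep_le (fun=> h0 (Mg theta phi)) (fun=> h0 (Me theta phi)).
by rewrite [X in X%:E](_ : _ = 2 * delta * spread psi ^+ 2 + (lsum c2 psi * 0 + lsum s2 psi * 0)) //; ring.
Qed.

(** One of cos^2 and sin^2 is at least 1/2 at n, so the corresponding outcome has probability at
    least 1/4. Normalizing by it enlarges the mass off |n> at most four times, whence tau^2 / 4 in
    the hypothesis and c / 4 in the conclusion. *)
Lemma Tstep_gain n (tau c : R) psi : 0 < tau <= 2^-1 -> 0 <= c ->
  (forall chi : state R, 1 - tau ^+ 2 < sqmod (chi n) -> (VV (Dst abar chi) + c%:E <= VV chi)%E) ->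
  1 - tau ^+ 2 / 4 < sqmod (psi n) ->
  (Tstep V' psi + (c / 4)%:E <= V' psi)%E.
Proof.
move=> /andP[tau0 tau1] c0 hgain hn.
have tau2 : tau ^+ 2 <= 4^-1.
  by have := ler_pM (ltW tau0) (ltW tau0) tau1 tau1; rewrite expr2; lra.
have branch m : bweight (sqw m) -> 2^-1 <= sqw m n ->
   4^-1 <= lsum (sqw m) psi /\ (VV (qnext fb (Mdiag m) psi) + c%:E <= VV (qhalf (Mdiag m) psi))%E.
  move=> m1 mn.
  have lo : sqw m n * sqmod (psi n) <= lsum (sqw m) psi.
    rewrite -lee_fin lsumK//; apply: (rser_ge1 (f := fun n => sqw m n * sqmod (psi n))) => i.
    by rewrite mulr_ge0 ?sqmod_ge0//; case/andP: (m1 i).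
  have up := lsum_le_split n psi m1.
  have p4 : 4^-1 <= lsum (sqw m) psi.
    apply: le_trans lo; apply: (@le_trans _ _ (2^-1 * 2^-1)); first by lra.
    by apply: ler_pM; lra.
  have p0 : 0 < lsum (sqw m) psi by lra.
  split; first exact: p4.
  apply: V_qnext_le; apply: hgain.
  rewrite sqmod_qhalf// mulrC ltr_pdivlMr//.
  move: up p4 hn; move: (lsum _ _) (sqmod _) (sqw m n * _) => p r w up p4 hn.
  have : tau ^+ 2 / 4 <= tau ^+ 2 * p by rewrite ler_wpM2l ?sqr_ge0.
  lra.
have h0 M : (VV (qnext fb M psi) + 0%:E <= VV (qhalf M psi))%E.
  by rewrite adde0; exact: V_qnext_le0.
have /orP[h|h] : (2^-1 <= c2 n) || (2^-1 <= s2 n).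
  by rewrite sin2wE; case: leP => //= h; lra.
- have [p4 hb] := branch (fun n => cos (phin theta phi n)) (@cos2w_bw R theta phi) h.
  apply: le_trans (Tstep_le (fun=> hb) (fun=> h0 (Me theta phi))).
  apply: leeD; first exact: lexx.
  rewrite lee_fin mulr0 addr0.
  rewrite -[sqw _]/c2 in p4; have : 4^-1 * c <= lsum c2 psi * c by rewrite ler_wpM2r.
  have : 0 <= 2 * delta * spread psi ^+ 2 by rewrite mulr_ge0 ?sqr_ge0// mulr_ge0// ltW.
  lra.
- have [p4 hb] := branch (fun n => sin (phin theta phi n)) (@sin2w_bw R theta phi) h.
  apply: le_trans (Tstep_le (fun=> h0 (Mg theta phi)) (fun=> hb)).
  apply: leeD; first exact: lexx.
  rewrite lee_fin mulr0 add0r.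
  rewrite -[sqw _]/s2 in p4; have : 4^-1 * c <= lsum s2 psi * c by rewrite ler_wpM2r.
  have : 0 <= 2 * delta * spread psi ^+ 2 by rewrite mulr_ge0 ?sqr_ge0// mulr_ge0// ltW.
  lra.
Qed.

End OneStep.

(** * Integrals of nonnegative functions as suprema over simple functions *)

Section LowerIntegral.
Context (d : measure_display) (T : measurableType d) (R : realType).
Variable mu : {measure set T -> \bar R}.
Local Open Scope ereal_scope.
Import HBNNSimple.

Lemma lint_le (f g : T -> \bar R) : (forall x, 0 <= f x) -> (forall x, f x <= g x) ->
  \int[mu]_x f x <= \int[mu]_x g x.
Proof.
move=> f0 fg; have g0 x : 0 <= g x by exact: le_trans (fg x).
rewrite !ge0_integralTE//; apply: ge_ereal_sup => _ [h /= hf <-].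
by apply: ereal_sup_ubound; exists h => //= x; exact: le_trans (fg x).
Qed.

Lemma lint_ge0 (f : T -> \bar R) : (forall x, 0 <= f x) -> 0 <= \int[mu]_x f x.
Proof. by move=> f0; apply: integral_ge0. Qed.

(** Simple minorants of f and of g add up to one of f + g. The finiteness cases come from
    subtracting in the extended reals. *)
Lemma lint_superadd (f g : T -> \bar R) : (forall x, 0 <= f x) -> (forall x, 0 <= g x) ->
  \int[mu]_x f x + \int[mu]_x g x <= \int[mu]_x (f x + g x).
Proof.
move=> f0 g0; have fg0 x : 0 <= f x + g x by rewrite adde_ge0.
set c := \int[mu]_x (f x + g x).
have c0 : 0 <= c by exact: lint_ge0.
have key (h1 h2 : {nnsfun T >-> R}) : (forall x, (h1 x)%:E <= f x) -> (forall x, (h2 x)%:E <= g x) ->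
    sintegral mu h1 + sintegral mu h2 <= c.
  move=> h1f h2g; rewrite -sintegralD// /c ge0_integralTE//; apply: ereal_sup_ubound.
  by exists (add_nnsfun h1 h2) => //= x; rewrite EFinD leeD.
have [->|coo] := eqVneq c +oo; first by rewrite leey.
have cf : c \is a fin_num by rewrite ge0_fin_numE// lt_neqAle coo leey.
have sf (h1 : {nnsfun T >-> R}) : (forall x, (h1 x)%:E <= f x) -> sintegral mu h1 \is a fin_num.
  move=> h1f; rewrite ge0_fin_numE ?sintegral_ge0//.
  have := key h1 nnsfun0 h1f (fun x => g0 x); rewrite sintegral0 adde0 => /le_lt_trans; apply.
  by rewrite -ge0_fin_numE.
have gf : \int[mu]_x g x \is a fin_num.
  rewrite ge0_fin_numE ?lint_ge0//; apply: (@le_lt_trans _ _ c); last by rewrite -ge0_fin_numE.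
  by apply: lint_le => // x; rewrite leeDr.
rewrite -leeBrDr//.
rewrite {1}ge0_integralTE//; apply: ge_ereal_sup => _ [h1 /= h1f <-].
rewrite leeBrDr// -leeBrDl ?sf//.
rewrite {1}ge0_integralTE//; apply: ge_ereal_sup => _ [h2 /= h2g <-].
by rewrite leeBrDl ?sf// key.
Qed.

Lemma lint_scale (k : R) (f : T -> \bar R) : (0 <= k)%R -> (forall x, 0 <= f x) ->
  k%:E * \int[mu]_x f x <= \int[mu]_x (k%:E * f x).
Proof.
move=> k0 f0; have kf0 x : 0 <= k%:E * f x by rewrite mule_ge0// lee_fin.
have [->|kn0] := eqVneq k 0%R; first by rewrite mul0e lint_ge0// => x; rewrite mul0e.
have k0' : (0 < k)%R by rewrite lt_neqAle eq_sym kn0.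
rewrite -lee_pdivlMl// [X in X <= _]ge0_integralTE//; apply: ge_ereal_sup => _ [h /= hf <-].
rewrite lee_pdivlMl// -sintegralrM// ge0_integralTE//; apply: ereal_sup_ubound.
exists (scale_nnsfun h k0) => //= x; by rewrite EFinM lee_pmul2l ?lte_fin.
Qed.

End LowerIntegral.

Section StepIntegral.
Context (d : measure_display) (T : measurableType d) (R : realType).
Variables (nu nu' : {measure set T -> \bar R}) (p1 p2 : T -> R) (f1 f2 : T -> T).
Hypothesis p10 : forall x, 0 <= p1 x.
Hypothesis p20 : forall x, 0 <= p2 x.
Hypothesis step : forall A, measurable A -> nu' A = (\int[nu]_x
  ((p1 x)%:E * (\1_A (f1 x) : R)%:E + (p2 x)%:E * (\1_A (f2 x) : R)%:E))%E.
Local Open Scope ereal_scope.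
Import HBNNSimple.

(* No measurability of [f1], [f2] is known, so the right-hand side is a lower
   integral; superadditivity of lower integrals gives the needed direction. *)
Lemma step_integral_le (g : T -> \bar R) : (forall x, 0 <= g x) ->
  \int[nu']_x g x <= \int[nu]_x ((p1 x)%:E * g (f1 x) + (p2 x)%:E * g (f2 x)).
Proof.
move=> g0; rewrite [leLHS]ge0_integralTE//; apply: ge_ereal_sup => _ [h /= hg <-].
pose F A x : \bar R := (p1 x)%:E * (\1_A (f1 x) : R)%:E + (p2 x)%:E * (\1_A (f2 x) : R)%:E.
have F0 A x : 0 <= F A x by rewrite adde_ge0// mule_ge0// lee_fin.
(* Induction over a list of values, as superadditivity is available for two summands at a time. *)
have sumle (l : seq R) : (forall r, r \in l -> (0 <= r)%R) ->
    \sum_(r <- l) r%:E * nu' (h @^-1` [set r]) <=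
    \int[nu]_x (\sum_(r <- l) r%:E * F (h @^-1` [set r]) x).
  elim: l => [|r l IH] l0.
    rewrite big_nil; apply: integral_ge0 => x _; by rewrite big_nil.
  have r0 : (0 <= r)%R by apply: l0; rewrite mem_head.
  have {}l0 s : s \in l -> (0 <= s)%R by move=> sl; apply: l0; rewrite in_cons sl orbT.
  rewrite big_cons; under eq_integral do rewrite big_cons.
  apply: le_trans (lint_superadd _ _ _).
  - apply: leeD; last exact: IH.
    rewrite step; last exact: measurable_sfunP.
    exact: (@lint_scale _ _ _ nu r (F (h @^-1` [set r])) r0 (F0 _)).
  - by move=> x; rewrite mule_ge0// lee_fin.
  - move=> x; rewrite big_seq sume_ge0// => s /l0 s0; by rewrite mule_ge0// lee_fin.
rewrite sintegralE fsbig_finite//=.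
apply: (le_trans (sumle _ _)).
  by move=> r; rewrite in_fset_set// inE => -[x _ <-].
have E x : \sum_(r <- finmap.enum_fset (fset_set (range h))) r%:E * F (h @^-1` [set r]) x =
   (p1 x)%:E * (h (f1 x))%:E + (p2 x)%:E * (h (f2 x))%:E.
  have hE y : h y = (\sum_(r <- finmap.enum_fset (fset_set (range h))) r * \1_(h @^-1` [set r]) y)%R.
    by rewrite {1}(fimfunE h y) fsbig_finite.
  have Fr (r : R) A : r%:E * F A x = (r * (p1 x * \1_A (f1 x) + p2 x * \1_A (f2 x)))%:E.
    by rewrite EFinM EFinD !EFinM.
  under eq_bigr do rewrite Fr.
  rewrite sumEFin !hE -!EFinM -EFinD; congr EFin.
  by rewrite !mulr_sumr -big_split /=; apply: eq_bigr => r _; ring.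
under eq_integral do rewrite E.
apply: lint_le => x; first by rewrite adde_ge0// mule_ge0// lee_fin.
by apply: leeD; apply: lee_wpmul2l; rewrite ?lee_fin.
Qed.

End StepIntegral.

(** * Topology and measurability of the state space *)

Section StateTopology.
Variable R : realType.
Implicit Types (psi chi : state R) (f g : state R -> R).

Definition snbhs psi : set_system (state R) := filter_from [set r : R | 0 < r] (sball psi).

Lemma sball_mono psi (r r' : R) : 0 <= r -> r <= r' -> sball psi r `<=` sball psi r'.
Proof.
move=> r0 rr chi; rewrite /sball /= => /lt_le_trans; apply.
by rewrite lee_fin lerXn2r// nnegrE// (le_trans r0).
Qed.

Global Instance snbhs_filter psi : Filter (snbhs psi).
Proof.
apply: filter_from_filter; first by exists 1; rewrite /= ltr01.
move=> r r' /= r0 r'0; exists (Num.min r r'); first by rewrite /= lt_min r0.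
have m0 : 0 <= Num.min r r' by rewrite le_min !ltW.
by move=> chi h; split; apply: sball_mono h => //; rewrite ge_min lexx ?orbT.
Qed.

(** Continuity as a limit along a filter, to reuse the arithmetic of limits. *)
Lemma scontinuousP f : scontinuous f <-> forall psi, f @ snbhs psi --> f psi.
Proof.
split=> [h psi|h psi e e0].
  by apply/cvgrPdist_lt => e e0; have [r r0 hr] := h psi e e0; exists r.
have /cvgrPdist_lt/(_ e e0)[r r0 hr] := h psi.
by exists r.
Qed.

Lemma sqmod_Young (z w : R[i]) (tau : R) : 0 < tau ->
  sqmod z <= (1 + tau) * sqmod w + (1 + tau^-1) * sqmod (z - w).
Proof.
move=> tau0; case: z w => a b [c e]; rewrite complex_sub /sqmod /=.
have ki : tau * tau^-1 = 1 by rewrite mulfV// gt_eqF.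
have k0 (p q : R) : p ^+ 2 <= (1 + tau) * q ^+ 2 + (1 + tau^-1) * (p - q) ^+ 2.
  have := mulr_ge0 (ltW tau0) (sqr_ge0 (q - tau^-1 * (p - q))).
  rewrite [X in 0 <= X](_ : _ = tau * q ^+ 2 - 2 * (tau * tau^-1) * q * (p - q) + tau * tau^-1 * tau^-1 * (p - q) ^+ 2); last by ring.
  by rewrite ki; move: tau^-1 => k'; nra.
by have := k0 a c; have := k0 b e; lra.
Qed.

Lemma sball_partial psi chi (r : R) L : sball psi r chi -> \sum_(n < L) sqmod (psi n - chi n) <= r ^+ 2.
Proof.
move=> h; rewrite -lee_fin; apply: le_trans (ltW h).
by apply: (@rser_ge _ (fun n => sqmod (psi n - chi n))) => n; exact: sqmod_ge0.
Qed.

Lemma sqmodC (z w : R[i]) : sqmod (z - w) = sqmod (w - z).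
Proof. by case: z w => a b [c e]; rewrite !complex_sub /sqmod /=; ring. Qed.

Lemma sball_sym psi chi (r : R) : sball psi r chi -> sball chi r psi.
Proof.
rewrite /sball /= (_ : nrm2 (fun n => chi n - psi n) = nrm2 (fun n => psi n - chi n))//.
by apply: eq_eseriesr => n _; rewrite sqmodC.
Qed.

(** Young's inequality coordinate by coordinate; fixing [tau] before r yields continuity. *)
Lemma lsum_sball a psi chi (r tau : R) : bweight a -> 0 < tau -> sball psi r chi ->
  lsum a psi <= lsum a chi + tau + (1 + tau^-1) * r ^+ 2.
Proof.
move=> a1 tau0 h; have a0 n : 0 <= a n by case/andP: (a1 n).
have ti0 : 0 < tau^-1 by rewrite invr_gt0.
have c1 := lsum_le1 chi a1; have c0 := lsum_ge0 chi a1.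
apply: (@le_trans _ _ ((1 + tau) * lsum a chi + (1 + tau^-1) * r ^+ 2)); last by nra.
rewrite -lee_fin lsumK//; apply: rser_le => [n|L]; first by rewrite mulr_ge0 ?sqmod_ge0.
apply: (@le_trans _ _ ((1 + tau) * (\sum_(n < L) a n * sqmod (chi n)) +
  (1 + tau^-1) * (\sum_(n < L) sqmod (psi n - chi n)))).
  rewrite !mulr_sumr -big_split /=; apply: ler_sum => n _.
  apply: (@le_trans _ _ (a n * ((1 + tau) * sqmod (chi n) + (1 + tau^-1) * sqmod (psi n - chi n)))).
    by rewrite ler_wpM2l// sqmod_Young.
  rewrite mulrDr mulrCA lerD2l; apply: ler_piMl; last by case/andP: (a1 n).
  by rewrite mulr_ge0 ?sqmod_ge0// addr_ge0// ltW.
have t0 : 0 <= 1 + tau by rewrite addr_ge0// ltW.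
have t1 : 0 <= 1 + tau^-1 by rewrite addr_ge0// ltW.
apply: lerD; apply: ler_wpM2l => //; last exact: sball_partial.
rewrite -lee_fin lsumK//; apply: (@rser_ge _ (fun n => a n * sqmod (chi n))) => n.
by rewrite mulr_ge0 ?sqmod_ge0.
Qed.

Lemma scontinuous_lsum a : bweight a -> scontinuous (fun psi => lsum a psi).
Proof.
move=> a1 psi e e0; pose tau := e / 3.
have tau0 : 0 < tau by rewrite divr_gt0.
have ti0 : 0 < tau^-1 by rewrite invr_gt0.
have k0 : 0 < e / 3 / (1 + tau^-1) by rewrite divr_gt0// addr_gt0.
exists (Num.sqrt (e / 3 / (1 + tau^-1))); first by rewrite sqrtr_gt0.
move=> chi h.
have k1 : (1 + tau^-1) * Num.sqrt (e / 3 / (1 + tau^-1)) ^+ 2 = e / 3.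
  by rewrite sqr_sqrtr ?(ltW k0)// mulrC divfK// gt_eqF// addr_gt0.
have h1 := lsum_sball a1 tau0 h; have h2 := lsum_sball a1 tau0 (sball_sym h).
rewrite k1 in h1 h2; rewrite /tau in h1 h2; rewrite ltr_norml; lra.
Qed.

Lemma sball_coord psi chi (r : R) n : sball psi r chi -> sqmod (psi n - chi n) < r ^+ 2.
Proof.
move=> h; rewrite -lte_fin; apply: le_lt_trans h.
by apply: (@rser_ge1 _ (fun n => sqmod (psi n - chi n))) => i; exact: sqmod_ge0.
Qed.

Lemma scontinuous_re n : scontinuous (fun psi => complex.Re (psi n)).
Proof.
move=> psi e e0; exists e => // chi /sball_coord -/(_ n).
case: (psi n) (chi n) => a b [c d]; rewrite complex_sub /sqmod /= => h.
rewrite -ltr_sqr ?nnegrE ?(ltW e0)// real_normK ?num_real//.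
by have := sqr_ge0 (b - d); lra.
Qed.

Lemma scontinuous_im n : scontinuous (fun psi => complex.Im (psi n)).
Proof.
move=> psi e e0; exists e => // chi /sball_coord -/(_ n).
case: (psi n) (chi n) => a b [c d]; rewrite complex_sub /sqmod /= => h.
rewrite -ltr_sqr ?nnegrE ?(ltW e0)// real_normK ?num_real//.
by have := sqr_ge0 (a - c); lra.
Qed.

Lemma sopen_measurable (U : set (state R)) : sopen U -> measurable (U : set (Bstate R)).
Proof. by move=> oU; apply: sub_sigma_algebra. Qed.

Lemma scontinuous_measurable f : scontinuous f -> measurable_fun [set: Bstate R] (f : Bstate R -> R).
Proof.
move=> cf mD; apply: (measurability _ (RGenOInfty.measurableE R)) => //.
move=> /= _ [_ [x ->] <-]; apply: measurableI => //; apply: sopen_measurable.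
move=> psi; rewrite /preimage /= in_itv /= andbT => xf.
have e0 : 0 < f psi - x by rewrite subr_gt0.
have [r r0 hr] := cf psi _ e0; exists r => // chi /hr.
by rewrite /= in_itv /= andbT ltr_norml => /andP[_]; lra.
Qed.

Lemma measurable_sqmod n : measurable_fun [set: Bstate R] (fun psi : Bstate R => sqmod ((psi : state R) n)).
Proof.
by apply: measurable_funD; apply: measurable_funX; apply: scontinuous_measurable;
  [exact: scontinuous_re|exact: scontinuous_im].
Qed.

Lemma measurable_wsum (a : nat -> R) : (forall n, 0 <= a n) ->
  measurable_fun [set: Bstate R] (fun psi : Bstate R => wsum a (psi : state R)).
Proof.
move=> a0; apply: (@ge0_emeasurable_sum _ _ _ setT (fun n (psi : Bstate R) => (a n * sqmod ((psi : state R) n))%:E) xpredT).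
- by move=> n psi _ _; rewrite lee_fin mulr_ge0 ?sqmod_ge0.
- move=> n _; apply/measurable_EFinP; apply: measurable_funM; first exact: measurable_cst.
  exact: measurable_sqmod.
Qed.

Lemma measurable_sball psi (r : R) : measurable (sball psi r : set (Bstate R)).
Proof.
have m : measurable_fun [set: Bstate R] (fun chi : Bstate R => nrm2 (fun n => psi n - (chi : state R) n)).
  apply: (@ge0_emeasurable_sum _ _ _ setT (fun n (chi : Bstate R) => (sqmod (psi n - (chi : state R) n))%:E) xpredT).
  - by move=> n chi _ _; rewrite lee_fin sqmod_ge0.
  - move=> n _; apply/measurable_EFinP.
    rewrite (_ : (fun _ => _) = (fun chi : Bstate R => (complex.Re (psi n) - complex.Re ((chi : state R) n)) ^+ 2 +
      (complex.Im (psi n) - complex.Im ((chi : state R) n)) ^+ 2)); last first.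
      by apply/funext => chi; case: (psi n) ((chi : state R) n) => a b [c d].
    apply: measurable_funD; apply: measurable_funX; apply: measurable_funB; try exact: measurable_cst.
      by apply: scontinuous_measurable; exact: scontinuous_re.
    by apply: scontinuous_measurable; exact: scontinuous_im.
have := measurable_lte measurableT m (measurable_cst (r ^+ 2)%:E).
by rewrite setTI.
Qed.

End StateTopology.

(** * Asymptotics of the laws *)

Section Supermartingale.
Variable R : realType.
Variables (nbar : nat) (theta phi delta abar : R) (fb : state R -> R).
Hypothesis d0 : 0 < delta.
Hypothesis abar01 : 0 <= abar <= 4^-1.
Hypothesis fbP : feedback nbar theta phi delta abar fb.
Variables (mu : probability (Bstate R) R) (nu : nat -> probability (Bstate R) R) (C : R).
Hypothesis muC : (Eexp mu (V nbar theta phi delta) <= C%:E)%E.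
Hypothesis nuP : law_seq theta phi fb mu nu.

Local Notation Vp := (V' nbar theta phi delta).
Local Notation Ts := (Tstep theta phi fb Vp).

Lemma measurable_purity : measurable_fun [set: Bstate R]
  (fun psi : Bstate R => purity (lsum (cos2w theta phi) (psi : state R))).
Proof.
have m : measurable_fun [set: Bstate R] (fun psi : Bstate R => lsum (cos2w theta phi) (psi : state R)).
  by apply: scontinuous_measurable; apply: scontinuous_lsum; exact: cos2w_bw.
apply: measurable_funD; apply: measurable_funX => //.
by apply: measurable_funB => //; exact: measurable_cst.
Qed.

Lemma measurable_V : measurable_fun [set: Bstate R] (V nbar theta phi delta : Bstate R -> \bar R).
Proof.
rewrite (_ : (V _ _ _ _ : Bstate R -> \bar R) = (fun psi : Bstate R => wsum (sigma R nbar) (psi : state R)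
   + (delta * (cos (phin theta phi nbar) ^+ 4 + sin (phin theta phi nbar) ^+ 4)
     - delta * purity (lsum (cos2w theta phi) (psi : state R)))%:E)%E); last first.
  by apply/funext => psi; rewrite VE.
apply: emeasurable_funD; first by apply: measurable_wsum; exact: sigma_ge0.
apply/measurable_EFinP; apply: measurable_funB; first exact: measurable_cst.
by apply: measurable_funM; [exact: measurable_cst|exact: measurable_purity].
Qed.

Lemma measurable_V' : measurable_fun [set: Bstate R] (Vp : Bstate R -> \bar R).
Proof. by apply: emeasurable_funD; [exact: measurable_V|exact: measurable_cst]. Qed.

Lemma Vp_ge0 psi : (0 <= Vp psi)%E.
Proof. exact: V'_ge0. Qed.

(** V may be negative, so its integral is a difference. The negative part is at most [delta], hence
    of finite integral, and can be moved across the inequality. *)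
Lemma integral_V'_mu : (\int[mu]_x Vp x <= (C + delta)%:E)%E.
Proof.
have mV := measurable_V.
pose W : Bstate R -> \bar R := V nbar theta phi delta.
have Wlo x : (- delta%:E <= W x)%E.
  by have := Vp_ge0 x; rewrite /V' -leeBlDr// sub0e.
have negle x : (W^\- x <= delta%:E)%E.
  rewrite funenegE ge_max lee_fin (ltW d0) andbT.
  by rewrite leeNl.
have E x : (Vp x + W^\- x = W^\+ x + delta%:E)%E.
  have fn : (W^\- x \is a fin_num)%E.
    by rewrite ge0_fin_numE ?(le_lt_trans (negle x)) ?ltry.
  have -> : Vp x = (W^\+ x - W^\- x + delta%:E)%E.
    by rewrite /V' -[V _ _ _ _ x]/(W x) {1}(funeposneg W).
  by rewrite addeAC subeK.
have I1 : (\int[mu]_x Vp x + \int[mu]_x W^\- x = \int[mu]_x W^\+ x + delta%:E)%E.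
  rewrite -ge0_integralD//=.
  - under eq_integral do rewrite E.
    rewrite ge0_integralD//=.
    + by rewrite integral_cst//= probability_setT mule1.
    + exact: measurable_funepos.
    + by move=> x _; rewrite lee_fin ltW.
  - by move=> x _; exact: Vp_ge0.
  - exact: measurable_V'.
  - exact: measurable_funeneg.
have I2 : (\int[mu]_x W^\- x \is a fin_num)%E.
  rewrite ge0_fin_numE; last by apply: integral_ge0.
  apply: (@le_lt_trans _ _ (\int[mu]_x (cst delta%:E x))%E).
    by apply: lint_le.
  by rewrite integral_cst//= probability_setT mule1 ltry.
have : (\int[mu]_x W^\+ x - \int[mu]_x W^\- x <= C%:E)%E.
  by rewrite -integralE; exact: muC.
rewrite -(leeD2rE _ _ (isT : delta%:E \is a fin_num)) -EFinD; apply: le_trans.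
by rewrite addeAC -I1 addeK.
Qed.

Lemma nu_step k : (\int[nu k.+1]_x Vp x <= \int[nu k]_x Ts x)%E.
Proof.
have [_ step] := nuP.
apply: (@step_integral_le _ (Bstate R) R (nu k) (nu k.+1) (qprob (Mg theta phi)) (qprob (Me theta phi))
  (qnext fb (Mg theta phi)) (qnext fb (Me theta phi))).
- by move=> x; rewrite /qprob nrm2_Mg -/(lsum _ _) lsum_ge0//; exact: cos2w_bw.
- by move=> x; rewrite /qprob nrm2_Me -/(lsum _ _) lsum_ge0//; exact: sin2w_bw.
- by move=> A mA; exact: step.
- by move=> x; exact: Vp_ge0.
Qed.

Lemma Ts_ge0 x : (0 <= Ts x)%E.
Proof.
rewrite /Tstep adde_ge0// mule_ge0 ?Vp_ge0// lee_fin.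
- by rewrite /qprob nrm2_Mg -/(lsum _ _) lsum_ge0//; exact: cos2w_bw.
- by rewrite /qprob nrm2_Me -/(lsum _ _) lsum_ge0//; exact: sin2w_bw.
Qed.

Lemma nu_descent (K : state R -> \bar R) k : (forall x, 0 <= K x)%E ->
  (forall x, Ts x + K x <= Vp x)%E ->
  (\int[nu k.+1]_x Vp x + \int[nu k]_x K x <= \int[nu k]_x Vp x)%E.
Proof.
move=> K0 TK.
apply: (@le_trans _ _ (\int[nu k]_x Ts x + \int[nu k]_x K x)%E).
  by apply: leeD; [exact: nu_step|exact: lexx].
apply: (@le_trans _ _ (\int[nu k]_x (Ts x + K x))%E).
  exact: (@lint_superadd _ (Bstate R) R (nu k) Ts K Ts_ge0 K0).
by apply: lint_le => [x|]; [rewrite adde_ge0 ?Ts_ge0|exact: TK].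
Qed.

Lemma integral_V'_nu k : (\int[nu k]_x Vp x <= (C + delta)%:E)%E.
Proof.
elim: k => [|k IH].
  have [h0 _] := nuP; rewrite (eq_measure_integral mu) => [|A mA _]; last exact: h0.
  exact: integral_V'_mu.
apply: le_trans IH; have := @nu_descent (cst 0%E) k.
rewrite integral_cst// mul0e adde0; apply => // x; rewrite adde0.
have := Tstep_spread d0 abar01 fbP x; apply: le_trans; rewrite leeDl// lee_fin.
by rewrite mulr_ge0 ?sqr_ge0// mulr_ge0// ltW.
Qed.

Lemma integral_W_nu k : (\int[nu k]_x wsum (sigma R nbar) (x : state R) <= (C + delta)%:E)%E.
Proof.
apply: le_trans (integral_V'_nu k); apply: lint_le => x.
  by apply: wsum_ge0; exact: sigma_ge0.
rewrite V'E leeDl// lee_fin -mulrBr mulr_ge0 ?(ltW d0)//.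
have : 0 <= lsum (cos2w theta phi) (x : state R) <= 1 by rewrite lsum_ge0 ?lsum_le1//; exact: cos2w_bw.
by move/purity01 => /andP[_]; have := kk_ge0 nbar theta phi; lra.
Qed.

(** The integrals of [V'] decrease and are nonnegative, so their successive differences, which
    dominate the integrals of K, tend to 0. *)
Lemma nu_vanish (K : state R -> \bar R) : (forall x, 0 <= K x)%E ->
  (forall x, Ts x + K x <= Vp x)%E ->
  (fun k => (\int[nu k]_x K x)%E) @ \oo --> 0%E.
Proof.
move=> K0 TK; pose i k := fine (\int[nu k]_x Vp x)%E.
have fi k : (\int[nu k]_x Vp x \is a fin_num)%E.
  rewrite ge0_fin_numE ?(le_lt_trans (integral_V'_nu k)) ?ltry//.
  by apply: integral_ge0 => x _; exact: Vp_ge0.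
have i0 k : 0 <= i k by rewrite /i fine_ge0// integral_ge0// => x _; exact: Vp_ge0.
have J k : (\int[nu k]_x K x <= (i k - i k.+1)%:E)%E.
  rewrite EFinB /i (fineK (fi k)) (fineK (fi k.+1)) leeBrDl; last exact: fi.
  exact: nu_descent k K0 TK.
have J0 k : (0 <= \int[nu k]_x K x)%E by apply: integral_ge0.
have ni : nonincreasing_seq i.
  apply/nonincreasing_seqP => k; rewrite -subr_ge0 -lee_fin.
  exact: le_trans (J0 k) (J k).
have ci : cvgn i by apply: nonincreasing_is_cvgn => //; exists 0 => _ [k _ <-].
have cd : (fun k => i k - i k.+1) @ \oo --> (0 : R).
  rewrite -(subrr (limn i)); apply: cvgB => //.
  by rewrite (_ : (fun k => i k.+1) = (fun k => i (k + 1)%N)) ?cvg_shiftn//; apply/funext => k; rewrite addn1.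
apply: (@squeeze_cvge _ _ _ _ (fun=> 0%E) _ (EFin \o (fun k => i k - i k.+1))).
- by apply: nearW => k; rewrite J0 J.
- exact: cvg_cst.
- by apply: cvg_EFin => //; apply: nearW.
Qed.

End Supermartingale.

(** * States of small spread are close to Fock states *)

Section Concentration.
Variable R : realType.
Variables (theta phi : R).
Hypothesis hA1 : A1 theta phi.
Implicit Types (psi : state R).

Local Notation c2 := (cos2w theta phi).
Local Notation spr := (spread theta phi).

(* If both cosine and sine change sign between [m] and [n] then the rotation by
   [phi_n - phi_m] is [-1], and applying it once more contradicts injectivity. *)
Lemma cos2w_inj : injective c2.
Proof.
have [ci si] := hA1.
have key n m : (m < n)%N -> cos (phin theta phi n) = - cos (phin theta phi m) ->
    sin (phin theta phi n) = - sin (phin theta phi m) -> False.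
  move=> mn hc hs.
  have e : phin theta phi (n + (n - m)) = phin theta phi n + (phin theta phi n - phin theta phi m).
    by rewrite /phin natrD natrB ?(ltnW mn)//; ring.
  have cx : cos (phin theta phi n - phin theta phi m) = -1.
    by rewrite cosB hc hs -(cos2Dsin2 (phin theta phi m)); ring.
  have sx : sin (phin theta phi n - phin theta phi m) = 0 by rewrite sinB hc hs; ring.
  have : cos (phin theta phi (n + (n - m))) = cos (phin theta phi m).
    by rewrite e cosD cx sx hc; ring.
  by move/ci => h; lia.
move=> n m h.
have hs : sin (phin theta phi n) ^+ 2 = sin (phin theta phi m) ^+ 2.
  by have := sin2wE theta phi n; have := sin2wE theta phi m; rewrite /sin2w h => -> ->.
move/eqP: h; rewrite /cos2w eqf_sqr => /orP[/eqP/ci //|/eqP hc].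
move/eqP: hs; rewrite eqf_sqr => /orP[/eqP/si //|/eqP hs].
have [mn|nm|//] := ltngtP m n; first by case: (key n m).
by case: (key m n) => //; rewrite ?hc ?hs opprK.
Qed.

Lemma unif_pos (P : nat -> R -> Prop) N :
  (forall n g g', 0 < g' -> g' <= g -> P n g -> P n g') ->
  (forall n, (n < N)%N -> exists2 g, 0 < g & P n g) ->
  exists2 g, 0 < g & forall n, (n < N)%N -> P n g.
Proof.
move=> mono; elim: N => [|N IH] h; first by exists 1.
have [g g0 hg] := IH (fun n nN => h n (ltnW nN)).
have [g' g'0 hg'] := h N (ltnSn N).
have m0 : 0 < Num.min g g' by rewrite lt_min g0.
exists (Num.min g g') => // n; rewrite ltnS leq_eqVlt => /orP[/eqP ->|nN].
  by apply: mono hg' => //; rewrite ge_min lexx orbT.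
by apply: mono (hg n nN) => //; rewrite ge_min lexx.
Qed.

(** The factor 2 leaves at most one of the values strictly within g of any given number. *)
Lemma cos2w_gap N : exists2 g : R, 0 < g & forall n m, (n < N)%N -> (m < N)%N -> n != m ->
  2 * g <= `|c2 n - c2 m|.
Proof.
pose P n g := forall m, (m < N)%N -> n != m -> 2 * g <= `|c2 n - c2 m|.
have [n g g' g'0 gg h m mN nm|n nN|g g0 h] := @unif_pos P N.
- by apply: le_trans (h m mN nm); rewrite ler_wpM2l.
- pose Q m g := n != m -> 2 * g <= `|c2 n - c2 m|.
  have [m g g' g'0 gg h nm|m mN|g g0 h] := @unif_pos Q N.
  + by apply: le_trans (h nm); rewrite ler_wpM2l.
  + have [<-|nm] := eqVneq n m; first by exists 1 => // /eqP.
    exists (`|c2 n - c2 m| / 2); last by move=> _; rewrite mulrC divfK.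
    rewrite divr_gt0// normr_gt0 subr_eq0; apply: contra nm => /eqP h.
    by apply/eqP; apply: cos2w_inj.
  + by exists g => // m mN nm; apply: h.
- by exists g => // n m nN mN; apply: h.
Qed.

Definition headw N n : R := (n < N)%:R.

Lemma headw_bw N : bweight (headw N).
Proof. by move=> n; rewrite /headw; case: (n < N)%N; rewrite ?lexx ?ler01. Qed.

Lemma lsum_head N psi : lsum (headw N) psi = \sum_(n < N) sqmod (psi n).
Proof.
have h0 n : 0 <= headw N n * sqmod (psi n).
  by rewrite mulr_ge0 ?sqmod_ge0//; case/andP: (headw_bw N n).
apply: EFin_inj; rewrite lsumK; last exact: headw_bw.
apply/eqP; rewrite eq_le; apply/andP; split.
  apply: rser_le => // L; rewrite /headw.
  have [LN|NL] := leqP L N.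
    apply: (@le_trans _ _ (\sum_(n < L) sqmod (psi n))).
      by apply: ler_sum => i _; rewrite (leq_trans (ltn_ord i) LN) mul1r.
    rewrite -!(big_mkord xpredT (fun n => sqmod (psi n))) (big_cat_nat (leq0n L) LN) /= lerDl.
    by apply: sumr_ge0 => i _; exact: sqmod_ge0.
  rewrite -(big_mkord xpredT (fun n => (n < N)%:R * sqmod (psi n))) (big_cat_nat (leq0n N) (ltnW NL)) /=.
  rewrite [X in _ + X]big1_seq => [|i]; last first.
    by rewrite mem_index_iota => /andP[_ /andP[Ni _]]; rewrite ltnNge Ni mul0r.
  by rewrite addr0 big_mkord; apply: ler_sum => i _; rewrite ltn_ord mul1r.
apply: le_trans (rser_ge N h0); rewrite lee_fin; apply: ler_sum => i _.
by rewrite /headw ltn_ord mul1r.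
Qed.

Lemma spread_variance psi :
  wsum (fun n => (c2 n - lsum c2 psi) ^+ 2) psi = (spr psi)%:E.
Proof.
set p := lsum c2 psi.
have p0 : 0 <= p by rewrite lsum_ge0//; exact: cos2w_bw.
have b0 n : 0 <= c2 n by exact: sqr_ge0.
(* The square is expanded with its negative term moved to the left, since [wsum] is additive on
   nonnegative weights. *)
have E : (wsum (fun n => (c2 n - p) ^+ 2)%R psi + (2 * p)%:E * wsum c2 psi =
   wsum (cos4w theta phi) psi + (p ^+ 2)%:E * wsum (fun=> 1)%R psi)%E.
  rewrite -wsumZ ?mulr_ge0// -wsumD; first last.
  - by move=> n; rewrite mulr_ge0// mulr_ge0.
  - by move=> n; exact: sqr_ge0.
  rewrite -wsumZ ?sqr_ge0// -wsumD; first last.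
  - by move=> n; rewrite mulr1 sqr_ge0.
  - by move=> n; rewrite mulr_ge0.
  by congr (wsum _ psi); apply/funext => n; rewrite /cos4w; ring.
rewrite wsum1 mule1 -(lsumK psi (@cos2w_bw R theta phi)) -/p -EFinM in E.
rewrite -(lsumK psi (@cos4w_bw R theta phi)) -EFinD in E.
have fn : wsum (fun n => (c2 n - p) ^+ 2) psi \is a fin_num.
  apply: contra_eqT E => h; rewrite ge0_fin_numE in h; last by apply: wsum_ge0 => n; exact: sqr_ge0.
  by rewrite -leNgt leye_eq in h; rewrite (eqP h) addye.
rewrite -(fineK fn) -EFinD in E; case: E => E.
by rewrite -(fineK fn); congr EFin; rewrite /spread -/p; lra.
Qed.

Lemma spread_ge0 psi : 0 <= spr psi.
Proof. by rewrite -lee_fin -spread_variance wsum_ge0// => n; exact: sqr_ge0. Qed.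

Lemma spread_le1 psi : spr psi <= 1.
Proof.
rewrite /spread; have := lsum_le1 psi (@cos4w_bw R theta phi); have := sqr_ge0 (lsum c2 psi); lra.
Qed.

(** Chebyshev's inequality: indices whose cos^2 is at least g away from the mean carry mass below
    eta / 2, the tail beyond N carries less than eta / 2, and a single index remains. *)
Lemma spread_concentrate N (eta : R) : 0 < eta < 1 -> exists2 v : R, 0 < v &
  forall psi, spr psi < v -> 1 - lsum (headw N) psi < eta / 2 ->
  exists2 n, (n < N)%N & 1 - eta < sqmod (psi n).
Proof.
move=> /andP[e0 e1]; have [g g0 hg] := cos2w_gap N.
have g20 : 0 < g ^+ 2 by rewrite exprn_gt0.
exists (g ^+ 2 * (eta / 2)); first by rewrite mulr_gt0// divr_gt0.
move=> psi hv ht; set p := lsum c2 psi.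
have far (a : nat -> R) : bweight a -> (forall n, a n != 0 -> g <= `|c2 n - p|) -> lsum a psi < eta / 2.
  move=> a1 ha; rewrite -(ltr_pM2l g20); apply: le_lt_trans hv.
  have a0 n : 0 <= a n by case/andP: (a1 n).
  rewrite -lee_fin EFinM lsumK// -wsumZ ?(ltW g20)// -spread_variance; apply: le_wsum => n.
    by rewrite mulr_ge0// ltW.
  have [->|an] := eqVneq (a n) 0; first by rewrite mulr0 sqr_ge0.
  apply: (@le_trans _ _ (g ^+ 2)); first by apply: ler_piMr; [exact: ltW|case/andP: (a1 n)].
  by rewrite -[leRHS]real_normK ?num_real// lerXn2r ?nnegrE ?(ltW g0)// ha.
have [[n nN hn]|none] := pselect (exists2 n, (n < N)%N & `|c2 n - p| < g); last first.
  have : lsum (headw N) psi < eta / 2.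
    apply: far => [|n]; first exact: headw_bw.
    rewrite /headw; case: ltnP => [nN _|_]; last by rewrite eqxx.
    by rewrite leNgt; apply/negP => h; apply: none; exists n.
  move=> h; have : 1 < eta by lra.
  by rewrite ltNge (ltW e1).
exists n => //.
pose a i : R := if i == n then 0 else headw N i.
have ab : bweight a by move=> i; rewrite /a; case: eqP => _; [rewrite lexx ler01|exact: headw_bw].
have : lsum a psi < eta / 2.
  apply: far => // i; rewrite /a /headw; case: (eqVneq i n) => [_|ni]; first by rewrite eqxx.
  case: ltnP => [iN _|_]; last by rewrite eqxx.
  have := hg i n iN nN ni.
  have := ler_distD p (c2 i) (c2 n); rewrite (distrC p (c2 n)); lra.
have db : bweight (fun i : nat => if i == n then 1 else 0 : R).
  by move=> i; case: eqP => _; rewrite lexx ler01.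
have -> : lsum a psi = lsum (headw N) psi - sqmod (psi n).
  have <- : lsum (fun i => if i == n then 1 else 0) psi = sqmod (psi n).
    by rewrite lsum_delta ?mul1r// lexx ler01.
  apply/eqP; rewrite eq_sym subr_eq -lsumD//; apply/eqP; congr (lsum _ psi).
  by apply/funext => i; rewrite /a; case: eqP => [->|_]; rewrite /headw ?nN ?add0r ?addr0.
lra.
Qed.

Lemma head_near psi (e : R) : 0 < e -> exists N, 1 - lsum (headw N) psi < e.
Proof.
move=> e0; have c : (fun L => \sum_(n < L) sqmod (psi n)) @ \oo --> (1 : R).
  by apply: (@rser_cvg _ (fun n => sqmod (psi n)) 1 _ (sunit psi)) => n; exact: sqmod_ge0.
have /cvgrPdist_lt/(_ _ e0)[N _ h] := c.
exists N; rewrite lsum_head; have := h N (leqnn N); apply: le_lt_trans; exact: ler_norm.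
Qed.

Lemma sqmod_le1 psi n : sqmod (psi n) <= 1.
Proof.
rewrite -lee_fin -(sunit psi); apply: (@rser_ge1 _ (fun n => sqmod (psi n))) => i; exact: sqmod_ge0.
Qed.

Lemma sqmod_add_le1 psi n m : n != m -> sqmod (psi n) + sqmod (psi m) <= 1.
Proof.
move=> nm; have := @lsum_le_split _ (fun i => if i == m then 1 else 0) n psi.
rewrite lsum_delta ?lexx ?ler01// (negbTE nm) mul1r mul0r add0r => h.
have {}h : sqmod (psi m) <= 1 - sqmod (psi n).
  by apply: h => i; case: eqP => _; rewrite lexx ler01.
lra.
Qed.

Lemma sqmod1_fock psi n : sqmod (psi n) = 1 -> is_fock_ph n psi.
Proof.
move=> h; exists (psi n); split => // m; rewrite /fock; case: eqVneq => [->|mn]; first by rewrite mulr1.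
have : sqmod (psi m) = 0.
  by apply/eqP; rewrite eq_le sqmod_ge0 andbT; have := sqmod_add_le1 psi mn; lra.
rewrite mulr0; case: (psi m) => a b; rewrite /sqmod /= => /eqP.
by rewrite paddr_eq0 ?sqr_ge0// !sqrf_eq0 => /andP[/eqP -> /eqP ->].
Qed.

Lemma fock_sqmod1 psi n : is_fock_ph n psi -> sqmod (psi n) = 1.
Proof. by move=> [c [c1 ->]]; rewrite /fock eqxx mulr1. Qed.

Lemma spread0_fock psi : spr psi = 0 -> exists n, sqmod (psi n) = 1.
Proof.
move=> s0.
have conc (eta : R) : 0 < eta < 1 -> exists n, 1 - eta < sqmod (psi n).
  move=> e01; have [e0 e1] := andP e01.
  have [N hN] := head_near psi (divr_gt0 e0 (ltr0n R 2)).
  have [v v0 hv] := spread_concentrate N e01.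
  by have [|n nN hn] := hv psi _ hN; [rewrite s0|exists n].
have h2 : 0 < (2^-1 : R) < 1 by lra.
have [n hn] := conc _ h2; exists n; apply/eqP; rewrite eq_le sqmod_le1 /=.
apply/ler_addgt0Pr => e e0.
(* Below 1/4, two different coordinates would have total mass above 1, so every precision selects
   the same n. *)
pose e' := Num.min e 4^-1.
have e'0 : 0 < e' by rewrite lt_min e0 /=; lra.
have e'4 : e' <= 4^-1 by rewrite ge_min lexx orbT.
have e'e : e' <= e by rewrite ge_min lexx.
have [|m hm] := conc e'; first by rewrite e'0 /=; lra.
have [mn|mn] := eqVneq m n; first by rewrite mn in hm; lra.
have := sqmod_add_le1 psi mn; lra.
Qed.

End Concentration.

(** * Continuous test functions *)

Section ContinuityCombinators.
Variable R : realType.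
Implicit Types (f g : state R -> R).

Lemma scontinuous_cst (k : R) : scontinuous (fun _ : state R => k).
Proof. by move=> psi e e0; exists 1 => // chi _; rewrite subrr normr0. Qed.

Lemma scontinuousB f g : scontinuous f -> scontinuous g -> scontinuous (fun x => f x - g x).
Proof. by move=> /scontinuousP cf /scontinuousP cg; apply/scontinuousP => psi; apply: cvgB. Qed.

Lemma scontinuousD f g : scontinuous f -> scontinuous g -> scontinuous (fun x => f x + g x).
Proof. by move=> /scontinuousP cf /scontinuousP cg; apply/scontinuousP => psi; apply: cvgD. Qed.

Lemma scontinuousM f g : scontinuous f -> scontinuous g -> scontinuous (fun x => f x * g x).
Proof. by move=> /scontinuousP cf /scontinuousP cg; apply/scontinuousP => psi; apply: cvgM. Qed.

Lemma scontinuous_norm f : scontinuous f -> scontinuous (fun x => `|f x|).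
Proof. by move=> /scontinuousP cf; apply/scontinuousP => psi; apply: cvg_norm. Qed.

Lemma scontinuous_sqmod n : scontinuous (fun psi : state R => sqmod (psi n)).
Proof.
have cr := @scontinuous_re R n; have ci := @scontinuous_im R n.
by rewrite /sqmod; apply: scontinuousD; rewrite /= ; under eq_fun do rewrite expr2; apply: scontinuousM.
Qed.

Lemma scontinuous_spread theta phi : scontinuous (fun psi => spread theta phi psi : R).
Proof.
have c2 := scontinuous_lsum (@cos2w_bw R theta phi).
have c4 := scontinuous_lsum (@cos4w_bw R theta phi).
rewrite /spread; apply: scontinuousB => //; under eq_fun do rewrite expr2; exact: scontinuousM.
Qed.

(** Twice the positive part of r - (1 - eta): a continuous substitute for the indicator of a
    neighbourhood of a Fock state, usable in weak limits. *)
Definition excess (eta r : R) : R := `|r - (1 - eta)| + (r - (1 - eta)).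

Lemma excess_ge0 eta r : 0 <= excess eta r.
Proof. by rewrite /excess; have := ler_norm (- (r - (1 - eta))); rewrite normrN; lra. Qed.

Lemma excess_eq0 eta r : r <= 1 - eta -> excess eta r = 0.
Proof. by move=> h; rewrite /excess ler0_norm; lra. Qed.

Lemma excess_le2 eta r : 0 < eta < 1 -> 0 <= r <= 1 -> excess eta r <= 2.
Proof.
move=> /andP[e0 e1] /andP[r0 r1]; rewrite /excess.
have [h|h] := leP r (1 - eta); first by rewrite ler0_norm; lra.
by rewrite gtr0_norm; lra.
Qed.

Lemma scontinuous_excess eta n : scontinuous (fun psi : state R => excess eta (sqmod (psi n))).
Proof.
have c := scontinuousB (@scontinuous_sqmod n) (scontinuous_cst (1 - eta)).
by apply: scontinuousD => //; exact: scontinuous_norm.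
Qed.

Lemma homo_lt_cvg (f : nat -> nat) : {homo f : m n / (m < n)%N >-> (m < n)%N} -> f @ \oo --> \oo.
Proof.
move=> hf; have le k : (k <= f k)%N.
  by elim: k => // k IH; apply: leq_ltn_trans IH (hf _ _ (ltnSn k)).
by move=> A [N _ h]; exists N => // k /= Nk; apply: h; apply: leq_trans (le k).
Qed.

End ContinuityCombinators.

Lemma tail_le_wsum (R : realType) (nbar N : nat) (psi : state R) : (nbar <= N)%N ->
  ((sigma R nbar N * (1 - lsum (headw R N) psi))%:E <= wsum (sigma R nbar) psi)%E.
Proof.
move=> nN; have hb := @headw_bw R N; have s0 := @sigma_ge0 R nbar.
rewrite -lsum_compl// EFinM lsumK; last by move=> n; case/andP: (hb n); lra.
rewrite -wsumZ//; last by move=> n; case/andP: (hb n); lra.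
apply: le_wsum => n; first by rewrite mulr_ge0//; case/andP: (hb n); lra.
rewrite /headw; case: ltnP => h; first by rewrite subrr mulr0.
by rewrite subr0 mulr1 sigma_mono.
Qed.

(** * Properties of the weak limits *)

Section WeakLimits.
Variable R : realType.
Variables (nbar n0 : nat) (theta phi eta eps B : R).
Hypothesis hA1 : A1 theta phi.
Hypothesis eta01 : 0 < eta < 1.
Hypothesis nbar_n0 : (nbar <= n0)%N.
Variable nu : nat -> probability (Bstate R) R.
Hypothesis nu_spread : (fun k => (\int[nu k]_x (spread theta phi (x : state R) ^+ 2)%:E)%E) @ \oo --> 0%E.
Hypothesis nu_excess : forall n, (n <= n0)%N -> n != nbar ->
  (fun k => (\int[nu k]_x (excess eta (sqmod ((x : state R) n)))%:E)%E) @ \oo --> 0%E.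
Hypothesis nu_W : forall k, (\int[nu k]_x wsum (sigma R nbar) (x : state R) <= B%:E)%E.
Hypothesis B_eps : B <= eps * sigma R nbar n0.+1.

Variables (f : nat -> nat) (mu : probability (Bstate R) R).
Hypothesis fhomo : {homo f : m n / (m < n)%N >-> (m < n)%N}.
Hypothesis fmu : wconv (nu \o f) mu.

Local Notation spr := (spread theta phi).

Lemma wlim_eq0 (g : state R -> R) : sbounded g -> scontinuous g ->
  (fun k => (\int[nu k]_x (g x)%:E)%E) @ \oo --> 0%E -> (\int[mu]_x (g x)%:E = 0)%E.
Proof.
move=> bg cg h; apply: (cvg_unique (@ereal_hausdorff R) (F := (fun k => Eexp ((nu \o f) k) (fun x => (g x)%:E)) @ \oo)).
  exact: fmu.
exact: (cvg_comp _ _ (homo_lt_cvg fhomo) h).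
Qed.

Lemma mu_spread0 : (\int[mu]_x (spr (x : state R) ^+ 2)%:E = 0)%E.
Proof.
apply: (wlim_eq0 (g := fun x => spr x ^+ 2)) => //.
- exists 1 => psi; rewrite ger0_norm ?sqr_ge0// expr_le1 ?spread_ge0// ?spread_le1//.
- by under eq_fun do rewrite expr2; apply: scontinuousM; exact: scontinuous_spread.
Qed.

Lemma mspr : measurable_fun [set: Bstate R] (fun x : Bstate R => spr (x : state R)).
Proof. by apply: scontinuous_measurable; exact: scontinuous_spread. Qed.

Lemma mu_support_fock psi : msupport mu psi -> exists n, is_fock_ph n psi.
Proof.
move=> sp; suff /(spread0_fock hA1)[n hn] : spr psi = 0 by exists n; exact: sqmod1_fock.
apply/eqP; rewrite eq_le spread_ge0 andbT leNgt; apply/negP => s0.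
have s20 : 0 < spr psi / 2 by rewrite divr_gt0.
have [r r0 hr] := scontinuous_spread theta phi psi s20.
have := sp r r0; rewrite lt_neqAle => /andP[/eqP h _]; apply: h; apply/esym/eqP.
rewrite eq_le measure_ge0 andbT.
have mb := measurable_sball psi r.
rewrite -(setIT (sball psi r : set (Bstate R))) -integral_indic//.
have k0 : 0 < (spr psi / 2) ^+ 2 by rewrite exprn_gt0.
rewrite -(pmule_rle0 _ (_ : (0 < ((spr psi / 2) ^+ 2)%:E)%E)) ?lte_fin//.
apply: (@le_trans _ _ (\int[mu]_x (((spr psi / 2) ^+ 2)%:E * (\1_(sball psi r : set (Bstate R)) x)%:E))%E).
  by apply: lint_scale => [|x]; [exact: ltW|rewrite lee_fin].
- rewrite -mu_spread0; apply: lint_le => x.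
    by rewrite -EFinM lee_fin mulr_ge0 ?(ltW k0).
  rewrite -EFinM lee_fin indicE.
  have [/set_mem hx|hx] := boolP (x \in (sball psi r : set (Bstate R))); last by rewrite mulr0 sqr_ge0.
  rewrite mulr1 lerXn2r ?nnegrE ?spread_ge0 ?(ltW s20)//.
  by have := hr x hx; rewrite ltr_norml; lra.
Qed.

(** The mean squared spread is 0 under the limit law, so almost every state is Fock and only the
    values there count. *)
Lemma ae_fock (g h : state R -> R) : scontinuous g -> measurable_fun [set: Bstate R] (h : Bstate R -> R) ->
  (forall x, 0 <= g x) -> (forall x, 0 <= h x) ->
  (forall x : state R, spr x = 0 -> g x = h x) ->
  (\int[mu]_x (g x)%:E = \int[mu]_x (h x)%:E)%E.
Proof.
move=> cg mh g0 h0 gh; apply: ge0_ae_eq_integral => //.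
- by apply/measurable_EFinP; exact: scontinuous_measurable.
- by apply/measurable_EFinP.
- by move=> x _; rewrite lee_fin.
- by move=> x _; rewrite lee_fin.
have ms : measurable_fun [set: Bstate R] (fun x : Bstate R => (spr (x : state R) ^+ 2)%:E).
  by apply/measurable_EFinP; apply: measurable_funX; exact: mspr.
have ae0 : ae_eq mu setT (fun x : Bstate R => (spr (x : state R) ^+ 2)%:E) (cst 0%E).
  apply/ae_eq_integral_abs => //.
  under eq_integral do rewrite gee0_abs ?lee_fin ?sqr_ge0//.
  exact: mu_spread0.
apply: filterS ae0 => x /= hx _; congr EFin; apply: gh.
by have /eqP := hx I; rewrite eqe sqrf_eq0 => /eqP.
Qed.

Lemma mu_bad n : (n <= n0)%N -> n != nbar -> (\int[mu]_x (sqmod ((x : state R) n))%:E = 0)%E.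
Proof.
move=> nn0 nn; have [e0 e1] := andP eta01.
have b0 : (\int[mu]_x (excess eta (sqmod ((x : state R) n)))%:E = 0)%E.
  apply: (wlim_eq0 (g := fun x => excess eta (sqmod (x n)))).
  - exists 2 => psi; rewrite ger0_norm ?excess_ge0// excess_le2// sqmod_ge0 sqmod_le1 //.
  - exact: scontinuous_excess.
  - exact: nu_excess.
have mexcess : measurable_fun [set: Bstate R] (fun x : Bstate R => (2 * eta)^-1 * excess eta (sqmod ((x : state R) n))).
  apply: measurable_funM; first exact: measurable_cst.
  by apply: scontinuous_measurable; exact: scontinuous_excess.
(* On a Fock state [sqmod] is 0 or 1, where [excess] is 0 or 2 eta. *)
rewrite (@ae_fock (fun x => sqmod (x n)) (fun x => (2 * eta)^-1 * excess eta (sqmod (x n)))) //.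
- under eq_integral do rewrite EFinM.
  rewrite ge0_integralZl//=.
  + by rewrite b0 mule0.
  + by apply/measurable_EFinP; apply: scontinuous_measurable; exact: scontinuous_excess.
  + by move=> x _; rewrite lee_fin excess_ge0.
  + by rewrite lee_fin invr_ge0 mulr_ge0// ltW.
- exact: scontinuous_sqmod.
- by move=> x; exact: sqmod_ge0.
- by move=> x; rewrite mulr_ge0 ?excess_ge0// invr_ge0 mulr_ge0// ltW.
- move=> x /(spread0_fock hA1)[m hm]; have [nm|nm] := eqVneq n m.
    rewrite nm hm /excess (_ : 1 - (1 - eta) = eta); last by ring.
    rewrite gtr0_norm// (_ : eta + eta = 2 * eta); last by ring.
    by rewrite mulVf// gt_eqF// mulr_gt0.
  have -> : sqmod (x n) = 0.
    by apply/eqP; rewrite eq_le sqmod_ge0 andbT; have := sqmod_add_le1 x nm; lra.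
  by rewrite excess_eq0 ?mulr0//; lra.
Qed.

(** Markov's inequality is applied along the sequence: the tail mass, unlike W, is bounded and
    continuous, so its bound passes to the weak limit. *)
Lemma mu_tail : (\int[mu]_x (1 - lsum (headw R n0.+1) (x : state R))%:E <= eps%:E)%E.
Proof.
have s0 : 0 < sigma R nbar n0.+1.
  by rewrite sigmaS ltr_wpDl ?sigma_ge0// sigma_incr_gt0.
have hb := @headw_bw R n0.+1.
have tail0 (x : state R) : 0 <= 1 - lsum (headw R n0.+1) x by rewrite subr_ge0 lsum_le1.
have bnd k : (\int[nu k]_x (1 - lsum (headw R n0.+1) (x : state R))%:E <= eps%:E)%E.
  rewrite -(@lee_pmul2l _ (sigma R nbar n0.+1)%:E) ?lte_fin//.
  apply: (@le_trans _ _ (\int[nu k]_x ((sigma R nbar n0.+1)%:E * (1 - lsum (headw R n0.+1) (x : state R))%:E))%E).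
    by apply: lint_scale => [|x]; [exact: ltW|rewrite lee_fin].
  apply: (@le_trans _ _ B%:E); last by rewrite -EFinM lee_fin mulrC.
  apply: le_trans (nu_W k); apply: lint_le => x.
    by rewrite -EFinM lee_fin mulr_ge0// ltW.
  by rewrite -EFinM; apply: tail_le_wsum; rewrite leqW.
have cv : (fun k => Eexp ((nu \o f) k) (fun x => (1 - lsum (headw R n0.+1) x)%:E)) @ \oo -->
   Eexp mu (fun x => (1 - lsum (headw R n0.+1) x)%:E).
  apply: fmu.
  - by exists 1 => x; rewrite ger0_norm// lerBlDr lerDl lsum_ge0.
  - by apply: scontinuousB; [exact: scontinuous_cst|exact: scontinuous_lsum].
rewrite -[leLHS]/(Eexp mu _) -(cvg_lim (@ereal_hausdorff R) cv); apply: lime_le.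
  by apply/cvg_ex; eexists; exact: cv.
by apply: nearW => k; exact: bnd.
Qed.

Lemma measurable_fock : measurable ([set psi | is_fock_ph nbar psi] : set (Bstate R)).
Proof.
rewrite (_ : [set psi | _] = [set: Bstate R] `&` (fun x : Bstate R => sqmod ((x : state R) nbar)) @^-1` [set 1%R]).
  by apply: measurable_sqmod; [exact: measurableT|exact: measurable_set1].
by rewrite setTI; apply/seteqP; split => x /=; [exact: fock_sqmod1|exact: sqmod1_fock].
Qed.

(** The occupations sum to 1. Those of n <= n0 other than nbar have mean 0, the tail has mean at
    most eps, and the occupation of nbar is almost everywhere the indicator of the target. *)
Lemma mu_target : ((1 - eps)%:E <= mu [set psi : Bstate R | is_fock_ph nbar psi])%E.
Proof.
have mF := measurable_fock.
have mq n : measurable_fun [set: Bstate R] (fun x : Bstate R => (sqmod ((x : state R) n))%:E).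
  by apply/measurable_EFinP; exact: measurable_sqmod.
have hb := @headw_bw R n0.+1.
have tail0 (x : state R) : 0 <= 1 - lsum (headw R n0.+1) x by rewrite subr_ge0 lsum_le1.
have -> : (mu [set psi | is_fock_ph nbar psi] = \int[mu]_x (sqmod ((x : state R) nbar))%:E)%E.
  rewrite (@ae_fock (fun x => sqmod (x nbar)) (fun x => \1_([set psi | is_fock_ph nbar psi] : set (Bstate R)) x)) //.
  - by rewrite integral_indic// setIT.
  - exact: scontinuous_sqmod.
  - exact: measurable_indic.
  - by move=> x; exact: sqmod_ge0.
  - move=> x /(spread0_fock hA1)[m hm]; rewrite indicE.
    have [/set_mem /= hx|/negP] := boolP (x \in ([set psi | is_fock_ph nbar psi] : set (Bstate R))).
      by rewrite fock_sqmod1.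
    rewrite inE /= => hx.
    apply/eqP; rewrite eq_le sqmod_ge0 andbT.
    have [nm|nm] := eqVneq nbar m; first by case: hx; apply: sqmod1_fock; rewrite nm.
    by have := sqmod_add_le1 x nm; lra.
have one : (\int[mu]_x (\sum_(n < n0.+1) (sqmod ((x : state R) n))%:E + (1 - lsum (headw R n0.+1) (x : state R))%:E) = 1)%E.
  under eq_integral do rewrite sumEFin -EFinD lsum_head addrC subrK.
  by rewrite integral_cst//= probability_setT mule1.
have mt : measurable_fun [set: Bstate R] (fun x : Bstate R => (1 - lsum (headw R n0.+1) (x : state R))%:E).
  apply/measurable_EFinP; apply: scontinuous_measurable.
  by apply: scontinuousB; [exact: scontinuous_cst|exact: scontinuous_lsum].
move: one; rewrite ge0_integralD//=.
- rewrite ge0_integral_sum//=; last by move=> n x _; rewrite lee_fin sqmod_ge0.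
  have nb : (nbar < n0.+1)%N by rewrite ltnS.
  rewrite (bigD1 (Ordinal nb))//= big1 ?adde0 => [one|i ni]; last first.
    by apply: mu_bad; [rewrite -ltnS|].
  rewrite EFinB leeBlDr// -one; apply: leeD; [exact: lexx|exact: mu_tail].
- by move=> x _; apply: sume_ge0 => n _; rewrite lee_fin sqmod_ge0.
- by apply: emeasurable_sum => n.
- by move=> x _; rewrite lee_fin.
Qed.

End WeakLimits.

(** * Quantile functions and coding of nearly Fock states *)

Section DiagonalExtraction.
Variable R : realType.

(** Tychonoff's theorem supplies a cluster point. The subsequence is built by matching, at step j,
    the coordinates up to j within 1/(j+1), each index exceeding the previous one. *)
Lemma diag_extract (F : nat -> nat -> R) : (forall k i, 0 <= F k i <= 1) ->
  exists (g : nat -> nat) (F0 : nat -> R), {homo g : m n / (m < n)%N >-> (m < n)%N} /\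
  forall i, (fun k => F (g k) i) @ \oo --> F0 i.
Proof.
move=> F01.
have cpt : compact ([set f | forall i, `[0 : R, 1]%classic (f i)] : set (prod_topology (fun _ : nat => R))).
  by apply: (@tychonoff nat (fun=> R) (fun=> `[0 : R, 1]%classic)) => i; exact: segment_compact.
have [|F0 [_ clF0]] := cpt (F @ \oo) _.
  by exists 0%N => // k _ i /=; rewrite in_itv /= F01.
have pick j K : exists k, (K < k)%N /\ forall i, (i <= j)%N -> `|F k i - F0 i| < j.+1%:R^-1.
  have A : (F @ \oo) [set f | exists2 k, (K < k)%N & f = F k].
    by exists K.+1 => // k /= Kk; exists k.
  have FF : Filter (nbhs F0) := nbhs_filter F0.
  have B m : nbhs F0 [set f | forall i, (i < m)%N -> `|f i - F0 i| < j.+1%:R^-1].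
    elim: m => [|m IH]; first by apply: filterS filterT.
    have c : nbhs F0 [set f | `|f m - F0 m| < j.+1%:R^-1].
      have /cvgrPdist_lt/(_ j.+1%:R^-1) := @proj_continuous nat (fun=> R) m F0.
      rewrite invr_gt0 ltr0n => /(_ isT).
      by apply: filterS => f /=; rewrite distrC.
    apply: filterS2 IH c => f hf hm i; rewrite ltnS leq_eqVlt => /orP[/eqP ->//|]; exact: hf.
  have [f [/= [k Kk ->] h]] := clF0 _ _ A (B j.+1).
  by exists k; split => // i ij; apply: h; rewrite ltnS.
have [p hp] := choice (fun x : nat * nat => pick x.1 x.2).
pose g := fix g j := if j is j'.+1 then p (j, g j') else p (0%N, 0%N).
have gS j : (g j < g j.+1)%N by have [] := hp (j.+1, g j).
have gP j i : (i <= j)%N -> `|F (g j) i - F0 i| < j.+1%:R^-1.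
  by case: j => [|j]; [have [_] := hp (0%N, 0%N)|have [_] := hp (j.+1, g j)]; apply.
exists g, F0; split; first exact: homo_ltn ltn_trans gS.
move=> i; apply/cvgrPdist_lt => e e0.
near=> j; rewrite distrC; apply: lt_trans (gP j i _) _; first by near: j; exists i.
by near: j; apply: near_infty_natSinv_lt (PosNum e0).
Unshelve. all: by end_near. Qed.

End DiagonalExtraction.

(** * Quantiles from values at rationals *)

Section Quantile.
Variable R : realType.
Implicit Types (F : rat -> R) (u c : R).

Definition quant F u : R := sup ((@ratr R) @` [set q | F q < u]).

(** Properties that survive a pointwise limit at rationals; right continuity would not. One point
    with value at most 0 is enough on the left because all codes exceed -4. *)
Record cdf_like F : Prop := CdfLike {
  cdfl_mono : {homo F : p q / p <= q};
  cdfl_low : exists q, F q <= 0;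
  cdfl_high : forall u, u < 1 -> exists q, u < F q }.

Variables (F : rat -> R) (u : R).
Hypothesis hF : cdf_like F.
Hypothesis u01 : 0 < u < 1.

Lemma quant_ub q : u <= F q -> quant F u <= ratr q.
Proof.
move=> uq; apply: ge_sup; last first.
  move=> _ [p /= pu <-]; rewrite ler_rat leNgt; apply/negP => qp.
  by have := cdfl_mono hF (ltW qp); move: uq pu; lra.
by have [q0 h0] := cdfl_low hF; exists (ratr q0), q0 => //=; case/andP: u01; lra.
Qed.

Lemma quant_has_sup : has_sup ((@ratr R) @` [set q | F q < u]).
Proof.
have [u0 u1] := andP u01; split.
  by have [q0 h0] := cdfl_low hF; exists (ratr q0), q0 => //=; lra.
have [q hq] := cdfl_high hF u1; exists (ratr q) => _ [p /= pu <-].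
rewrite ler_rat leNgt; apply/negP => qp.
by have := cdfl_mono hF (ltW qp); move: hq pu; lra.
Qed.

Lemma quant_lb q : F q < u -> ratr q <= quant F u.
Proof.
move=> qu; apply: (sup_upper_bound quant_has_sup); by exists q.
Qed.

Lemma quant_gtP c : c < quant F u <-> exists2 q, c < ratr q & F q < u.
Proof.
split=> [|[q cq qu]]; last exact: lt_le_trans (quant_lb qu).
move/(sup_gt (proj1 quant_has_sup)) => [_ [q /= qu <-] cq].
by exists q.
Qed.

End Quantile.

Section QuantileConvergence.
Variable R : realType.
Variables (Fk : nat -> rat -> R) (F0 : rat -> R) (u : R).
Hypothesis hFk : forall k, cdf_like (Fk k).
Hypothesis hF0 : cdf_like F0.
Hypothesis cF : forall q, (fun k => Fk k q) @ \oo --> F0 q.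
Hypothesis u01 : 0 < u < 1.
Hypothesis uF0 : forall q, F0 q != u.

(** A level u that [F0] never takes excludes a flat piece, so there are strict inequalities at
    rationals on both sides of the quantile, and these hold for large k. *)
Lemma quant_cvg : (fun k => quant (Fk k) u) @ \oo --> quant F0 u.
Proof.
set X := quant F0 u; apply/cvgrPdist_lt => e e0.
have Xe : X - e < X by lra.
have /(quant_gtP hF0 u01)[q1 Xq1 q1u] := Xe.
have [q2 /itvP hq2] : exists q : rat, ratr q \in `]X, (X + e)[%R by apply: rat_in_itvoo; lra.
have uq2 : u < F0 q2.
  rewrite lt_neqAle eq_sym uF0 /= leNgt; apply/negP => /(quant_lb hF0 u01).
  by rewrite leNgt hq2.
have n1 : \forall k \near \oo, Fk k q1 < u by apply: (cvgr_lt _ (@cF q1)).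
have n2 : \forall k \near \oo, u < Fk k q2 by apply: (cvgr_gt _ (@cF q2)).
near=> k.
have h1 : ratr q1 <= quant (Fk k) u by apply: (quant_lb (hFk k) u01); near: k.
have h2 : quant (Fk k) u <= ratr q2 by apply: (quant_ub (hFk k) u01); apply: ltW; near: k.
have : ratr q2 < X + e by rewrite hq2.
by rewrite ltr_norml; lra.
Unshelve. all: by end_near. Qed.

End QuantileConvergence.

(** * Real codes for phases of Fock states *)

Section CircleCoding.
Variable R : realType.
Implicit Types (psi : state R).

Definition cvec n (s : R) : cseq R := fun m => if m == n then Complex (cos s) (sin s) else 0.

Lemma sqmod0 : sqmod (0 : R[i]) = 0.
Proof. by rewrite /sqmod /= expr0n addr0. Qed.

Lemma cvec_unit n s : unit_vec (cvec n s).
Proof.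
have f0 i : 0 <= sqmod (cvec n s i) by exact: sqmod_ge0.
have fn : sqmod (cvec n s n) = 1 by rewrite /cvec eqxx /sqmod /= cos2Dsin2.
apply/eqP; rewrite eq_le; apply/andP; split; last first.
  by apply: le_trans (rser_ge1 n f0); rewrite fn.
apply: rser_le => // L; have [nL|Ln] := ltnP n L.
  rewrite (bigD1 (Ordinal nL))//= fn big1 ?addr0// => i /negbTE ni.
  by rewrite /cvec (_ : (i == n :> nat) = false) ?sqmod0// -ni.
rewrite big1 ?ler01// => i _.
by rewrite /cvec ltn_eqF ?sqmod0// (leq_trans _ Ln).
Qed.

Definition circ n s : state R := State (cvec_unit n s).

(** On the unit circle, the argument in [-pi, pi]. Its jump at -1 is harmless: the argument needs a
    measurable code and a decoding close to the original state, not a continuous code. *)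
Definition chart (z : R[i]) : R :=
  if 0 <= complex.Im z then acos (complex.Re z) else - acos (complex.Re z).

Lemma re_le1 psi n : -1 <= complex.Re (psi n) <= 1.
Proof.
rewrite -ler_norml -(@expr_le1 _ 2)// real_normK ?num_real//.
apply: le_trans (sqmod_le1 psi n); rewrite /sqmod lerDl sqr_ge0 //.
Qed.

Lemma chart_pi psi n : - pi <= chart (psi n) <= pi.
Proof.
have r1 := re_le1 psi n; have := acos_ge0 r1; have := acos_lepi r1; have := pi_ge2 R.
by rewrite /chart; case: ifP => _; lra.
Qed.

Lemma pi_lt4 : pi < 4 :> R.
Proof. by have := @pihalf_lt2 R; lra. Qed.

(* Both imaginary parts have the same sign and [|Im (psi n)| <= |sin (chart (psi n))|],
   so the squared difference is at most the difference of the squares. *)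
Lemma circ_chart_near psi n (r : R) : 0 < r -> 2 * (1 - sqmod (psi n)) < r ^+ 2 ->
  sball (circ n (chart (psi n))) r psi.
Proof.
move=> r0 hr; rewrite /sball /=.
have r1 := re_le1 psi n; have q1 := sqmod_le1 psi n.
apply: le_lt_trans (_ : (_ <= (2 * (1 - sqmod (psi n)))%:E)%E) _; last by rewrite lte_fin.
have f0 m : 0 <= sqmod (cvec n (chart (psi n)) m - psi m) by exact: sqmod_ge0.
have key : sqmod (cvec n (chart (psi n)) n - psi n) <= 1 - sqmod (psi n).
  rewrite /cvec eqxx /chart; move: r1 q1; case: (psi n) => a b; rewrite /sqmod /= => r1 q1.
  have a1 : a \in `[(-1), 1]%R by rewrite in_itv.
  have [b0|b0] := leP 0 b.
    rewrite acosK// sin_acos// subrr expr0n add0r; set y := Num.sqrt _.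
    have y0 : 0 <= y by exact: sqrtr_ge0.
    have y2 : y ^+ 2 = 1 - a ^+ 2 by rewrite sqr_sqrtr//; have := sqr_ge0 b; lra.
    have yb : b <= y by rewrite -ler_sqr ?nnegrE//; lra.
    nra.
  rewrite cosN sinN acosK// sin_acos// subrr expr0n add0r; set y := Num.sqrt _.
  have y0 : 0 <= y by exact: sqrtr_ge0.
  have y2 : y ^+ 2 = 1 - a ^+ 2 by rewrite sqr_sqrtr//; have := sqr_ge0 b; lra.
  have yb : - b <= y by rewrite -ler_sqr ?nnegrE ?oppr_ge0 ?(ltW b0)// sqrrN; lra.
  nra.
apply: rser_le => // L.
apply: (@le_trans _ _ (\sum_(m < maxn L n.+1) sqmod (cvec n (chart (psi n)) m - psi m))).
  rewrite -!(big_mkord xpredT (fun m => sqmod (cvec n (chart (psi n)) m - psi m))).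
  rewrite (big_cat_nat (leq0n L) (leq_maxl L n.+1)) /= lerDl; apply: sumr_ge0 => i _; exact: f0.
have nL : (n < maxn L n.+1)%N by exact: leq_maxr.
rewrite (bigD1 (Ordinal nL))//= mulr2n mulrDl mul1r lerD//.
have := lsum_le1 psi (@headw_bw R (maxn L n.+1)).
rewrite lsum_head (bigD1 (Ordinal nL))//= -lerBrDl; apply: le_trans; apply: ler_sum => i /negbTE ni.
rewrite /cvec (_ : (i == n :> nat) = false); last by rewrite -ni.
by rewrite sqmodC subr0.
Qed.

(** At most one coordinate has squared modulus above 1/2. Since pi < 4, the spacing 8 leaves gaps
    around the points 8n + 4. The default 0 concerns states that carry little mass
    asymptotically. *)
Definition hcode psi : R :=
  match pselect (exists n, 2^-1 < sqmod (psi n)) with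
  | left h => 8 * (projT1 (cid h))%:R + chart (psi (projT1 (cid h)))
  | right _ => 0
  end.

Lemma half_uniq psi n m : 2^-1 < sqmod (psi n) -> 2^-1 < sqmod (psi m) -> n = m.
Proof.
move=> hn hm; apply/eqP; apply/negPn/negP => nm.
have := sqmod_add_le1 psi nm; lra.
Qed.

Lemma hcodeE psi n : 2^-1 < sqmod (psi n) -> hcode psi = 8 * n%:R + chart (psi n).
Proof.
move=> hn; rewrite /hcode; case: pselect => [h|[]]; last by exists n.
by case: (cid h) => m hm /=; rewrite (half_uniq hm hn).
Qed.

Lemma hcode0 psi : (forall n, sqmod (psi n) <= 2^-1) -> hcode psi = 0.
Proof. by move=> h; rewrite /hcode; case: pselect => // e; exfalso; case: e => n; rewrite ltNge h. Qed.

Lemma hcode_range psi : exists n, 8 * n%:R - pi <= hcode psi <= 8 * n%:R + pi.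
Proof.
have p2 := pi_ge2 R.
have [[n hn]|h] := pselect (exists n, 2^-1 < sqmod (psi n)).
  exists n; rewrite (hcodeE hn); have := chart_pi psi n; lra.
exists 0%N; rewrite hcode0; first by lra.
by move=> n; rewrite leNgt; apply/negP => hn; apply: h; exists n.
Qed.

(** Rounds t / 8 to the nearest integer; truncation sends everything negative to 0. *)
Definition idx (t : R) : nat := Num.truncn ((t + 4) / 8).

Lemma idxE t n : t < 8 * n%:R + 4 -> (n == 0%N) || (8 * n%:R - 4 <= t) -> idx t = n.
Proof.
move=> h1; have [n0 _|n0] /= := eqVneq n 0%N.
  have [t0|t0] := ltP ((t + 4) / 8) 0.
    by rewrite /idx truncn_floor leNgt t0 n0.
  apply: truncn_def; rewrite n0 t0 /=; move: h1; rewrite n0; lra.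
move=> h2; apply: truncn_def; rewrite -natr1; apply/andP; split.
  by rewrite ler_pdivlMr//; lra.
by rewrite ltr_pdivrMr//; lra.
Qed.

Definition Gst (t : R) : state R := circ (idx t) (t - 8 * (idx t)%:R).

Lemma Gst_hcode psi n : 2^-1 < sqmod (psi n) -> Gst (hcode psi) = circ n (chart (psi n)).
Proof.
move=> hn; have := chart_pi psi n; have p4 := pi_lt4 => hc.
have e : idx (hcode psi) = n.
  by apply: idxE; rewrite (hcodeE hn); [lra|apply/orP; right; lra].
by rewrite /Gst e (hcodeE hn) addrAC subrr add0r.
Qed.

Lemma circ_sball n (s s' r : R) : (cos s - cos s') ^+ 2 + (sin s - sin s') ^+ 2 < r ^+ 2 ->
  sball (circ n s) r (circ n s').
Proof.
move=> h; rewrite /sball /=.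
apply: le_lt_trans (_ : (_ <= ((cos s - cos s') ^+ 2 + (sin s - sin s') ^+ 2)%:E)%E) _; last by rewrite lte_fin.
have z0 : 0 <= (cos s - cos s') ^+ 2 + (sin s - sin s') ^+ 2 by rewrite addr_ge0 ?sqr_ge0.
apply: rser_le => [m|L]; first exact: sqmod_ge0.
have zi i : i != n -> sqmod (cvec n s i - cvec n s' i) = 0.
  by move=> /negbTE ni; rewrite /cvec ni subrr sqmod0.
have [nL|Ln] := ltnP n L.
  rewrite (bigD1 (Ordinal nL))//= big1 ?addr0 => [|i ni]; first by rewrite /cvec eqxx complex_sub.
  by apply: zi; apply: contra ni => /eqP h'; apply/eqP/val_inj.
by rewrite big1// => i _; apply: zi; rewrite ltn_eqF// (leq_trans _ Ln).
Qed.

Lemma circ_cvg n (s r : R) : 0 < r -> \forall s' \near s, sball (circ n s) r (circ n s').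
Proof.
move=> r0; have e0 : 0 < r / 2 by rewrite divr_gt0.
have /cvgrPdist_lt/(_ _ e0) hc := @continuous_cos R s.
have /cvgrPdist_lt/(_ _ e0) hs := @continuous_sin R s.
near=> s'; apply: circ_sball.
have c1 : `|cos s - cos s'| < r / 2 by near: s'.
have s1 : `|sin s - sin s'| < r / 2 by near: s'.
have sq (z : R) : `|z| < r / 2 -> z ^+ 2 < (r / 2) ^+ 2.
  by move=> hz; rewrite -real_normK ?num_real// ltrXn2r// ?nnegrE ?ltW.
have := sq _ c1; have := sq _ s1; have : 0 < r ^+ 2 by rewrite exprn_gt0.
rewrite [(r / 2) ^+ 2](_ : _ = r ^+ 2 / 4); last by field.
lra.
Unshelve. all: by end_near. Qed.

(** [idx] jumps only at the points 8n + 4 and is locally constant elsewhere; the range of index 0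
    has no left end. *)
Lemma Gst_near (t r : R) : (forall n, t != 8 * n%:R + 4) -> 0 < r ->
  \forall t' \near t, sball (Gst t) r (Gst t').
Proof.
move=> tn r0; set n := idx t.
have lt1 : t < 8 * n%:R + 4.
  rewrite /n /idx; have [t0|t0] := ltP ((t + 4) / 8) 0.
    by rewrite truncn_floor leNgt t0 /= mulr0; lra.
  by have /andP[_] := truncn_itv t0; rewrite -natr1 ltr_pdivrMr//; lra.
have lt2 : (n == 0%N) || (8 * n%:R - 4 < t).
  have [//|n0] /= := eqVneq n 0%N; rewrite lt_neqAle; apply/andP; split.
    have := tn n.-1; apply: contra => /eqP <-; apply/eqP.
    by rewrite -{1}(prednK (_ : 0 < n)%N) ?lt0n// -natr1; ring.
  have t0 : 0 <= (t + 4) / 8.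
    by rewrite leNgt; apply/negP => t0; move: n0; rewrite /n /idx truncn_floor leNgt t0.
  by have /andP[+ _] := truncn_itv t0; rewrite -/(idx t) -/n ler_pdivlMr//; lra.
have near_idx : \forall t' \near t, idx t' = n.
  case/orP: lt2 => [/eqP n0|lt2].
    near=> t'; apply: idxE; last by rewrite n0.
    by near: t'; apply: lt_nbhsl.
  near=> t'; apply: idxE; first by near: t'; apply: lt_nbhsl.
  by apply/orP; right; near: t'; apply: filterS (lt_nbhsr lt2) => z /ltW.
have hc : \forall t' \near t, sball (circ n (t - 8 * n%:R)) r (circ n (t' - 8 * n%:R)).
  have c : (fun t' => t' - 8 * n%:R) @ t --> t - 8 * n%:R by apply: cvgB; [exact: cvg_id|exact: cvg_cst].
  exact: c _ (circ_cvg n (t - 8 * n%:R) r0).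
by apply: filterS2 near_idx hc => t' e h; rewrite /Gst e -/n.
Unshelve. all: by end_near. Qed.

End CircleCoding.

(** * Measurability of coding and decoding *)

Section CodingMeasurability.
Variable R : realType.

(** [acos] is decreasing, so acos a > c means a < cos c; thresholds outside [0, pi) give everything
    or nothing. *)
Lemma measurable_acos_re n : measurable_fun [set: Bstate R]
  (fun psi : Bstate R => acos (complex.Re ((psi : state R) n))).
Proof.
move=> mD; apply: (measurability _ (RGenOInfty.measurableE R)) => //.
move=> /= _ [_ [c ->] <-]; rewrite setTI.
have mre : measurable_fun [set: Bstate R] (fun psi : Bstate R => complex.Re ((psi : state R) n)).
  by apply: scontinuous_measurable; exact: scontinuous_re.
have [c0|c0] := ltP c 0.
  rewrite (_ : _ @^-1` _ = setT)//; apply/seteqP; split => // psi _.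
  rewrite /= in_itv /= andbT; apply: lt_le_trans c0 _; apply: acos_ge0; exact: re_le1.
have [cp|cp] := leP pi c.
  rewrite (_ : _ @^-1` _ = set0)//; apply/seteqP; split => // psi /=.
  rewrite in_itv /= andbT ltNge => /negP; apply; apply: le_trans cp; apply: acos_lepi; exact: re_le1.
rewrite (_ : _ @^-1` _ = [set: Bstate R] `&` (fun psi : Bstate R => complex.Re ((psi : state R) n)) @^-1` `]-oo, cos c[%classic).
  by apply: mre => //; exact: measurable_itv.
have cI : c \in `[0, pi]%R by rewrite in_itv /= c0 ltW.
rewrite setTI; apply/seteqP; split => psi /=; rewrite !in_itv /= andbT.
all: have r1 := re_le1 (psi : state R) n.
all: have aI : acos (complex.Re ((psi : state R) n)) \in `[0, pi]%R by rewrite in_itv /= acos_ge0 ?acos_lepi.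
all: have aK : cos (acos (complex.Re ((psi : state R) n))) = complex.Re ((psi : state R) n) by apply: acosK; rewrite in_itv.
  by move=> h; rewrite -aK ltr_cos.
by rewrite -{1}aK ltr_cos.
Qed.

Lemma measurable_chart n : measurable_fun [set: Bstate R] (fun psi : Bstate R => chart ((psi : state R) n)).
Proof.
apply: measurable_fun_ifT.
- apply: measurable_fun_ler; first exact: measurable_cst.
  by apply: scontinuous_measurable; exact: scontinuous_im.
- exact: measurable_acos_re.
- by apply: measurableT_comp; [exact: oppr_measurable|exact: measurable_acos_re].
Qed.

Lemma measurable_hcode : measurable_fun [set: Bstate R] (@hcode R : Bstate R -> R).
Proof.
move=> _ A mA; rewrite setTI.
pose H n : set (Bstate R) := [set psi | 2^-1 < sqmod ((psi : state R) n)].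
have mH n : measurable (H n).
  rewrite (_ : H n = [set: Bstate R] `&` (fun psi : Bstate R => sqmod ((psi : state R) n)) @^-1` `]2^-1, +oo[%classic).
    by apply: measurable_sqmod; [exact: measurableT|exact: measurable_itv].
  by rewrite setTI; apply/seteqP; split => psi /=; rewrite /H /= in_itv /= andbT.
have mC n : measurable ((fun psi : Bstate R => 8 * n%:R + chart ((psi : state R) n)) @^-1` A).
  have m : measurable_fun [set: Bstate R] (fun psi : Bstate R => 8 * n%:R + chart ((psi : state R) n)).
    by apply: measurable_funD; [exact: measurable_cst|exact: measurable_chart].
  by rewrite -[X in measurable X]setTI; exact: m.
rewrite (_ : _ @^-1` A = (\bigcup_n (H n `&` (fun psi : Bstate R => 8 * n%:R + chart ((psi : state R) n)) @^-1` A))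
   `|` ((\bigcap_n ~` H n) `&` (fun _ : Bstate R => 0) @^-1` A)).
  apply: measurableU; first by apply: bigcupT_measurable => n; apply: measurableI.
  apply: measurableI; first by apply: bigcapT_measurable => n; apply: measurableC.
  by rewrite -[X in measurable X]setTI; apply: measurable_cst.
apply/seteqP; split => psi /=.
- have [[n hn]|h] := pselect (exists n, 2^-1 < sqmod ((psi : state R) n)).
    by rewrite (hcodeE hn) => hA; left; exists n.
  have h' n : sqmod ((psi : state R) n) <= 2^-1 by rewrite leNgt; apply/negP => hn; apply: h; exists n.
  rewrite (hcode0 h') => hA; right; split => // n _; rewrite /H /=; apply/negP; rewrite -leNgt; exact: h'.
- case=> [[n _ [/= hn]]|[h hA]]; first by rewrite -(hcodeE hn).
  rewrite hcode0// => n; rewrite leNgt; apply/negP; exact: h n I.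
Qed.

Lemma idx_bounds (t : R) : t < 8 * (idx t)%:R + 4 /\ ((idx t == 0%N) || (8 * (idx t)%:R - 4 <= t)).
Proof.
have [t0|t0] := ltP ((t + 4) / 8) 0.
  have -> : idx t = 0%N by rewrite /idx truncn_floor leNgt t0.
  by split => //; rewrite mulr0; lra.
have /andP[h1 h2] := truncn_itv t0; rewrite -/(idx t) in h1 h2.
split; first by move: h2; rewrite -natr1 ltr_pdivrMr//; lra.
by apply/orP; right; move: h1; rewrite ler_pdivlMr//; lra.
Qed.

Lemma measurable_Gst : measurable_fun [set: R] (@Gst R : R -> Bstate R).
Proof.
apply: (@measurability _ _ _ (Bstate R) setT _ (@sopen R : set (set (Bstate R)))) => //.
move=> /= _ [U oU <-]; rewrite setTI.
pose J n : set R := [set t | t < 8 * n%:R + 4] `&` [set t | (n == 0%N) || (8 * n%:R - 4 <= t)].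
have mJ n : measurable (J n).
  apply: measurableI.
    rewrite (_ : [set _ | _] = `]-oo, 8 * n%:R + 4[%classic); first exact: measurable_itv.
    by apply/seteqP; split => t /=; rewrite in_itv.
  have [_|_] /= := eqVneq n 0%N.
    by rewrite (_ : [set _ | _] = setT); [exact: measurableT|apply/seteqP; split].
  rewrite (_ : [set _ | _] = `[8 * n%:R - 4, +oo[%classic); first exact: measurable_itv.
  by apply/seteqP; split => t /=; rewrite in_itv /= andbT.
have oC n : open [set t : R | U (circ n (t - 8 * n%:R))].
  rewrite openE => t /= /oU[r r0 hr]; rewrite /interior.
  have c : (fun t' => t' - 8 * n%:R) @ t --> t - 8 * n%:R by apply: cvgB; [exact: cvg_id|exact: cvg_cst].
  have hc : \forall t' \near t, sball (circ n (t - 8 * n%:R)) r (circ n (t' - 8 * n%:R)).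
    exact: c _ (circ_cvg n (t - 8 * n%:R) r0).
  by apply: filterS hc => t' /=; exact: hr.
rewrite (_ : _ @^-1` U = \bigcup_n (J n `&` [set t : R | U (circ n (t - 8 * n%:R))])).
  apply: bigcupT_measurable => n; apply: measurableI => //; exact: open_measurable.
apply/seteqP; split => t /=.
  by move=> hU; exists (idx t) => //; split; [exact: idx_bounds|exact: hU].
by move=> [n _ [[/= h1 h2] hU]]; rewrite /Gst (idxE h1 h2).
Qed.

Lemma sball_triangle (psi chi w : state R) (r : R) : 0 < r -> sball psi r w -> sball w r chi -> sball psi (2 * r) chi.
Proof.
move=> r0 h1 h2; rewrite /sball /=.
have f1 : nrm2 (fun n => psi n - w n) \is a fin_num.
  by rewrite ge0_fin_numE ?nrm2_ge0// (lt_trans h1)// ltry.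
have f2 : nrm2 (fun n => w n - chi n) \is a fin_num.
  by rewrite ge0_fin_numE ?nrm2_ge0// (lt_trans h2)// ltry.
apply: (@le_lt_trans _ _ (2 * fine (nrm2 (fun n => psi n - w n)) + 2 * fine (nrm2 (fun n => w n - chi n)))%:E).
  apply: rser_le => [n|L]; first exact: sqmod_ge0.
  have p1 : \sum_(n < L) sqmod (psi n - w n) <= fine (nrm2 (fun n => psi n - w n)).
    rewrite -lee_fin fineK//; apply: (@rser_ge _ (fun n => sqmod (psi n - w n))) => n; exact: sqmod_ge0.
  have p2 : \sum_(n < L) sqmod (w n - chi n) <= fine (nrm2 (fun n => w n - chi n)).
    rewrite -lee_fin fineK//; apply: (@rser_ge _ (fun n => sqmod (w n - chi n))) => n; exact: sqmod_ge0.
  apply: (@le_trans _ _ (2 * (\sum_(n < L) sqmod (psi n - w n)) + 2 * (\sum_(n < L) sqmod (w n - chi n)))).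
    rewrite !mulr_sumr -big_split /=; apply: ler_sum => n _.
    case: (psi n) (w n) (chi n) => a b [c e] [x y]; rewrite !complex_sub /sqmod /=.
    have := sqr_ge0 ((a - c) - (c - x)); have := sqr_ge0 ((b - e) - (e - y)); nra.
  by lra.
move: h1 h2; rewrite /sball /= -(fineK f1) -(fineK f2) !lte_fin exprMn.
by rewrite (_ : 2 ^+ 2 = 4 :> R); [lra|ring].
Qed.

(** Uniform continuity along a compact set, here finitely many circles parametrized by [-4, 4],
    which contains every value of [chart]. *)
Lemma circ_uniform (phi : state R -> R) N (e : R) : scontinuous phi -> 0 < e ->
  exists2 r : R, 0 < r & forall n, (n < N)%N -> forall s psi, -4 <= s <= 4 ->
    sball (circ n s) r psi -> `|phi (circ n s) - phi psi| < e.
Proof.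
move=> cphi e0.
pose P n (r : R) := forall s psi, -4 <= s <= 4 -> sball (circ n s) r psi -> `|phi (circ n s) - phi psi| < e.
apply: (@unif_pos R P N) => [n r r' r'0 rr h s psi s4 hb|n _].
  by apply: h => //; apply: sball_mono hb => //; exact: ltW.
have e2 : 0 < e / 2 by rewrite divr_gt0.
have /compact_near_coveringP cov := @segment_compact R (-4) 4.
have := cov R (0 : R)^'+ (fun r s => forall psi, sball (circ n s) r psi -> `|phi (circ n s) - phi psi| < e) _.
case.
  move=> s _; have [r0 r00 hr0] := cphi (circ n s) _ e2.
  have r2 : 0 < r0 / 2 by rewrite divr_gt0.
  exists ([set s' | sball (circ n s) (r0 / 2) (circ n s')], [set r : R | 0 < r < r0 / 2]) => /=.
    split; first exact: circ_cvg.
    by near=> r; apply/andP; split; near: r; [exact: nbhs_right_gt|exact: nbhs_right_lt].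
  move=> [s' r] [/= hs /andP[rp rr]] psi hb.
  have h1 : `|phi (circ n s) - phi (circ n s')| < e / 2.
    apply: hr0; apply: sball_mono hs; [exact: ltW|lra].
  have h2 : `|phi (circ n s) - phi psi| < e / 2.
    apply: hr0; rewrite (_ : r0 = 2 * (r0 / 2)); last by field.
    apply: sball_triangle hs _ => //; apply: sball_mono hb; exact: ltW.
  have := ler_distD (phi (circ n s)) (phi (circ n s')) (phi psi); rewrite (distrC (phi (circ n s')) (phi (circ n s))); lra.
move=> d /= d0 hd; exists (d / 2); first by rewrite divr_gt0.
move=> s psi s4; apply: (hd (d / 2)) => //=.
- by rewrite /ball /= sub0r normrN gtr0_norm ?divr_gt0//; lra.
- by rewrite divr_gt0.
Unshelve. all: by end_near. Qed.

End CodingMeasurability.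

(** * The distribution function of the code *)

Section LawOfCode.
Variable R : realType.

Definition mkRV (d d' : measure_display) (T : measurableType d) (T' : measurableType d')
  (P : probability T R) (f : T -> T') (mf : measurable_fun setT f) : {RV P >-> T'} :=
  HB.pack f (isMeasurableFun.Build _ _ _ _ f mf).

Definition unif : probability (measurableTypeR R) R := uniform_prob (@ltr01 R).

Lemma unif_itv (c : R) : 0 <= c <= 1 -> unif `]c, 1[%classic = (1 - c)%:E.
Proof.
move=> /andP[c0 c1].
rewrite -[LHS]/(\int[lebesgue_measure]_(x in [set` `]c, (1 : R)[%R]) (uniform_pdf 0 1 x)%:E)%E.
rewrite (eq_integral (cst 1%:E)); last first.
  move=> x; rewrite inE /= in_itv /= => /andP[cx x1].
  by rewrite /uniform_pdf (ltW x1) (ltW (le_lt_trans c0 cx)) /= subr0 invr1.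
rewrite integral_cst//= mul1e lebesgue_measure_itv /= lte_fin.
case: ltP => // h; have -> : c = 1 by lra.
by rewrite subrr.
Qed.

Variable P : probability (Bstate R) R.

Definition hcdf (c : R) : R := fine (P [set psi : Bstate R | hcode psi <= c]).

Lemma measurable_hle c : measurable [set psi : Bstate R | hcode psi <= c].
Proof.
rewrite (_ : [set _ | _] = [set: Bstate R] `&` (@hcode R : Bstate R -> R) @^-1` `]-oo, c]%classic).
  by apply: measurable_hcode; [exact: measurableT|exact: measurable_itv].
by rewrite setTI; apply/seteqP; split => psi /=; rewrite in_itv.
Qed.

Lemma hcdfK c : (hcdf c)%:E = P [set psi : Bstate R | hcode psi <= c].
Proof. by rewrite fineK// fin_num_measure//; exact: measurable_hle. Qed.

Lemma hcdf01 c : 0 <= hcdf c <= 1.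
Proof. by rewrite -!lee_fin hcdfK measure_ge0 probability_le1//; exact: measurable_hle. Qed.

Lemma hcdf_mono c c' : c <= c' -> hcdf c <= hcdf c'.
Proof.
move=> cc; rewrite -lee_fin !hcdfK; apply: le_measure; rewrite ?inE; [exact: measurable_hle|exact: measurable_hle|].
by move=> psi /= h; exact: le_trans cc.
Qed.

Lemma hcdf_gap c c' : c <= c' -> (forall psi : state R, ~ (c < hcode psi <= c')) -> hcdf c = hcdf c'.
Proof.
move=> cc h; congr (fine (P _)); apply/seteqP; split => psi /=; first by move=> h'; exact: le_trans cc.
by move=> h'; rewrite leNgt; apply/negP => h''; apply: (h psi); rewrite h''.
Qed.

Lemma hcdf_low c : c < - pi -> hcdf c = 0.
Proof.
move=> cp; rewrite /hcdf (_ : [set _ | _] = set0) ?measure0//; apply/seteqP; split => // psi /=.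
have [n] := hcode_range psi; have : 0 <= n%:R :> R by []; lra.
Qed.

Lemma hcdf_high u : u < 1 -> exists q : rat, u < hcdf (ratr q).
Proof.
move=> u1; pose A n : set (Bstate R) := [set psi | hcode psi <= n%:R].
have cup : \bigcup_n A n = setT.
  apply/seteqP; split => // psi _; exists (Num.bound (hcode psi)) => //=.
  rewrite /A /=; have [h|h] := leP 0 (hcode psi); first by rewrite ltW// archi_boundP.
  by apply: ltW; apply: lt_le_trans h _.
have c : P \o A @ \oo --> 1%:E.
  rewrite -(probability_setT P) -cup; apply: nondecreasing_cvg_mu.
  - by move=> i; exact: measurable_hle.
  - by rewrite cup; exact: measurableT.
  - move=> m n mn; apply/subsetPset => psi /= h; apply: le_trans h _; by rewrite ler_nat.
have /fine_cvgP[_ /cvgr_gt -/(_ _ u1) [N _ hN]] := c.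
by exists N%:R; rewrite ratr_nat; apply: (hN N) => /=.
Qed.

Lemma hcdf_right c u : hcdf c < u -> exists2 q : rat, c < ratr q & hcdf (ratr q) < u.
Proof.
move=> cu; pose A n : set (Bstate R) := [set psi | hcode psi <= c + n.+1%:R^-1].
have cap : \bigcap_n A n = [set psi : Bstate R | hcode psi <= c].
  apply/seteqP; split => psi /=.
    move=> h; apply/ler_addgt0Pr => e e0.
    have [N _ hN] := near_infty_natSinv_lt (PosNum e0).
    have := h N I; rewrite /A /= => /le_trans; apply; rewrite lerD2l ltW//; exact: (hN N (leqnn N)).
  by move=> h n _; rewrite /A /=; apply: (le_trans h); rewrite lerDl invr_ge0.
have cv : P \o A @ \oo --> (hcdf c)%:E.
  rewrite hcdfK -cap; apply: nonincreasing_cvg_mu.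
  - by rewrite (le_lt_trans (probability_le1 _ _)) ?ltry//; exact: measurable_hle.
  - by move=> i; exact: measurable_hle.
  - by rewrite cap; exact: measurable_hle.
  - move=> m n mn; apply/subsetPset => psi /= h; apply: le_trans h _.
    by rewrite lerD2l lef_pV2 ?posrE// ler_nat ltnS.
have /fine_cvgP[_ /cvgr_lt -/(_ _ cu) [N _ hN]] := cv.
have [q /itvP hq] : exists q : rat, ratr q \in `]c, (c + N.+1%:R^-1)[%R.
  by apply: rat_in_itvoo; rewrite ltrDl invr_gt0.
exists q; first by rewrite hq.
by apply: le_lt_trans (hN N (leqnn N)); apply: hcdf_mono; rewrite ltW// hq.
Qed.

Lemma hcdf_like : cdf_like (fun q : rat => hcdf (ratr q)).
Proof.
split.
- by move=> p q pq; apply: hcdf_mono; rewrite ler_rat.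
- exists (-4); rewrite hcdf_low// rmorphN /= ratr_nat; have := pi_lt4 R; lra.
- exact: hcdf_high.
Qed.

End LawOfCode.

Section QuantileMap.
Variable R : realType.

Definition qmap (F : rat -> R) (u : R) : R := if 0 < u < 1 then quant F u else 0.

Lemma qmap_preimage F c : cdf_like F -> qmap F @^-1` `]c, +oo[%classic =
  (`]0, 1[%classic `&` \bigcup_q (if c < ratr q then `]F q, +oo[%classic else set0)) `|`
  (if c < 0 then ~` `]0, 1[%classic else set0).
Proof.
move=> hF; apply/seteqP; split => u /=; rewrite !in_itv /= ?andbT /qmap.
  case: ifP => [u01 /(quant_gtP hF u01)[q cq qu]|/negP h c0]; [left|right].
    by split => //; exists q => //; rewrite cq /= in_itv /= andbT.
  by rewrite c0 /= in_itv.
case=> [[u01 [q _]]|].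
  rewrite u01; case: ifP => // cq /=; rewrite in_itv /= andbT => qu.
  by apply/(quant_gtP hF u01); exists q.
by case: ifP => // c0; rewrite /= in_itv /= => /negP/negbTE ->.
Qed.

Lemma measurable_qmap F : cdf_like F ->
  measurable_fun [set: measurableTypeR R] (qmap F : measurableTypeR R -> R).
Proof.
move=> hF; apply: (measurability _ (RGenOInfty.measurableE R)) => _ [_ [c ->] <-].
rewrite setTI qmap_preimage//; apply: measurableU.
  apply: measurableI; first exact: measurable_itv.
  by apply: bigcupT_measurable_rat => q; case: ifP => // _; exact: measurable_itv.
by case: ifP => // _; apply: measurableC; exact: measurable_itv.
Qed.

Lemma unif01 : unif R (~` `]0, 1[%classic) = 0%E.
Proof.
rewrite probability_setC; last exact: measurable_itv.
by rewrite unif_itv ?lexx ?ler01// subr0 subee.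
Qed.

(** By right continuity of [hcdf], the quantile at u exceeds c exactly when [hcdf P c] is below u,
    an event of uniform mass 1 - [hcdf P c]. *)
Lemma unif_qmap_ray (P : probability (Bstate R) R) c :
  unif R (qmap (fun q => hcdf P (ratr q)) @^-1` `]c, +oo[%classic) =
  P ((@hcode R : Bstate R -> R) @^-1` `]c, +oo[%classic).
Proof.
have hF := hcdf_like P.
have -> : (@hcode R : Bstate R -> R) @^-1` `]c, +oo[%classic = ~` [set psi : Bstate R | hcode psi <= c].
  by apply/seteqP; split => psi /=; rewrite in_itv /= andbT ltNge => /negP.
rewrite probability_setC; last exact: measurable_hle.
rewrite -hcdfK -EFinB -unif_itv ?hcdf01//.
have mX : measurable (qmap (fun q => hcdf P (ratr q)) @^-1` `]c, +oo[%classic : set (measurableTypeR R)).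
  by rewrite -[X in measurable X]setTI; apply: measurable_qmap => //; exact: measurable_itv.
rewrite (measureDI _ mX (measurable_itv `]0, 1[%R)) [X in (X + _)%E](_ : _ = 0%E) ?add0e; last first.
  apply/eqP; rewrite eq_le measure_ge0 andbT -unif01; apply: le_measure; rewrite ?inE.
  - by apply: measurableD => //; exact: measurable_itv.
  - by apply: measurableC; exact: measurable_itv.
  - by move=> u [].
congr (unif R _); apply/seteqP; split => u /=; rewrite !in_itv /= /qmap.
  move=> [+ u01]; rewrite u01 andbT => /(quant_gtP hF u01)[q cq qu].
  by case/andP: u01 => _ ->; rewrite andbT (le_lt_trans _ qu)//; apply: hcdf_mono; exact: ltW.
move=> /andP[cu u1]; have u01 : 0 < u < 1.
  by rewrite u1 (le_lt_trans _ cu)//; case/andP: (hcdf01 P c).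
by rewrite u01; split => //; rewrite andbT; apply/(quant_gtP hF u01); exact: hcdf_right.
Qed.

(** Rays generate the Borel sets and are stable under intersection, so the code and the quantile map
    have the same law. *)
Lemma integral_hcode (P : probability (Bstate R) R) (g : R -> \bar R) :
  measurable_fun [set: R] g -> (forall t, 0 <= g t)%E ->
  (\int[P]_x g (hcode (x : state R)) = \int[unif R]_u g (qmap (fun q => hcdf P (ratr q)) u))%E.
Proof.
move=> mg g0.
pose X : {RV P >-> R} := mkRV P (@measurable_hcode R).
pose Y : {RV unif R >-> R} := mkRV (unif R) (measurable_qmap (hcdf_like P)).
transitivity (\int[distribution P X]_y g y)%E.
  by rewrite ge0_integral_distribution.
transitivity (\int[distribution (unif R) Y]_y g y)%E; last first.
  by rewrite ge0_integral_distribution.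
apply: eq_measure_integral => A mA _; symmetry.
apply: (measure_unique (@RGenOInfty.G R) (fun n => `](- n%:R), +oo[%classic)) => //.
- exact: RGenOInfty.measurableE.
- move=> _ _ [x ->] [y ->]; exists (Order.max x y); apply/seteqP; split => t /=; rewrite !in_itv /= !andbT gt_max.
    by case=> -> ->.
  by case/andP.
- by move=> n; exists (- n%:R).
- apply/seteqP; split => // t _; exists (Num.bound `|t|) => //=; rewrite in_itv /= andbT.
  by have := archi_boundP (normr_ge0 t); rewrite ltr_norml => /andP[].
- by move=> _ [c ->]; exact: unif_qmap_ray.
- by move=> k; rewrite (le_lt_trans (probability_le1 _ _)) ?ltry//; exact: measurable_itv.
Qed.

End QuantileMap.

(** * Weak compactness *)

Section Compactness.
Variable R : realType.

Definition concentrated N (eta : R) : set (Bstate R) :=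
  [set psi | exists2 n, (n < N)%N & 1 - eta < sqmod ((psi : state R) n)].

Lemma measurable_concentrated N eta : measurable (concentrated N eta).
Proof.
rewrite (_ : concentrated N eta = \bigcup_(n in [set n | (n < N)%N])
    ([set: Bstate R] `&` (fun psi : Bstate R => sqmod ((psi : state R) n)) @^-1` `]1 - eta, +oo[%classic)).
  by apply: bigcup_measurable => n _; apply: measurable_sqmod => //; exact: measurable_itv.
apply/seteqP; split => psi [n nN].
  by move=> h; exists n => //=; split => //=; rewrite in_itv /= andbT.
by move=> [_ /=]; rewrite in_itv /= andbT => h; exists n.
Qed.

Variable lam : nat -> probability (Bstate R) R.
Hypothesis lam_conc : forall eta e : R, 0 < eta < 1 -> 0 < e ->
  exists N, \forall k \near \oo, (lam k (~` concentrated N eta) <= e%:E)%E.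

(* A state has at most one coordinate of squared modulus above 1/2, so the number
   of coordinates needed for eta = 1/2 serves every smaller eta. *)
Lemma lam_conc_unif (e : R) : 0 < e -> exists N, forall eta, 0 < eta <= 2^-1 ->
  \forall k \near \oo, (lam k (~` concentrated N eta) <= e%:E)%E.
Proof.
move=> e0; have e2 : 0 < e / 2 by lra.
have [|N hN] := @lam_conc 2^-1 (e / 2) _ e2; first by lra.
exists N => eta eta0; have [|N' hN'] := @lam_conc eta (e / 2) _ e2; first by lra.
near=> k.
have m (M : nat) a : measurable (~` concentrated M a) by apply: measurableC; exact: measurable_concentrated.
rewrite (splitr e) EFinD.
apply: (@le_trans _ _ (lam k (~` concentrated N 2^-1) + lam k (~` concentrated N' eta))%E); last first.
  by apply: leeD; near: k.
apply: le_trans (measureU2 (lam k) (m _ _) (m _ _)); apply: le_measure; rewrite ?inE; [exact: m|exact: measurableU|].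
move=> psi hb; apply/not_andP => -[[n nN hn] [n' _ hn']]; apply: hb.
have nn' : n = n' by apply: (@half_uniq _ psi); lra.
by exists n => //; rewrite nn'.
Unshelve. all: by end_near. Qed.

Let F k q := hcdf (lam k) (ratr q).

(** No mass escapes to infinity: states concentrated on a coordinate below N have codes below 8
    N. *)
Lemma hcdf_tight u : u < 1 -> exists q : rat, \forall k \near \oo, u <= F k q.
Proof.
move=> u1; have u1' : 0 < 1 - u by lra.
have [|N hN] := @lam_conc 2^-1 _ _ u1'; first by lra.
exists (8 * N)%:R; near=> k; rewrite -lee_fin hcdfK ratr_nat.
have h : (lam k (~` concentrated N 2^-1) <= (1 - u)%:E)%E by near: k.
rewrite probability_setC in h; last exact: measurable_concentrated.
apply: (@le_trans _ _ (lam k (concentrated N 2^-1))).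
  have /fineK e := fin_num_measure (lam k) _ (measurable_concentrated N 2^-1).
  by move: h; rewrite -e -EFinB !lee_fin; lra.
apply: le_measure; rewrite ?inE; [exact: measurable_concentrated|exact: measurable_hle|].
move=> psi [n nN hn] /=; rewrite (@hcodeE _ _ n); last by lra.
have /andP[_ h2] := chart_pi psi n; have p4 := pi_lt4 R.
have : n.+1%:R <= N%:R :> R by rewrite ler_nat.
by rewrite natrM -natr1; lra.
Unshelve. all: by end_near. Qed.

Lemma helly : exists (g : nat -> nat) (F0 : rat -> R),
  [/\ {homo g : m n / (m < n)%N >-> (m < n)%N}, cdf_like F0 &
      forall q, (fun k => F (g k) q) @ \oo --> F0 q].
Proof.
have [|g [G [hg cG]]] := @diag_extract R (fun k i => F k (odflt 0 (unpickle i))).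
  by move=> k i; exact: hcdf01.
have cF q : (fun k => F (g k) q) @ \oo --> G (pickle q).
  by have := cG (pickle q); rewrite pickleK.
exists g, (fun q => G (pickle q)); split => //; split.
- move=> p q pq; apply: (ler_cvg_to (cF p) (cF q)); apply: nearW => k.
  by apply: hcdf_mono; rewrite ler_rat.
- exists (-4); apply: (ler_cvg_to (cF (-4)) (cvg_cst 0)); apply: nearW => k.
  by rewrite /F hcdf_low// rmorphN /= ratr_nat; have := pi_lt4 R; lra.
(* The midpoint leaves room, since limits keep only weak inequalities. *)
- move=> u u1; have [q hq] := @hcdf_tight ((u + 1) / 2) ltac:(lra).
  exists q; apply: (@lt_le_trans _ _ ((u + 1) / 2)); first by lra.
  apply: (ler_cvg_to (cvg_cst _) (cF q)).
  by have := homo_lt_cvg hg hq.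
Qed.

End Compactness.

Section IntegralComparison.
Context (d : measure_display) (T : measurableType d) (R : realType) (P : probability T R).
Variables (g h : T -> R) (M e : R) (S : set T).
Hypothesis mg : measurable_fun [set: T] g.
Hypothesis mh : measurable_fun [set: T] h.
Hypothesis mS : measurable S.
Hypothesis gM : forall x, 0 <= g x <= M.
Hypothesis h0 : forall x, 0 <= h x.
Hypothesis e0 : 0 <= e.
Hypothesis ghS : forall x, S x -> g x <= h x + e.

Lemma integral_le_off : (\int[P]_x (g x)%:E <= \int[P]_x (h x)%:E + (e%:E + M%:E * P (~` S)))%E.
Proof.
have M0 : 0 <= M by have /andP[] := gM point; exact: le_trans.
have mC : measurable (~` S) by exact: measurableC.
have mI : measurable_fun [set: T] (fun x => (\1_(~` S) x : R)%:E).
  by apply/measurable_EFinP; exact: measurable_indic.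
have -> : (M%:E * P (~` S))%E = (\int[P]_x (M%:E * (\1_(~` S) x : R)%:E))%E.
  by rewrite ge0_integralZl//= ?integral_indic ?setIT// ?lee_fin ?M0// => x _; rewrite lee_fin.
have -> : e%:E = (\int[P]_x (cst e%:E x))%E by rewrite integral_cst//= probability_setT mule1.
have mM : measurable_fun [set: T] (fun x => (M%:E * (\1_(~` S) x : R)%:E)%E) by exact: measurable_funeM.
have mh' : measurable_fun [set: T] (fun x => (h x)%:E) by exact/measurable_EFinP.
rewrite -ge0_integralD//= -?ge0_integralD//=.
- apply: ge0_le_integral => //=.
  + by move=> x _; rewrite lee_fin; case/andP: (gM x).
  + exact/measurable_EFinP.
  + by apply: emeasurable_funD => //; apply: emeasurable_funD.
  move=> x _; rewrite lee_fin indicE; have /andP[g0 gx] := gM x.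
  have [hx|/negP hx] := boolP (x \in ~` S).
    by rewrite mulr1; apply: (le_trans gx); rewrite addrA lerDr addr_ge0.
  by rewrite mulr0 addr0; apply: ghS; apply: contrapT => hn; exact/hx/mem_set.
- by move=> x _; rewrite lee_fin.
- by move=> x _; rewrite -EFinM -EFinD lee_fin addr_ge0// mulr_ge0// ?M0.
- by apply: emeasurable_funD.
- by move=> x _; rewrite -EFinM lee_fin mulr_ge0// ?M0.
Qed.

End IntegralComparison.

Section ExtendedLimits.
Variable R : realType.

Lemma cvge_close (a b : nat -> \bar R) (l : R) : b @ \oo --> l%:E ->
  (forall e : R, 0 < e -> \forall k \near \oo, (a k <= b k + e%:E)%E /\ (b k <= a k + e%:E)%E) ->
  a @ \oo --> l%:E.
Proof.
move=> /fine_cvgP[bfin /cvgrPdist_lt bl] ab.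
have fin k (e : R) : b k \is a fin_num -> (a k <= b k + e%:E)%E /\ (b k <= a k + e%:E)%E -> a k \is a fin_num.
  by case: (a k) (b k) => [r||] [s||] // _ [].
apply/fine_cvgP; split.
  by near=> k; apply: (@fin k 1); near: k; [exact: bfin|exact: ab].
apply/cvgrPdist_lt => e e0; have e2 : 0 < e / 2 by lra.
near=> k.
have bk : b k \is a fin_num by near: k.
have abk : (a k <= b k + (e / 2)%:E)%E /\ (b k <= a k + (e / 2)%:E)%E by near: k; exact: ab.
have lk : `|l - fine (b k)| < e / 2 by near: k; exact: bl.
have ak := fin _ _ bk abk.
move: abk lk => /=; case: (a k) (b k) ak bk => [r||] [s||] //= _ _; rewrite -!EFinD !lee_fin.
by move=> [h1 h2]; rewrite !ltr_norml; lra.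
Unshelve. all: by end_near. Qed.

Lemma integrable_bounded (d : measure_display) (T : measurableType d) (P : probability T R)
  (g : T -> R) (M : R) : measurable_fun [set: T] g -> (forall x, `|g x| <= M) ->
  P.-integrable [set: T] (EFin \o g).
Proof.
move=> mg gM; apply: (le_integrable measurableT _ _ (finite_measure_integrable_cst P M measurableT)).
  exact/measurable_EFinP.
by move=> x _ /=; rewrite lee_fin (le_trans (gM x))// ler_norm.
Qed.

End ExtendedLimits.

(** * Convergence of integrals to those of the limit law *)

Section WeakConvergence.
Variable R : realType.
Variable lam : nat -> probability (Bstate R) R.
Hypothesis lam_conc : forall eta e : R, 0 < eta < 1 -> 0 < e ->
  exists N, \forall k \near \oo, (lam k (~` concentrated N eta) <= e%:E)%E.
Variable F0 : rat -> R.
Hypothesis hF0 : cdf_like F0.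
Hypothesis cF : forall q, (fun k => hcdf (lam k) (ratr q)) @ \oo --> F0 q.

(* The codes of states avoid the gaps between the circles, hence so do the quantiles. *)
Lemma quant_off_gap u n : 0 < u < 1 -> quant F0 u != 8 * n%:R + 4.
Proof.
move=> u01; have p4 := pi_lt4 R; apply/eqP => e.
have [q1 /itvP h1] : exists q : rat, ratr q \in `](8 * n%:R + pi), (8 * n%:R + 4 : R)[%R.
  by apply: rat_in_itvoo; lra.
have [q2 /itvP h2] : exists q : rat, ratr q \in `](8 * n%:R + 4), (8 * n%:R + 8 - pi : R)[%R.
  by apply: rat_in_itvoo; lra.
have [h11 h12] : 8 * n%:R + pi < ratr q1 :> R /\ ratr q1 < 8 * n%:R + 4 :> R by rewrite !h1.
have [h21 h22] : 8 * n%:R + 4 < ratr q2 :> R /\ ratr q2 < 8 * n%:R + 8 - pi :> R by rewrite !h2.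
have e12 : F0 q1 = F0 q2.
  rewrite -(cvg_lim (@Rhausdorff R) (@cF q1)); apply: (cvg_lim (@Rhausdorff R)).
  rewrite (_ : (fun k => hcdf (lam k) (ratr q1)) = (fun k => hcdf (lam k) (ratr q2))); first exact: cF.
  apply/funext => k; apply: hcdf_gap; first by lra.
  move=> psi; have [m /andP[l1 l2]] := hcode_range psi => /andP[l3 l4].
  have [mn|nm] := leqP m n.
    have : m%:R <= n%:R :> R by rewrite ler_nat.
    by lra.
  have : n.+1%:R <= m%:R :> R by rewrite ler_nat.
  by rewrite -natr1; lra.
have [h|h] := ltP (F0 q1) u.
  by rewrite e12 in h; have := quant_lb hF0 u01 h; lra.
by have := quant_ub hF0 u01 h; lra.
Qed.

Definition limit_law : probability (Bstate R) R :=
  distribution (unif R) (mkRV (unif R) (measurableT_comp (@measurable_Gst R) (measurable_qmap hF0))).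

Variables (f : state R -> R) (M : R).
Hypothesis f0M : forall psi, 0 <= f psi <= M.
Hypothesis cf : scontinuous f.

Let mfG : measurable_fun [set: R] (fun t : R => (f (Gst t))%:E).
Proof.
apply/measurable_EFinP.
exact: (measurableT_comp (scontinuous_measurable cf) (@measurable_Gst R)).
Qed.

Lemma cvg_f_quant u : 0 < u < 1 -> (forall q, F0 q != u) ->
  (fun k => f (Gst (qmap (fun q => hcdf (lam k) (ratr q)) u))) @ \oo --> f (Gst (qmap F0 u)).
Proof.
move=> u01 uF0; rewrite /qmap u01.
have c := quant_cvg (fun k => hcdf_like (lam k)) hF0 cF u01 uF0.
apply: (cvg_comp _ (fun t => f (Gst t)) c).
apply/cvgrPdist_lt => e e0; have [d d0 hd] := cf (Gst (quant F0 u)) e0.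
have := Gst_near (fun n => quant_off_gap n u01) d0.
by apply: filterS => t; exact: hd.
Qed.

Lemma cvg_integral_code :
  (fun k => \int[lam k]_x (f (Gst (hcode (x : state R))))%:E)%E @ \oo -->
  (\int[limit_law]_x (f (x : state R))%:E)%E.
Proof.
have f0 psi : (0 <= (f psi)%:E)%E by rewrite lee_fin; case/andP: (f0M psi).
rewrite ge0_integral_distribution//=; last first.
  by apply/measurable_EFinP; exact: scontinuous_measurable.
under eq_fun do rewrite (integral_hcode (lam _) mfG) //.
have mq F : cdf_like F -> measurable_fun [set: measurableTypeR R] (fun u : R => (f (Gst (qmap F u)))%:E).
  move=> hF; apply: (measurableT_comp mfG); exact: measurable_qmap.
have [] := @dominated_convergence _ _ _ (unif R) setT measurableT
  (fun k u => (f (Gst (qmap (fun q => hcdf (lam k) (ratr q)) u)))%:E)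
  (fun u => (f (Gst (qmap F0 u)))%:E) (EFin \o cst M).
- by move=> k; apply: mq; exact: hcdf_like.
- exact: mq.
(* The null set collects the points where [qmap] takes its default and the countably many levels of
   [F0]. *)
- exists (~` `]0, 1[%classic `|` F0 @` [set: rat]).
  have mC : measurable (F0 @` [set: rat] : set (measurableTypeR R)).
    apply: countable_measurable => [t|]; first exact: measurable_set1.
    exact: sub_countable (card_image_le _ _) (countableP _).
  have mI : measurable (~` `]0, 1[%classic : set (measurableTypeR R)).
    by apply: measurableC; exact: measurable_itv.
  split; first exact: measurableU.
    apply/eqP; rewrite eq_le measure_ge0 andbT.
    have u0 : unif R (F0 @` [set: rat]) = 0%E.
      apply: (@dominates_uniform_prob _ _ _ (@ltr01 R) (F0 @` [set: rat])) => //.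
      apply/measure0_null_setP => //; apply: countable_lebesgue_measure0.
      exact: sub_countable (card_image_le _ _) (countableP _).
    rewrite [leRHS](_ : 0%E = (unif R (~` [set` `]0, 1[%R]) + unif R (F0 @` [set: rat]))%E).
      exact: measureU2 mI mC.
    by rewrite unif01 u0 adde0.
  move=> u /= /not_implyP[_ h]; rewrite in_itv /=; apply: contrapT => /not_orP[/contrapT u01 hu].
  apply: h; apply/cvg_EFin; first exact: nearW.
  by apply: cvg_f_quant => // q; apply/eqP => e; apply: hu; exists q.
- exact: finite_measure_integrable_cst.
- by apply: aeW => u k _ /=; move: (Gst _) => x; have /andP[x0 xM] := f0M x; rewrite ger0_norm.
- by move=> _ _; apply.
Qed.

Lemma integral_code_near (e : R) : 0 < e -> \forall k \near \oo,
  ((\int[lam k]_x (f (x : state R))%:E <= \int[lam k]_x (f (Gst (hcode (x : state R))))%:E + e%:E)%E /\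
   (\int[lam k]_x (f (Gst (hcode (x : state R))))%:E <= \int[lam k]_x (f (x : state R))%:E + e%:E)%E).
Proof.
move=> e0; have M0 : 0 <= M by case/andP: (f0M point); exact: le_trans.
pose e' := e / (2 * (M + 1)).
have e'0 : 0 < e' by rewrite divr_gt0// mulr_gt0// ltr_wpDl.
have [N hN] := lam_conc_unif lam_conc e'0.
have e20 : 0 < e / 2 by lra.
have [r r0 hr] := circ_uniform N cf e20.
(* The bound 1/2 makes the dominant coordinate the coded one; r^2 / 2 puts the state within r of its
   decoded point. *)
pose eta := Num.min 2^-1 (r ^+ 2 / 2).
have eta0 : 0 < eta by rewrite lt_min invr_gt0 ltr0n divr_gt0// exprn_gt0.
have eta1 : eta <= 2^-1 by rewrite ge_min lexx.
have eta2 : eta <= r ^+ 2 / 2 by rewrite ge_min lexx orbT.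
have close (x : state R) : concentrated N eta x -> `|f (Gst (hcode x)) - f x| < e / 2.
  move=> [n nN hn]; rewrite (@Gst_hcode _ x n); last by lra.
  have := chart_pi x n; have p4 := pi_lt4 R => c4.
  by apply: hr => //; [lra|apply: circ_chart_near => //; lra].
near=> k.
have hk : (lam k (~` concentrated N eta) <= e'%:E)%E by near: k; apply: hN; rewrite eta0.
have hM : ((e / 2)%:E + M%:E * lam k (~` concentrated N eta) <= e%:E)%E.
  apply: (@le_trans _ _ ((e / 2)%:E + M%:E * e'%:E)%E); first by rewrite leeD2l// lee_pmul// lee_fin.
  rewrite -EFinM -EFinD lee_fin.
  have : (M + 1) * e' = e / 2 by rewrite /e'; field; lra.
  by lra.
have mf := scontinuous_measurable cf.
have mfc : measurable_fun [set: Bstate R] (fun x : Bstate R => f (Gst (hcode (x : state R)))).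
  exact: (measurableT_comp mf (measurableT_comp (@measurable_Gst R) (@measurable_hcode R))).
have mS := measurable_concentrated N eta.
have f0 x : 0 <= f x by case/andP: (f0M x).
split.
  apply: le_trans (integral_le_off (lam k) mf mfc mS f0M (fun x => f0 _) (ltW e20) _) _.
    by move=> x /close; rewrite ltr_norml; lra.
  by rewrite leeD2l.
apply: le_trans (integral_le_off (lam k) mfc mf mS (fun x => f0M _) f0 (ltW e20) _) _.
  by move=> x /close; rewrite ltr_norml; lra.
by rewrite leeD2l.
Unshelve. all: by end_near. Qed.

Lemma cvg_integral_limit_law :
  (fun k => \int[lam k]_x (f (x : state R))%:E)%E @ \oo --> (\int[limit_law]_x (f (x : state R))%:E)%E.
Proof.
have lf : (\int[limit_law]_x (f (x : state R))%:E)%E \is a fin_num.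
  apply: integrable_fin_num => //; apply: (@integrable_bounded _ _ _ _ _ M).
    exact: scontinuous_measurable.
  by move=> x; have /andP[x0 xM] := f0M x; rewrite ger0_norm.
rewrite -(fineK lf); apply: cvge_close integral_code_near.
by rewrite fineK//; exact: cvg_integral_code.
Qed.

End WeakConvergence.

(** * Convergent subsequences and concentration of the laws *)

Section Prokhorov.
Variable R : realType.

(** Reduces bounded test functions to nonnegative ones. *)
Lemma integral_shift (P : probability (Bstate R) R) (f : state R -> R) (M : R) :
  scontinuous f -> (forall x, `|f x| <= M) ->
  (\int[P]_x (f (x : state R))%:E = \int[P]_x (f (x : state R) + M)%:E - M%:E)%E.
Proof.
move=> cf fM; have mf := scontinuous_measurable cf.
under [in RHS]eq_integral do rewrite EFinD.
rewrite integralD//; last 2 first.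
- exact: (@integrable_bounded _ _ (Bstate R) P (f : Bstate R -> R) M mf fM).
- exact: (finite_measure_integrable_cst P M measurableT).
by rewrite integral_cst//= probability_setT mule1 addeK.
Qed.

Lemma prokhorov (lam : nat -> probability (Bstate R) R) :
  (forall eta e : R, 0 < eta < 1 -> 0 < e ->
     exists N, \forall k \near \oo, (lam k (~` concentrated N eta) <= e%:E)%E) ->
  exists g : nat -> nat, {homo g : m n / (m < n)%N >-> (m < n)%N} /\
  exists mu, wconv (lam \o g) mu.
Proof.
move=> conc; have [g [F0 [hg hF0 cF]]] := helly conc.
exists g; split => //; exists (limit_law hF0) => f [M fM] cf.
have conc' eta e : 0 < eta < 1 -> 0 < e ->
    exists N, \forall k \near \oo, ((lam \o g) k (~` concentrated N eta) <= e%:E)%E.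
  by move=> h1 h2; have [N hN] := conc _ _ h1 h2; exists N; exact: (homo_lt_cvg hg hN).
rewrite /Eexp (integral_shift _ cf fM); under eq_fun do rewrite (integral_shift _ cf fM).
apply: cvgeB; [by rewrite fin_num_adde_defl| |exact: cvg_cst].
apply: (@cvg_integral_limit_law _ (lam \o g) conc' _ hF0 cF (fun x => f x + M) (M + M)).
- by move=> x; move: (fM x); rewrite ler_norml; lra.
- exact: (scontinuousD cf (scontinuous_cst M)).
Qed.

Lemma prob_le_integral (P : probability (Bstate R) R) (A : set (Bstate R)) (g : Bstate R -> \bar R) :
  measurable A -> (forall x, 0 <= g x)%E -> (forall x, A x -> 1 <= g x)%E -> (P A <= \int[P]_x g x)%E.
Proof.
move=> mA g0 g1; rewrite -[A]setIT -(integral_indic P measurableT mA); apply: lint_le => x.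
  by rewrite lee_fin.
by rewrite indicE; have [/set_mem hx|hx] := boolP (x \in A); [exact: g1|exact: g0].
Qed.

Variables (nbar : nat) (theta phi B : R) (lam : nat -> probability (Bstate R) R).
Hypothesis hA1 : A1 theta phi.
Hypothesis lam_spread : (fun k => (\int[lam k]_x (spread theta phi (x : state R) ^+ 2)%:E)%E) @ \oo --> 0%E.
Hypothesis lam_W : forall k, (\int[lam k]_x wsum (sigma R nbar) (x : state R) <= B%:E)%E.

(** A state that is not concentrated has spread at least v or tail mass at least eta / 2; the first
    is unlikely because the spread tends to 0, the second because W has bounded mean. *)
Lemma spread_W_concentrated (eta e : R) : 0 < eta < 1 -> 0 < e ->
  exists N, \forall k \near \oo, (lam k (~` concentrated N eta) <= e%:E)%E.
Proof.
move=> eta01 e0; have eta0 : 0 < eta by case/andP: eta01.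
have B0 : 0 <= B.
  by rewrite -lee_fin (le_trans _ (lam_W 0))// integral_ge0// => x _; apply: wsum_ge0; exact: sigma_ge0.
have [N nN hN] := @sigma_unbounded R nbar (4 * (B + 1) / (eta * e)).
have s0 : 0 < sigma R nbar N by rewrite (lt_le_trans _ hN)// divr_gt0 ?mulr_gt0// ltr_wpDl.
have [v v0 hv] := spread_concentrate hA1 N eta01.
(* Tail mass eta / 2 forces W >= s eta / 2, that is, c W >= 1; N was chosen so that c B <= e / 2. *)
exists N; pose s := sigma R nbar N; pose c := 2 / (eta * s).
have c0 : 0 < c by rewrite divr_gt0// mulr_gt0.
have cB : c * B <= e / 2.
  rewrite /c mulrAC ler_pdivrMr ?mulr_gt0//.
  move: hN; rewrite ler_pdivrMr ?mulr_gt0// -/s.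
  have -> : s * (eta * e) = 2 * (e / 2 * (eta * s)) by field.
  by lra.
have w0 : 0 < (v ^+ 2)^-1 by rewrite invr_gt0 exprn_gt0.
have ve : 0 < v ^+ 2 * (e / 2) by rewrite mulr_gt0// ?divr_gt0// exprn_gt0.
have near_spread : \forall k \near \oo, (\int[lam k]_x (spread theta phi (x : state R) ^+ 2)%:E <= (v ^+ 2 * (e / 2))%:E)%E.
  have /fine_cvgP[lf /cvgrPdist_lt/(_ _ ve) lt] := lam_spread.
  near=> k; rewrite -[leLHS]fineK ?lee_fin; last by near: k.
  have : `|0 - fine (\int[lam k]_x (spread theta phi (x : state R) ^+ 2)%:E)| < v ^+ 2 * (e / 2) by near: k.
  by rewrite sub0r normrN => /ltW; apply: le_trans; exact: ler_norm.
have ms : measurable_fun [set: Bstate R] (fun x : Bstate R => (spread theta phi (x : state R) ^+ 2)%:E).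
  by apply/measurable_EFinP/measurable_funX; apply: scontinuous_measurable; exact: scontinuous_spread.
have mW : measurable_fun [set: Bstate R] (fun x : Bstate R => wsum (sigma R nbar) (x : state R)).
  by apply: measurable_wsum => n; exact: sigma_ge0.
have W0 (x : state R) : (0 <= wsum (sigma R nbar) x)%E by apply: wsum_ge0; exact: sigma_ge0.
have S0 (x : state R) : (0 <= (spread theta phi x ^+ 2)%:E)%E by rewrite lee_fin sqr_ge0.
near=> k.
apply: (@le_trans _ _ (\int[lam k]_x ((v ^+ 2)^-1%:E * (spread theta phi (x : state R) ^+ 2)%:E +
    c%:E * wsum (sigma R nbar) (x : state R)))%E).
  apply: prob_le_integral => [|x|x hx].
  - by apply: measurableC; exact: measurable_concentrated.
  - by rewrite adde_ge0// mule_ge0// lee_fin ltW.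
  - have [sv|sv] := ltP (spread theta phi x) v.
      have tl : eta / 2 <= 1 - lsum (headw R N) x.
        by rewrite leNgt; apply/negP => h; apply: hx; exact: hv.
      rewrite -[leLHS]add0e leeD//; first by rewrite mule_ge0// lee_fin ltW.
      apply: (@le_trans _ _ (c%:E * (s * (1 - lsum (headw R N) x))%:E)%E); last first.
        by rewrite lee_pmul2l ?lte_fin//; exact: tail_le_wsum.
      rewrite -EFinM lee_fin /c.
      have -> : 2 / (eta * s) * (s * (1 - lsum (headw R N) x)) = (1 - lsum (headw R N) x) / (eta / 2).
        by field; rewrite !gt_eqF.
      by rewrite ler_pdivlMr ?mul1r// divr_gt0.
    rewrite -[leLHS]adde0 leeD//; last by rewrite mule_ge0// lee_fin ltW.
    by rewrite -EFinM lee_fin mulrC ler_pdivlMr ?exprn_gt0// mul1r lerXn2r// nnegrE ?ltW// (lt_le_trans v0).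
rewrite ge0_integralD//.
- rewrite !ge0_integralZl//= ?lee_fin ?(ltW w0) ?(ltW c0)//.
  rewrite [e]splitr EFinD leeD//; last first.
    apply: (@le_trans _ _ (c%:E * B%:E)%E); first by rewrite lee_pmul2l ?lte_fin.
    by rewrite -EFinM lee_fin.
  apply: (@le_trans _ _ ((v ^+ 2)^-1%:E * (v ^+ 2 * (e / 2))%:E)%E).
    by rewrite lee_pmul2l ?lte_fin//; near: k.
  by rewrite -EFinM lee_fin mulKf// gt_eqF// exprn_gt0.
- by move=> x _; rewrite mule_ge0// lee_fin ltW.
- exact: measurable_funeM.
- by move=> x _; rewrite mule_ge0// lee_fin ltW.
- exact: measurable_funeM.
Unshelve. all: by end_near. Qed.

End Prokhorov.

(** * Choice of the parameters *)

Section ControlParameters.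
Variable R : realType.

(** The errors in t^3, in delta t^2 and in [tau] each get a quarter of k t^2. The last is not of
    order t^2 by itself, so [tau] is chosen after t. *)
Lemma gain_parameters (k Z : R) : 0 < k -> 0 <= Z -> exists delta t tau : R,
  [/\ 0 < delta <= 1, 0 < t <= 4^-1, 0 < tau <= 2^-1 &
    - k * t ^+ 2 + Z * t ^+ 3 + 16 * t * tau + 2 * delta * (Z * t ^+ 2 + tau * (4 + Z))
      <= - (k / 4 * t ^+ 2)].
Proof.
move=> k0 Z0.
have Z1 : 0 < Z + 1 by lra.
pose delta := Num.min 1 (k / (8 * (Z + 1))).
have d0 : 0 < delta by rewrite lt_min ltr01 divr_gt0// mulr_gt0.
have d1 : delta <= 1 by rewrite ge_min lexx.
have dZ : delta * (8 * (Z + 1)) <= k by rewrite -ler_pdivlMr ?mulr_gt0// ge_min lexx orbT.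
pose t := Num.min 4^-1 (k / (4 * (Z + 1))).
have t0 : 0 < t by rewrite lt_min invr_gt0 ltr0n divr_gt0// mulr_gt0.
have t1 : t <= 4^-1 by rewrite ge_min lexx.
have tZ : t * (4 * (Z + 1)) <= k by rewrite -ler_pdivlMr ?mulr_gt0// ge_min lexx orbT.
pose q := 16 * t + 2 * delta * (4 + Z).
have q0 : 0 < q by rewrite addr_gt0 ?mulr_gt0//; lra.
pose tau := Num.min 2^-1 (k * t ^+ 2 / 4 / q).
have kt0 : 0 < k * t ^+ 2 / 4 by rewrite divr_gt0// mulr_gt0// exprn_gt0.
have tau0 : 0 < tau by rewrite lt_min invr_gt0 ltr0n divr_gt0.
have tau1 : tau <= 2^-1 by rewrite ge_min lexx.
have tauq : tau * q <= k * t ^+ 2 / 4 by rewrite -ler_pdivlMr// ge_min lexx orbT.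
exists delta, t, tau; split; rewrite ?d0 ?t0 ?tau0//.
have h1 : t ^+ 2 * (t * (4 * Z)) <= t ^+ 2 * k.
  by rewrite ler_wpM2l ?sqr_ge0// (le_trans _ tZ)// ler_wpM2l ?(ltW t0)//; lra.
have h2 : t ^+ 2 * (delta * (8 * Z)) <= t ^+ 2 * k.
  by rewrite ler_wpM2l ?sqr_ge0// (le_trans _ dZ)// ler_wpM2l ?(ltW d0)//; lra.
have -> : - k * t ^+ 2 + Z * t ^+ 3 + 16 * t * tau + 2 * delta * (Z * t ^+ 2 + tau * (4 + Z)) =
  - k * t ^+ 2 + t ^+ 2 * (t * (4 * Z)) / 4 + tau * q + t ^+ 2 * (delta * (8 * Z)) / 4.
  by rewrite /q; field.
by lra.
Qed.

Lemma cvg0_scale (nu : nat -> probability (Bstate R) R) (c : R) (g : state R -> R) :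
  0 < c -> (forall x, 0 <= g x) ->
  (fun k => \int[nu k]_x (c * g (x : state R))%:E)%E @ \oo --> 0%E ->
  (fun k => \int[nu k]_x (g (x : state R))%:E)%E @ \oo --> 0%E.
Proof.
move=> c0 g0 h.
have h' : (fun k => c^-1%:E * \int[nu k]_x (c * g (x : state R))%:E)%E @ \oo --> 0%E.
  by rewrite -(mule0 c^-1%:E); apply: cvgeZl.
apply: (squeeze_cvge _ (cvg_cst 0%E) h').
apply: nearW => k; rewrite integral_ge0 /=; last by move=> x _; rewrite lee_fin.
rewrite -(@lee_pmul2l _ c%:E) ?lte_fin// muleA -EFinM mulfV ?gt_eqF// mul1e.
by under [leRHS]eq_integral do rewrite EFinM; apply: lint_scale => [|x]; [exact: ltW|rewrite lee_fin].
Qed.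

End ControlParameters.

Theorem theorem2 (R : realType) (nbar : nat) (theta phi : R) :
  A1 theta phi ->
  forall eps C : R, 0 < eps -> 0 < C ->
  exists delta abar : R, 0 < delta /\ 0 < abar /\
  forall a : state R -> R,
    feedback nbar theta phi delta abar a ->
    measurable_fun [set: Bstate R] (a : Bstate R -> R) ->
  forall (mu : probability (Bstate R) R),
    (Eexp mu (V nbar theta phi delta) <= C%:E)%E ->
  forall nu : nat -> probability (Bstate R) R,
    law_seq theta phi a mu nu ->
    (* (Gamma_k(mu))_k converges to its (nonempty) limit set Omega:
       every subsequence has a further subsequence converging weakly-* *)
    (forall f : nat -> nat, {homo f : m n / (m < n)%N >-> (m < n)%N} ->
       exists g : nat -> nat, {homo g : m n / (m < n)%N >-> (m < n)%N} /\
       exists mu_inf : probability (Bstate R) R, wconv (nu \o f \o g) mu_inf) /\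
    (forall mu_inf : probability (Bstate R) R, in_limit_set nu mu_inf ->
       (forall psi : state R, msupport mu_inf psi -> exists n : nat, is_fock_ph n psi) /\
       ((1 - eps)%:E <= mu_inf ([set psi : Bstate R | is_fock_ph nbar psi]))%E).
Proof.
move=> hA1 eps C eps0 C0.
(* C + 1 stands for C + delta, as delta <= 1 is chosen later and depends on n0. *)
have [n0 nn0 hn0] := sigma_unbounded nbar ((C + 1) / eps).
have B_eps : C + 1 <= eps * sigma R nbar n0.+1.
  by rewrite mulrC -ler_pdivrMr// (le_trans hn0)// sigma_mono.
have [k [Z [k0 Z0 gain]]] := V_gain_uniform nbar theta phi n0.
have [delta [t [tau [/andP[d0 d1] /andP[t0 t1] tau01 hpar]]]] := gain_parameters k0 Z0.
exists delta, t; do 2!split => //.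
move=> a fbP _ mu muC nu nuP.
have t01 : 0 <= t <= 4^-1 by rewrite (ltW t0).
pose c := k / 4 * t ^+ 2.
have c0 : 0 < c by rewrite mulr_gt0 ?divr_gt0// exprn_gt0.
(* The mass off |n> tolerated by [Tstep_gain] before the measurement. *)
pose eta := tau ^+ 2 / 4.
have eta01 : 0 < eta < 1.
  have /andP[tau0 tau1] := tau01; rewrite divr_gt0 ?exprn_gt0//= ltr_pdivrMr// mul1r.
  have : tau ^+ 2 <= 1 by rewrite expr_le1// ?(ltW tau0)//; lra.
  by lra.
have Tspread := Tstep_spread d0 t01 fbP.
have spread0 x : (0 <= (2 * delta * spread theta phi x ^+ 2)%:E)%E.
  by rewrite lee_fin mulr_ge0 ?sqr_ge0// mulr_ge0// ltW.
have nu_spread : (fun k => (\int[nu k]_x (spread theta phi (x : state R) ^+ 2)%:E)%E) @ \oo --> 0%E.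
  apply: (@cvg0_scale _ nu (2 * delta) (fun x => spread theta phi x ^+ 2)) => [|x|]; [by rewrite mulr_gt0|exact: sqr_ge0|].
  exact: (nu_vanish d0 t01 fbP muC nuP spread0 Tspread).
have nu_excess n : (n <= n0)%N -> n != nbar ->
    (fun k => (\int[nu k]_x (excess eta (sqmod ((x : state R) n)))%:E)%E) @ \oo --> 0%E.
  (* The gain is c / 4 where [excess] is positive, and [excess] is at most 2. *)
  move=> nn nb; apply: (@cvg0_scale _ nu (c / 8) (fun x => excess eta (sqmod (x n)))) => [|x|]; [by rewrite divr_gt0|exact: excess_ge0|].
  apply: (nu_vanish (K := fun x => (c / 8 * excess eta (sqmod (x n)))%:E) d0 t01 fbP muC nuP) => x.
    by rewrite lee_fin mulr_ge0 ?excess_ge0// ltW// divr_gt0.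
  have [h|h] := leP (sqmod (x n)) (1 - eta).
    rewrite excess_eq0// mulr0; apply: le_trans (Tspread x).
    by apply: leeD; [exact: lexx|exact: spread0].
  have Tgain : (Tstep theta phi a (V' nbar theta phi delta) x + (c / 4)%:E <= V' nbar theta phi delta x)%E.
    apply: (Tstep_gain d0 t01 fbP tau01 (ltW c0) _ h) => chi hchi.
    have := gain n t tau delta chi nn nb t01 tau01 (ltW d0) hchi.
    move=> /(leeD2r c%:E)/le_trans; apply; rewrite -addeA -EFinD -[leRHS]adde0.
    by apply: leeD; [exact: lexx|rewrite lee_fin -lerBrDr sub0r].
  apply: le_trans Tgain; apply: leeD; first exact: lexx.
  rewrite lee_fin (_ : c / 4 = c / 8 * 2); last by field.
  by rewrite ler_pM2l ?divr_gt0// excess_le2// sqmod_ge0 sqmod_le1.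
have nu_W m : (\int[nu m]_x wsum (sigma R nbar) (x : state R) <= (C + 1)%:E)%E.
  apply: le_trans (integral_W_nu d0 t01 fbP muC nuP m) _.
  by rewrite lee_fin lerD2l.
split.
  move=> f hf; apply: (@prokhorov _ (nu \o f)) => eta' e' h1 h2.
  apply: (@spread_W_concentrated _ nbar theta phi (C + 1)) => // [|m]; last exact: nu_W.
  exact: (cvg_comp _ _ (homo_lt_cvg hf) nu_spread).
move=> mu_inf [f [hf fmu]]; split.
  by move=> psi; exact: (mu_support_fock hA1 nu_spread hf fmu).
exact: (mu_target hA1 eta01 nn0 nu_spread nu_excess nu_W B_eps hf fmu).
Qed.
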